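(* Let $\nu$ be a finite measure on $[0,\infty)$ with moment generating function $g(z)=\int_0^\infty e^{zx}\,\nu(dx)$. Assume that there are $\alpha>0$ and $\delta\in[0,\frac{\pi}{2})$ such that, with $\mathcal{G}_\delta(\alpha)=\{z\in\mathbb{C}: z\ne\alpha,\ |\arg(z-\alpha)|>\delta\}$, (6.3a) $g(z)$ is analytic on $\mathcal{G}_\delta(\alpha)$ and is bounded on $\mathcal{G}_\delta(\alpha)\cap\{z\in\mathbb{C}:|z-\alpha|>\epsilon_0\}$ for some $\epsilon_0>0$; (6.3b) for some complex numbers $a,b$ and some real number $\lambda$ with $\lambda\neq0$ and $\lambda>-1$, $$\lim_{z\to\alpha,\ z\in\mathcal{G}_\delta(\alpha)}(\alpha-z)^{\lambda}\,(g(z)-a)=b .$$ Then $$\nu((x,\infty))\sim\frac{b\,\alpha^{-1}}{\Gamma(\lambda)}\,x^{\lambda-1}e^{-\alpha x}\quad\text{as }x\to\infty,$$ that is, $\lim_{x\to\infty}\nu((x,\infty))/(x^{\lambda-1}e^{-\alpha x})=b\,\alpha^{-1}/\Gamma(\lambda)$.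
   Context: $\Gamma(\cdot)$ is the gamma function. For $z\in\mathbb{C}\setminus\{0\}$, $\arg(z)\in(-\pi,\pi]$ is the angle of $z$; $(\alpha-z)^\lambda$ is the principal branch. The integral defining $g$ is a priori defined for $\Re z\le0$; $g$ also denotes its analytic continuation, so (6.3a) means that $g$ extends analytically to $\mathcal{G}_\delta(\alpha)$. For functions $f_1,f_2$, $f_1(x)\sim f_2(x)$ means $f_1(x)/f_2(x)\to1$ as $x\to\infty$. *)

(* Defs.v *)
From HB Require Import structures.
From mathcomp Require Import all_boot all_order all_algebra.
From mathcomp Require Import complex.
From mathcomp Require Import all_classical all_reals all_analysis.

Set Implicit Arguments.
Unset Strict Implicit.
Unset Printing Implicit Defensive.

Import Order.TTheory GRing.Theory Num.Theory.
Import numFieldNormedType.Exports.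

Local Open Scope classical_set_scope.
Local Open Scope ring_scope.
Local Open Scope complex_scope.

(* The topology on the complex numbers is that of the regular module R[i]^o. *)

Section ComplexFunctions.
Context {R : realType}.
Implicit Types z w : R[i].

(* The modulus as a real number; `|z| : R[i] is its image under %:C. *)
Definition cmod z : R := Num.sqrt (complex.Re z ^+ 2 + complex.Im z ^+ 2).

Definition cexp z : R[i] :=
  (expR (complex.Re z) * cos (complex.Im z)) +i*
  (expR (complex.Re z) * sin (complex.Im z)).

(* Only meaningful for z != 0; see carg_itv and carg_polar. *)
Definition carg z : R :=
  if 0 <= complex.Im z then acos (complex.Re z / cmod z)
  else - acos (complex.Re z / cmod z).

Definition clog z : R[i] := ln (cmod z) +i* carg z.

Definition cpow z (l : R) : R[i] := cexp (l%:C * clog z).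

Lemma normr_cmod z : `|z| = (cmod z)%:C.
Proof. by case: z. Qed.

Lemma cmod_gt0 z : z != 0 -> 0 < cmod z.
Proof. by move=> z0; rewrite -ltcR -normr_cmod normr_gt0. Qed.

Lemma cmod_ratio z : z != 0 -> -1 <= complex.Re z / cmod z <= 1.
Proof.
move=> z0; have m0 := cmod_gt0 z0.
rewrite -ler_norml normrM normfV (gtr0_norm m0) ler_pdivrMr// mul1r.
by rewrite /cmod -sqrtr_sqr ler_wsqrtr// lerDl sqr_ge0.
Qed.

Lemma cmod_sqr z : cmod z ^+ 2 = complex.Re z ^+ 2 + complex.Im z ^+ 2.
Proof. by rewrite sqr_sqrtr// addr_ge0 ?sqr_ge0. Qed.

Lemma sin_acos_ratio z : z != 0 ->
  sin (acos (complex.Re z / cmod z)) = `|complex.Im z| / cmod z.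
Proof.
move=> z0; have m0 := cmod_gt0 z0.
rewrite sin_acos ?cmod_ratio//.
have -> : 1 - (complex.Re z / cmod z) ^+ 2 = (complex.Im z / cmod z) ^+ 2.
  rewrite !expr_div_n -[1](@divff _ (cmod z ^+ 2)) ?expf_neq0 ?gt_eqF//.
  by rewrite -mulrBl {1}cmod_sqr addrAC subrr add0r.
by rewrite sqrtr_sqr normrM normfV (gtr0_norm m0).
Qed.

Lemma carg_itv z : z != 0 -> - pi < carg z <= pi.
Proof.
move=> z0; have r := cmod_ratio z0.
have a0 := acos_ge0 r; have ap := acos_lepi r; rewrite /carg.
case: (leP 0 (complex.Im z)) => im.
  by rewrite ap andbT (lt_le_trans _ a0)// oppr_lt0 pi_gt0.
rewrite ltrN2 (le_trans _ (pi_ge0 R)) ?oppr_le0// andbT lt_neqAle ap andbT.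
apply/eqP => apE; have := sin_acos_ratio z0; rewrite apE sinpi => /esym/eqP.
by rewrite mulf_eq0 invr_eq0 normr_eq0 (lt_eqF im) (gt_eqF (cmod_gt0 z0)).
Qed.

Lemma carg_polar z : z != 0 ->
  z = (cmod z * cos (carg z)) +i* (cmod z * sin (carg z)).
Proof.
move=> z0; have r := cmod_ratio z0.
have m0 : cmod z != 0 by rewrite gt_eqF ?cmod_gt0.
have -> : cos (carg z) = complex.Re z / cmod z.
  by rewrite /carg; case: ifP => _; rewrite ?cosN acosK.
have -> : sin (carg z) = complex.Im z / cmod z.
  rewrite /carg; case: (leP 0 (complex.Im z)) => im; rewrite ?sinN sin_acos_ratio//.
    by rewrite ger0_norm.
  by rewrite ltr0_norm// mulNr opprK.
by rewrite ![cmod z * _]mulrC !divfK//; case: (z).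
Qed.

Definition holomorphic_on (A : set R[i]) (f : R[i] -> R[i]) : Prop :=
  forall z, A z -> derivable (f : R[i]^o -> R[i]^o) z 1.

End ComplexFunctions.

Section GammaFunction.
Context {R : realType}.

(* Euler's integral, meaningful for 0 < s. *)
Definition gamma_int (s : R) : R :=
  \int[lebesgue_measure]_(t in `]0, +oo[) (t `^ (s - 1) * expR (- t)).

(* For s <= 0 the analytic continuation, obtained by iterating
   Gamma s = Gamma (s + 1) / s until the argument is positive; junk value at
   the poles 0, -1, -2, ... *)
Definition Gamma (s : R) : R :=
  if 0 < s then gamma_int s
  else let n := (Num.truncn (- s)).+1 in
       gamma_int (s + n%:R) / \prod_(i < n) (s + i%:R).

End GammaFunction.

Section MomentGeneratingFunction.
Context {R : realType}.

Definition mgf (nu : {finite_measure set (measurableTypeR R) -> \bar R})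
    (z : R[i]) : R[i] :=
  (\int[nu]_(x in `[0, +oo[) complex.Re (cexp (z * x%:C))) +i*
  (\int[nu]_(x in `[0, +oo[) complex.Im (cexp (z * x%:C))).

Definition Gdomain (delta alpha : R) : set R[i] :=
  [set z | z != alpha%:C /\ delta < `|carg (z - alpha%:C)|].

End MomentGeneratingFunction.

(* Main.v *)
(* The measure is compared with the explicit densities
     w_r(y) = y^(lambda - 1) (e^(- r y) - e^(- (r + 1) y)),  y > 0,
   for r = alpha and r = alpha + 1.  The transform of w_r is
   Gamma(lambda) k_r with k_r(z) = (r - z)^(- lambda) - (r + 1 - z)^(- lambda),
   and for c = (a + b) / (1 - 2^(- lambda)) the residual
   H = g - b k_alpha - c k_(alpha + 1) is o(|z - alpha|^(- lambda)) at alpha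
   and O(|z - alpha|) away from it.  After smoothing by a centred Gaussian law
   of deviation s, the difference of the densities at u is
   (2 pi)^-1 int H(i t) e^(- i t u - s^2 t^2 / 2) dt.  Cauchy's theorem moves the
   contour to the two rays v + t (k +- i), t >= 0, with v = alpha - 1 / x and
   k = cos(delta) / 2: they lie in the domain of H, and the Gaussian factor is
   bounded on them uniformly in s <= 1.  For u >= x this yields
   e^(- v u) o(x^(lambda - 1)); integrating over u and letting s tend to 0 shows
   that the tail of nu differs from the one of (b / Gamma(lambda)) w_alpha by
   o(x^(lambda - 1) e^(- alpha x)). *)

Require Import Defs.
From HB Require Import structures.
From mathcomp Require Import all_boot all_order all_algebra.
From mathcomp Require Import complex.
From mathcomp Require Import all_classical all_reals all_analysis.
From mathcomp Require Import measurable_realfun.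
From mathcomp Require Import ring lra.

Set Implicit Arguments.
Unset Strict Implicit.
Unset Printing Implicit Defensive.

Import Order.TTheory GRing.Theory Num.Theory.
Import numFieldNormedType.Exports.

Local Open Scope classical_set_scope.
Local Open Scope ring_scope.
Local Open Scope complex_scope.
Local Notation reC := (@complex.Re _).
Local Notation imC := (@complex.Im _).

(** * Complex numbers through real coordinates: modulus, limits, exponential *)

Section ComplexBasics.
Context {R : realType}.
Implicit Types (z w : R[i]) (x y t e : R).

(** [nu] need not have a density and H need not be integrable on the imaginary axis, so Fourier
    inversion is applied only after smoothing; a Gaussian is used because its transform is entire
    and can follow the contour. A vertical line through v would give no bound uniform in s: the
    slope k > 0, available since delta < pi / 2, makes e^(- u z) decay like e^(- u k t) along the
    rays, while k <= 1 / 2 keeps the Gaussian factor bounded. At distance 1 / x from alpha, e^(- v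
    x) = e e^(- alpha x) costs only a constant, H is o(x^lambda), and integration in t gains the
    factor 1 / x. The value of c is forced by the case lambda < 0, where a nonzero constant term a +
    b - c (1 - 2^(- lambda)) of H at alpha would dominate |z - alpha|^(- lambda); lambda != 0 makes
    the equation solvable, and -1 < lambda makes the remaining linear term negligible. The region to
    the left of the two rays is not convex, so the contour is folded at the real axis: each half
    lies in a half-plane, where Goursat's theorem for triangles suffices, and the values at i t and
    - i t are paired. *)

Lemma complex_eq z w : reC z = reC w -> imC z = imC w -> z = w.
Proof. by case: z w => [? ?] [? ?] /= -> ->. Qed.

Lemma reD z w : reC (z + w) = reC z + reC w. Proof. by case: z w => [? ?] []. Qed.
Lemma imD z w : imC (z + w) = imC z + imC w. Proof. by case: z w => [? ?] []. Qed.
Lemma reN z : reC (- z) = - reC z. Proof. by case: z. Qed.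
Lemma imN z : imC (- z) = - imC z. Proof. by case: z. Qed.
Lemma reM z w : reC (z * w) = reC z * reC w - imC z * imC w.
Proof. by case: z w => [? ?] []. Qed.
Lemma imM z w : imC (z * w) = reC z * imC w + imC z * reC w.
Proof. by case: z w => [? ?] [? ?]. Qed.
Lemma re_real x : reC x%:C = x. Proof. by []. Qed.
Lemma im_real x : imC x%:C = 0. Proof. by []. Qed.
Lemma re0 : reC (0 : R[i]) = 0. Proof. by []. Qed.
Lemma im0 : imC (0 : R[i]) = 0. Proof. by []. Qed.
Lemma re1 : reC (1 : R[i]) = 1. Proof. by []. Qed.
Lemma im1 : imC (1 : R[i]) = 0. Proof. by []. Qed.
Lemma reMr x z : reC (x%:C * z) = x * reC z.
Proof. by rewrite reM re_real im_real mul0r subr0. Qed.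
Lemma imMr x z : imC (x%:C * z) = x * imC z.
Proof. by rewrite imM re_real im_real mul0r addr0. Qed.
Lemma rei : reC ('i : R[i]) = 0. Proof. by []. Qed.
Lemma imi : imC ('i : R[i]) = 1. Proof. by []. Qed.

Definition reimE :=
  (reMr, imMr, reD, imD, reN, imN, reM, imM, re_real, im_real, re0, im0,
   re1, im1, rei, imi).

Lemma cmod_ge0 z : 0 <= cmod z. Proof. exact: sqrtr_ge0. Qed.

Lemma cmodM z w : cmod (z * w) = cmod z * cmod w.
Proof.
by apply: (@complexI R); rewrite rmorphM/= -!normr_cmod normrM.
Qed.

Lemma cmodD z w : cmod (z + w) <= cmod z + cmod w.
Proof. by have := ler_normD z w; rewrite !normr_cmod -rmorphD lecR. Qed.

Lemma cmodN z : cmod (- z) = cmod z.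
Proof. by apply: (@complexI R); rewrite -!normr_cmod normrN. Qed.

Lemma cmodB z w : cmod (z - w) <= cmod z + cmod w.
Proof. by rewrite (le_trans (cmodD _ _))// cmodN. Qed.

Lemma cmod_distC z w : cmod (z - w) = cmod (w - z).
Proof. by rewrite -cmodN opprB. Qed.

Lemma cmod_real x : cmod x%:C = `|x|.
Proof. by rewrite /cmod/= expr0n/= addr0 sqrtr_sqr. Qed.

Lemma cmod0 : cmod (0 : R[i]) = 0.
Proof. by rewrite (_ : 0 = 0%:C)// cmod_real normr0. Qed.

Lemma cmod1 : cmod (1 : R[i]) = 1.
Proof. by rewrite (_ : 1 = 1%:C)// cmod_real normr1. Qed.

Lemma cmod_eq0 z : (cmod z == 0) = (z == 0).
Proof.
apply/eqP/eqP => [h|->]; last exact: cmod0.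
by apply/eqP; apply: contraPT isT => /cmod_gt0; rewrite h ltxx.
Qed.

Lemma cmod_re z : `|reC z| <= cmod z.
Proof. by rewrite /cmod -sqrtr_sqr ler_wsqrtr// lerDl sqr_ge0. Qed.

Lemma cmod_im z : `|imC z| <= cmod z.
Proof. by rewrite /cmod -sqrtr_sqr ler_wsqrtr// lerDr sqr_ge0. Qed.

Lemma cmod_le_reim z : cmod z <= `|reC z| + `|imC z|.
Proof.
rewrite -(@ler_pXn2r _ 2)// ?nnegrE ?cmod_ge0 ?addr_ge0//.
rewrite cmod_sqr sqrrD !real_normK ?num_real// lerD2r lerDl.
by rewrite mulrn_wge0// mulr_ge0.
Qed.

Lemma cmodV z : cmod z^-1 = (cmod z)^-1.
Proof.
have [->|z0] := eqVneq z 0; first by rewrite invr0 cmod0 invr0.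
have m0 : cmod z != 0 by rewrite cmod_eq0.
by apply: (mulfI m0); rewrite -cmodM !divff// cmod1.
Qed.

Lemma cmodB_ge z w : cmod z - cmod w <= cmod (z - w).
Proof. by rewrite lerBlDr (le_trans _ (cmodD _ _))// subrK. Qed.

(** The norm of [R[i]^o] takes values in [R[i]], so the epsilons of the general theory are complex;
    being positive forces them to be real, which permits the real modulus instead. *)
Lemma cvg_cmodP (T : Type) (F : set_system T) (FF : Filter F)
    (f : T -> R[i]^o) (l : R[i]^o) :
  f x @[x --> F] --> l <->
  forall e, 0 < e -> \forall t \near F, cmod (f t - l) < e.
Proof.
split=> [/cvgrPdist_lt fl e e0|fl].
  have := fl e%:C; rewrite ltcR => /(_ e0); apply: filterS => t.
  by rewrite distrC normr_cmod ltcR.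
apply/cvgrPdist_lt => eps; rewrite ltcE/= => /andP[/eqP e1 e2].
have -> : eps = (reC eps)%:C by case: eps e1 {e2} => ? ? /= ->.
by apply: filterS (fl _ e2) => t; rewrite distrC normr_cmod ltcR.
Qed.

Lemma nbhs_cmodP z (P : set R[i]) :
  nbhs (z : R[i]^o) P <->
  exists2 e, 0 < e & forall w, cmod (w - z) < e -> P w.
Proof.
split=> [/nbhs_ballP[eps /= + h]|[e e0 h]].
  rewrite ltcE/= => /andP[/eqP e1 e2].
  exists (reC eps) => // w wz; apply: h; rewrite -ball_normE/=.
  have -> : eps = (reC eps)%:C by case: eps e1 {e2 wz} => ? ? /= ->.
  by rewrite distrC normr_cmod ltcR.
apply/nbhs_ballP; exists e%:C => /=; first by rewrite ltcR.
by move=> w; rewrite -ball_normE/= distrC normr_cmod ltcR => /h.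
Qed.

(** The difference quotient multiplied out: the estimate also makes sense at [w = z], so no
    punctured neighbourhood is left. *)
Lemma is_derive_cmodP (f : R[i] -> R[i]) z l :
  is_derive (z : R[i]^o) 1 (f : R[i]^o -> R[i]^o) l <->
  forall e, 0 < e -> exists2 d, 0 < d & forall w, cmod (w - z) < d ->
    cmod (f w - f z - l * (w - z)) <= e * cmod (w - z).
Proof.
split=> [[df dl] e e0|h].
  have : h^-1 *: ((f : R[i]^o -> R[i]^o) (h *: 1 + z) - f z) @[h --> (0 : R[i]^o)^']
      --> (l : R[i]^o).
    by rewrite -dl; exact: df.
  move=> /cvg_cmodP/(_ _ e0)/nbhs_cmodP[d d0 hd]; exists d => // w wz.
  have [->|wz0] := eqVneq w z.
    by rewrite !subrr mulr0 subrr cmod0 mulr0.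
  have wz1 : w - z != 0 by rewrite subr_eq0.
  have := hd (w - z); rewrite subr0 => /(_ wz wz1) /ltW.
  have -> : (w - z)%R *: (1 : R[i]^o) + z = w by rewrite /GRing.scale/= mulr1 subrK.
  rewrite /GRing.scale/= -(ler_pM2r (cmod_gt0 wz1)) -cmodM mulrBl.
  by rewrite mulrAC mulVf// mul1r.
have H : h^-1 *: ((f : R[i]^o -> R[i]^o) (h *: 1 + z) - f z) @[h --> (0 : R[i]^o)^']
    --> (l : R[i]^o).
  apply/cvg_cmodP => e e0; have e2 : 0 < e / 2 by rewrite divr_gt0.
  have [d d0 hd] := h _ e2.
  apply/nbhs_cmodP; exists d => // w; rewrite subr0 => wd /= w0.
  rewrite (@le_lt_trans _ _ (e / 2))//; last by rewrite ltr_pdivrMr// ltr_pMr// ltr1n.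
  have := hd (w + z); rewrite addrK => /(_ wd) h1.
  rewrite -(ler_pM2r (cmod_gt0 w0)) -cmodM.
  rewrite /GRing.scale/= mulr1.
  by have -> : (w^-1 * (f (w + z) - f z) - l) * w = f (w + z) - f z - l * w by field.
split; first by apply/cvg_ex; exists l.
exact/cvg_lim.
Qed.

Lemma derivable_cmod (f : R[i] -> R[i]) z :
  derivable (f : R[i]^o -> R[i]^o) z 1 -> exists l, forall e, 0 < e ->
  exists2 d, 0 < d & forall w, cmod (w - z) < d ->
    cmod (f w - f z - l * (w - z)) <= e * cmod (w - z).
Proof. by move=> /derivableP/is_derive_cmodP h; eexists; exact: h. Qed.

Lemma derivable_continuousC (f : R[i] -> R[i]) z :
  derivable (f : R[i]^o -> R[i]^o) z 1 ->
  {for z, continuous (f : R[i]^o -> R[i]^o)}.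
Proof. by move=> /derivable1_diffP/differentiable_continuous. Qed.

Lemma continuous_cmodP (f : R[i] -> R[i]) z :
  {for z, continuous (f : R[i]^o -> R[i]^o)} <->
  forall e, 0 < e -> exists2 d, 0 < d & forall w, cmod (w - z) < d ->
    cmod (f w - f z) < e.
Proof.
have H := @cvg_cmodP _ _ (nbhs_filter (z : R[i]^o)) f (f z).
split=> [h e e0|h]; first by have /nbhs_cmodP := H.1 h e e0.
by apply/H => e e0; apply/nbhs_cmodP; exact: h.
Qed.

Lemma real_continuous_cmodP (f : R[i] -> R) z :
  {for z, continuous (f : R[i]^o -> R)} <->
  forall e, 0 < e -> exists2 d, 0 < d & forall w, cmod (w - z) < d ->
    `|f w - f z| < e.
Proof.
have H := @cvgrPdist_lt _ _ _ _ (nbhs_filter (z : R[i]^o)) (f : R[i]^o -> R) (f z).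
split=> [h e e0|h].
  have /nbhs_cmodP[d d0 hd] := H.1 h e e0.
  by exists d => // w /hd; rewrite distrC.
apply/H => e e0; apply/nbhs_cmodP; have [d d0 hd] := h e e0.
by exists d => // w /hd; rewrite distrC.
Qed.

Lemma continuous_Re : continuous (reC : R[i]^o -> R).
Proof.
move=> z; apply/real_continuous_cmodP => e e0; exists e => // w wz.
by rewrite (le_lt_trans _ wz)// (le_trans _ (cmod_re _))// !reimE.
Qed.

Lemma continuous_Im : continuous (imC : R[i]^o -> R).
Proof.
move=> z; apply/real_continuous_cmodP => e e0; exists e => // w wz.
by rewrite (le_lt_trans _ wz)// (le_trans _ (cmod_im _))// !reimE.
Qed.

Lemma continuous_cmod : continuous (cmod : R[i]^o -> R).
Proof.
move=> z; apply/real_continuous_cmodP => e e0; exists e => // w wz.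
rewrite (le_lt_trans _ wz)// ler_norml cmodB_ge andbT.
by rewrite lerNl opprB cmod_distC cmodB_ge.
Qed.

Lemma cvg_complexP (T : Type) (F : set_system T) (FF : Filter F)
    (f : T -> R[i]^o) (l : R[i]^o) :
  (reC (f x) : R) @[x --> F] --> (reC l : R) ->
  (imC (f x) : R) @[x --> F] --> (imC l : R) ->
  f x @[x --> F] --> l.
Proof.
move=> /cvgrPdist_lt h1 /cvgrPdist_lt h2; apply/cvg_cmodP => e e0.
have e2 : 0 < e / 2 by rewrite divr_gt0.
near=> t; rewrite (le_lt_trans (cmod_le_reim _))// [ltRHS]splitr ltrD// !reimE distrC.
  by near: t; exact: h1.
by near: t; exact: h2.
Unshelve. all: by end_near. Qed.

Lemma continuous_mkC (T : topologicalType) (f : T -> R[i]^o) (x : T) :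
  {for x, continuous (fun t : T => reC (f t) : R)} ->
  {for x, continuous (fun t : T => imC (f t) : R)} -> {for x, continuous f}.
Proof. by move=> h1 h2; exact: cvg_complexP. Qed.

Lemma cexpD z w : cexp (z + w) = cexp z * cexp w.
Proof.
move: z w => [a b] [c d]; apply: complex_eq; rewrite /= expRD ?cosD ?sinD; ring.
Qed.

Lemma cexp0 : cexp (0 : R[i]) = 1.
Proof. by rewrite /cexp/= expR0 cos0 sin0 !mul1r. Qed.

Lemma cmod_cexp z : cmod (cexp z) = expR (reC z).
Proof.
rewrite /cmod/= !exprMn -mulrDr cos2Dsin2 mulr1 sqrtr_sqr.
by rewrite ger0_norm// expR_ge0.
Qed.

Lemma cexp_neq0 z : cexp z != 0.
Proof. by rewrite -cmod_eq0 cmod_cexp gt_eqF ?expR_gt0. Qed.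

Lemma cexpN z : cexp (- z) = (cexp z)^-1.
Proof.
apply: (mulfI (cexp_neq0 z)); rewrite divff ?cexp_neq0//.
by rewrite -cexpD subrr cexp0.
Qed.

Lemma cexp_real x : cexp x%:C = (expR x)%:C.
Proof. by rewrite /cexp/= cos0 sin0 mulr0 mulr1. Qed.

End ComplexBasics.

(** * Integrals of complex-valued functions *)

Section ComplexIntegral.
Context d (T : measurableType d) (R : realType) (m : {measure set T -> \bar R}).
Implicit Types (D : set T) (f g : T -> R[i]) (B : T -> R).

(** Built exactly as [mgf] is, so that [mgf nu z] is a [cint] by conversion. *)
Definition cint D f : R[i] :=
  (\int[m]_(x in D) reC (f x)) +i* (\int[m]_(x in D) imC (f x)).

Definition cintegrable D f :=
  m.-integrable D (EFin \o (fun x => reC (f x))) /\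
  m.-integrable D (EFin \o (fun x => imC (f x))).

Lemma eq_cint D f g : (forall x, D x -> f x = g x) -> cint D f = cint D g.
Proof.
by move=> fg; rewrite /cint; congr (_ +i* _); apply: eq_Rintegral => x;
  rewrite inE => /fg ->.
Qed.

Lemma eq_cintegrable D f g : measurable D -> (forall x, D x -> f x = g x) ->
  cintegrable D f -> cintegrable D g.
Proof.
move=> mD fg [f1 f2]; split.
- by apply: eq_integrable f1 => // x; rewrite inE => /fg /= ->.
- by apply: eq_integrable f2 => // x; rewrite inE => /fg /= ->.
Qed.

Lemma integrable_realZ D (r : R) (f : T -> R) : measurable D ->
  m.-integrable D (EFin \o f) -> m.-integrable D (EFin \o (fun x => r * f x)).
Proof.
by move=> mD /(integrableZl mD r); apply: eq_integrable => // x _ /=.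
Qed.

Lemma cintegrableD D f g : measurable D -> cintegrable D f -> cintegrable D g ->
  cintegrable D (fun x => f x + g x).
Proof.
move=> mD [f1 f2] [g1 g2]; split.
- apply: eq_integrable (integrableD mD f1 g1) => // x _ /=.
  by rewrite reD EFinD.
- apply: eq_integrable (integrableD mD f2 g2) => // x _ /=.
  by rewrite imD EFinD.
Qed.

Lemma cintegrableZ D (c : R[i]) f : measurable D -> cintegrable D f ->
  cintegrable D (fun x => c * f x).
Proof.
move=> mD [f1 f2]; split.
- have h1 := integrableZl mD (reC c) f1.
  have h2 := integrableZl mD (imC c) f2.
  by apply: eq_integrable (integrableB mD h1 h2) => // x _ /=; rewrite reM EFinB.
- have h1 := integrableZl mD (reC c) f2.
  have h2 := integrableZl mD (imC c) f1.
  apply: eq_integrable (integrableD mD h1 h2) => // x _ /=.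
  by rewrite imM EFinD.
Qed.

Lemma cintD D f g : measurable D -> cintegrable D f -> cintegrable D g ->
  cint D (fun x => f x + g x) = cint D f + cint D g.
Proof.
move=> mD [f1 f2] [g1 g2]; apply: complex_eq => /=.
- by rewrite -RintegralD//; apply: eq_Rintegral => x _; rewrite reD.
- by rewrite -RintegralD//; apply: eq_Rintegral => x _; rewrite imD.
Qed.

Lemma cintZ D (c : R[i]) f : measurable D -> cintegrable D f ->
  cint D (fun x => c * f x) = c * cint D f.
Proof.
move=> mD [f1 f2]; apply: complex_eq; [rewrite reM|rewrite imM]; rewrite /cint /=.
- rewrite -!RintegralZl// -RintegralB//; try exact: integrable_realZ.
  by apply: eq_Rintegral => x _; rewrite reM.
- rewrite -!RintegralZl// -RintegralD//; try exact: integrable_realZ.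
  by apply: eq_Rintegral => x _; rewrite imM.
Qed.

Lemma cintegrableN D f : measurable D -> cintegrable D f ->
  cintegrable D (fun x => - f x).
Proof.
move=> mD /(cintegrableZ (-1) mD); apply: eq_cintegrable => // x _.
by rewrite mulN1r.
Qed.

Lemma cintN D f : measurable D -> cintegrable D f ->
  cint D (fun x => - f x) = - cint D f.
Proof.
move=> mD h; rewrite -mulN1r -cintZ//; apply: eq_cint => x _.
by rewrite mulN1r.
Qed.

Lemma cintegrableB D f g : measurable D -> cintegrable D f -> cintegrable D g ->
  cintegrable D (fun x => f x - g x).
Proof. by move=> mD hf hg; apply: cintegrableD => //; exact: cintegrableN. Qed.

Lemma cintB D f g : measurable D -> cintegrable D f -> cintegrable D g ->
  cint D (fun x => f x - g x) = cint D f - cint D g.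
Proof.
move=> mD hf hg; rewrite -cintN// -cintD//; exact: cintegrableN.
Qed.

(* The sharp constant is [1]; the crude [2] avoids a rotation argument. *)
Lemma cmod_cint_le D f B : measurable D -> cintegrable D f ->
  m.-integrable D (EFin \o B) -> (forall x, D x -> cmod (f x) <= B x) ->
  cmod (cint D f) <= 2 * \int[m]_(x in D) B x.
Proof.
move=> mD [f1 f2] hB fB; rewrite (le_trans (cmod_le_reim _))//= mulr_natl mulr2n.
apply: lerD.
- rewrite (le_trans (le_normr_Rintegral mD f1))// le_Rintegral//.
    exact: integrable_norm f1.
  by move=> x Dx; rewrite (le_trans (cmod_re _))// fB.
- rewrite (le_trans (le_normr_Rintegral mD f2))// le_Rintegral//.
    exact: integrable_norm f2.
  by move=> x Dx; rewrite (le_trans (cmod_im _))// fB.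
Qed.

Lemma cintegrable_real D (f : T -> R) : measurable D ->
  m.-integrable D (EFin \o f) -> cintegrable D (fun x => (f x)%:C).
Proof. by move=> mD hf; split => //; exact: integrable0. Qed.

Lemma cint_real D (f : T -> R) : cint D (fun x => (f x)%:C) = (\int[m]_(x in D) f x)%:C.
Proof.
apply: complex_eq => //=; rewrite /Rintegral.
by rewrite integral0.
Qed.

End ComplexIntegral.

(** * Line integrals along segments *)

Section SegmentIntegral.
Context {R : realType}.
Notation mu := (@lebesgue_measure R).
Implicit Types (F G : R[i] -> R[i]) (U : set R[i]) (a b c z w : R[i]).

Lemma within_continuous_comp_sub (X Y Z : topologicalType) (A : set X) (B : set Y)
    (f : X -> Y) (g : Y -> Z) : f @` A `<=` B ->
  {within B, continuous g} -> {within A, continuous f} ->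
  {within A, continuous g \o f}.
Proof.
move=> fAB /subspace_continuousP cg /subspace_continuousP cf.
apply/subspace_continuousP => x Ax.
apply: (cvg_comp _ _ _ (cg (f x) (fAB _ (ex_intro2 _ _ x Ax erefl)))).
move=> P; rewrite /within/= => /(cf x Ax).
rewrite /within/= !nbhs_simpl/=; apply: filterS => y h Ay.
by apply: h => //; apply: fAB; exists y.
Qed.

Lemma Rintegral_affine (f : R -> R) (p q : R) : p < q ->
  {within `[p, q], continuous f} ->
  \int[mu]_(x in `[p, q]) f x =
  (q - p) * \int[mu]_(t in `[0, 1]) f (p + t * (q - p)).
Proof.
move=> pq cf; have qp : 0 < q - p by rewrite subr_gt0.
pose A := (fun t : R => p + t * (q - p)).
have A0 : A 0 = p by rewrite /A mul0r addr0.
have A1 : A 1 = q by rewrite /A mul1r addrC subrK.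
have dA (t : R) : is_derive t (1 : R) A (q - p).
  apply: is_derive_eq. by rewrite add0r /GRing.scale/=; ring.
have dAE : (A^`())%classic = cst (q - p).
  by apply/funext => t; rewrite derive1E; have [] := dA t.
have cA : continuous A.
  by move=> t; apply/differentiable_continuous/derivable1_diffP; have [] := dA t.
have H := @integration_by_substitution_increasing R A f 0 1.
have cfA : {within `[0, 1], continuous (f \o A)}.
  apply: (@within_continuous_comp_sub _ _ _ _ `[p, q]%classic) => //.
    move=> _ [t /= /[!in_itv]/= /andP[t0 t1] <-]; rewrite /A.
    have := ler_piMl (ltW qp) t1; have := mulr_ge0 t0 (ltW qp).
    by move=> u1 u2; rewrite lerDl u1/= -lerBrDl.
  exact: continuous_subspaceT.
rewrite /Rintegral -[in X in X = _]A0 -[in X in X = _]A1 H //.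
- transitivity (\int[mu]_(t in `[0, 1]) ((q - p) * f (A t))).
    rewrite /Rintegral; congr fine; apply: eq_integral => t _ /=.
    by rewrite dAE /= mulrC.
  rewrite RintegralZl//.
  exact: continuous_compact_integrable (@segment_compact _ _ _) cfA.
- by move=> x y _ _ xy; rewrite /A ltrD2l ltr_pM2r.
- by rewrite dAE => x _; exact: cvg_cst.
- by rewrite dAE; exact: is_cvg_cst.
- by rewrite dAE; exact: is_cvg_cst.
- split.
  + by move=> t _; have [] := dA t.
  + by apply: cvg_at_right_filter; exact: cA.
  + by apply: cvg_at_left_filter; exact: cA.
- by rewrite A0 A1.
Qed.

Definition seg F a b : R[i] :=
  (b - a) * cint mu `[0%R, 1%R] (fun t => F (a + t%:C * (b - a))).

Definition convexC U := forall a b (t : R), U a -> U b -> 0 <= t <= 1 ->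
  U (a + t%:C * (b - a)).

Definition continuousC U F :=
  forall z, U z -> {for z, continuous (F : R[i]^o -> R[i]^o)}.

Lemma continuous_affine (p q : R) : continuous (fun t : R => p + t * q).
Proof.
by move=> t; apply: cvgD; [exact: cvg_cst|apply: cvgM; [exact: cvg_id|exact: cvg_cst]].
Qed.

Lemma continuous_line a (w : R[i]) : continuous (fun t : R => a + t%:C * w : R[i]^o).
Proof.
move=> t; apply: continuous_mkC.
- rewrite (_ : (fun _ => _) = (fun s => reC a + s * reC w)).
    exact: continuous_affine.
  by apply/funext => s; rewrite reD reMr.
- rewrite (_ : (fun _ => _) = (fun s => imC a + s * imC w)).
    exact: continuous_affine.
  by apply/funext => s; rewrite imD imMr.
Qed.

Lemma continuous_on_line U F a (w : R[i]) (p q : R) : continuousC U F ->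
  (forall t, p <= t <= q -> U (a + t%:C * w)) ->
  {within `[p, q], continuous (fun t : R => F (a + t%:C * w) : R[i]^o)}.
Proof.
move=> cF abU; apply: continuous_in_subspaceT => t; rewrite inE/= in_itv/= => t01.
apply: (@continuous_comp _ _ _ (fun t : R => a + t%:C * w : R[i]^o)).
  exact: continuous_line.
by apply: cF; exact: abU.
Qed.

Lemma continuous_cintegrable (f : R -> R[i]) (p q : R) :
  {within `[p, q], continuous (f : R -> R[i]^o)} -> cintegrable mu `[p, q] f.
Proof.
move=> cf; split; apply: continuous_compact_integrable; try exact: segment_compact.
- apply: (@within_continuous_comp R[i]^o R R _ (f : R -> R[i]^o) reC) => // z _.
  exact: continuous_Re.
- apply: (@within_continuous_comp R[i]^o R R _ (f : R -> R[i]^o) imC) => // z _.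
  exact: continuous_Im.
Qed.

Lemma continuous_seg_cintegrable U F a b : convexC U -> continuousC U F ->
  U a -> U b ->
  cintegrable mu `[0%R, 1%R] (fun t => F (a + t%:C * (b - a))).
Proof.
move=> cU cF Ua Ub; apply: continuous_cintegrable.
by apply: continuous_on_line cF _ => t t01; exact: cU.
Qed.

Lemma eq_seg U F G a b : convexC U -> U a -> U b ->
  (forall z, U z -> F z = G z) -> seg F a b = seg G a b.
Proof.
move=> cU Ua Ub FG; rewrite /seg; congr (_ * _); apply: eq_cint => t /= /[!in_itv]/= t01.
by rewrite FG//; exact: cU.
Qed.

Lemma segD U F G a b : convexC U -> continuousC U F -> continuousC U G ->
  U a -> U b -> seg (fun z => F z + G z) a b = seg F a b + seg G a b.
Proof.
by move=> cU cF cG Ua Ub; rewrite /seg cintD ?mulrDr//;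
  exact: continuous_seg_cintegrable cU _ Ua Ub.
Qed.

Lemma seg_le U F a b (B : R) : convexC U -> continuousC U F -> U a -> U b ->
  (forall t : R, 0 <= t <= 1 -> cmod (F (a + t%:C * (b - a))) <= B) ->
  cmod (seg F a b) <= 2 * B * cmod (b - a).
Proof.
move=> cU cF Ua Ub FB; rewrite /seg cmodM mulrC ler_wpM2r ?cmod_ge0//.
have h := continuous_seg_cintegrable cU cF Ua Ub.
rewrite (le_trans (cmod_cint_le (B := cst B) _ h _ _))//.
- apply: continuous_compact_integrable; first exact: segment_compact.
  by apply: continuous_subspaceT => x; exact: cvg_cst.
- suff -> : \int[mu]_(x in `[0, 1]) cst B x = B by rewrite lexx.
  have -> : \int[mu]_(x in `[0, 1]) cst B x = B * fine (mu `[0, 1]).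
    exact: Rintegral_cst.
  by rewrite lebesgue_measure_itv/= lte_fin ltr01 -EFinD/= subr0 mulr1.
Qed.

Lemma cint_affine (f : R -> R[i]) (p q : R) : p < q ->
  {within `[p, q], continuous (f : R -> R[i]^o)} ->
  cint mu `[p, q] f =
  (q - p)%:C * cint mu `[0%R, 1%R] (fun t => f (p + t * (q - p))).
Proof.
move=> pq cf; apply: complex_eq; rewrite ?reMr ?imMr /cint/=.
- rewrite (@Rintegral_affine (fun t => reC (f t)))//.
  apply: (@within_continuous_comp R[i]^o R R _ (f : R -> R[i]^o) reC) => // z _.
  exact: continuous_Re.
- rewrite (@Rintegral_affine (fun t => imC (f t)))//.
  apply: (@within_continuous_comp R[i]^o R R _ (f : R -> R[i]^o) imC) => // z _.
  exact: continuous_Im.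
Qed.

(** Lets a whole line be parametrised once: pieces of the axis and of the rays become ordinary
    integrals in [t] over an arbitrary [p, q]. *)
Lemma seg_line U F a (w : R[i]) (p q : R) : p < q -> continuousC U F ->
  (forall t, p <= t <= q -> U (a + t%:C * w)) ->
  seg F (a + p%:C * w) (a + q%:C * w) =
  w * cint mu `[p, q] (fun t => F (a + t%:C * w)).
Proof.
move=> pq cF abU; rewrite cint_affine//; last exact: continuous_on_line cF abU.
rewrite /seg mulrA; congr (_ * _).
  by apply: complex_eq; rewrite !reimE; ring.
apply: eq_cint => t _; congr F.
by apply: complex_eq; rewrite !reimE; ring.
Qed.

Lemma Rintegral_itv_cat (f : R -> R) (p q r : R) : p <= q -> q <= r ->
  mu.-integrable `[p, r] (EFin \o f) ->
  \int[mu]_(x in `[p, r]) f x =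
  \int[mu]_(x in `[p, q]) f x + \int[mu]_(x in `[q, r]) f x.
Proof.
move=> pq qr fi; apply/eqP; rewrite [X in _ == X]addrC -subr_eq; apply/eqP.
have := @Rintegral_itvB _ f (BLeft p) (BRight r) q fi.
rewrite !bnd_simp => /(_ pq qr) ->.
apply/Rintegral_itv_obnd_cbnd; apply: integrableS fi => //.
by apply: subset_itv; rewrite bnd_simp.
Qed.

Lemma cint_itv_cat (f : R -> R[i]) (p q r : R) : p <= q -> q <= r ->
  cintegrable mu `[p, r] f ->
  cint mu `[p, r] f = cint mu `[p, q] f + cint mu `[q, r] f.
Proof.
by move=> pq qr [f1 f2]; apply: complex_eq; rewrite ?reD ?imD/=;
  exact: Rintegral_itv_cat.
Qed.

Lemma seg_split U F a b : convexC U -> continuousC U F -> U a -> U b ->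
  seg F a b = seg F a (a + (2^-1)%:C * (b - a)) + seg F (a + (2^-1)%:C * (b - a)) b.
Proof.
move=> cU cF Ua Ub; pose L (t : R) := a + t%:C * (b - a).
have h1 : (0 : R) < 2^-1 by rewrite invr_gt0.
have h2 : (2^-1 : R) < 1 by rewrite invf_lt1// ltr1n.
have L0 : L 0 = a by rewrite /L mul0r addr0.
have L1 : L 1 = b by rewrite /L mul1r addrC subrK.
have Hs p q : 0 <= p -> p < q -> q <= 1 ->
    seg F (L p) (L q) =
    (b - a) * cint mu `[p, q] (fun t => F (a + t%:C * (b - a))).
  move=> p0 pq q1; apply: seg_line cF _ => // t /andP[pt tq].
  by apply: cU => //; rewrite (le_trans p0)//= (le_trans tq).
have E1 := Hs 0 1 (lexx _) ltr01 (lexx _).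
have E2 := Hs 0 2^-1 (lexx _) h1 (ltW h2).
have E3 := Hs 2^-1 1 (ltW h1) h2 (lexx _).
rewrite L0 L1 in E1 E2 E3; rewrite -/(L 2^-1) E1 E2 E3.
rewrite -mulrDr -cint_itv_cat//; try exact: ltW.
exact: continuous_seg_cintegrable cU cF Ua Ub.
Qed.

Lemma seg_rev U F a b : convexC U -> continuousC U F -> U a -> U b ->
  seg F b a = - seg F a b.
Proof.
move=> cU cF Ua Ub; rewrite /seg -mulNr opprB; congr (_ * _).
have cf : {within `[0, 1], continuous (fun t : R => F (b + t%:C * (a - b)) : R[i]^o)}.
  by apply: continuous_on_line cF _ => t t01; exact: cU.
have H (f : R -> R) : {within `[0, 1], continuous f} ->
    \int[mu]_(x in `[0, 1]) f x = \int[mu]_(x in `[0, 1]) f (1 - x).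
  move=> cf'; rewrite (Rintegration_by_substitution_onem (r := 1))//; last first.
    by rewrite ler01 lexx.
  by rewrite unstable.onem1.
apply: complex_eq; rewrite /cint/=.
- rewrite (H (fun t => reC (F (b + t%:C * (a - b))))).
    apply: eq_Rintegral => t _; congr (reC (F _)).
    by apply: complex_eq; rewrite !reimE; ring.
  apply: (@within_continuous_comp R[i]^o R R _ (fun t => F (b + t%:C * (a - b)) :
      R[i]^o) reC) => // z _.
  exact: continuous_Re.
- rewrite (H (fun t => imC (F (b + t%:C * (a - b))))).
    apply: eq_Rintegral => t _; congr (imC (F _)).
    by apply: complex_eq; rewrite !reimE; ring.
  apply: (@within_continuous_comp R[i]^o R R _ (fun t => F (b + t%:C * (a - b)) :
      R[i]^o) imC) => // z _.
  exact: continuous_Im.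
Qed.

(** The right-hand side is the increment of the primitive k z + l z^2 / 2, so it telescopes to zero
    round a closed polygon; this disposes of the first-order Taylor polynomial in [Goursat]. *)
Lemma seg_affine_fun (k l : R[i]) a b :
  seg (fun z => k + l * z) a b = k * (b - a) + l * (b ^+ 2 - a ^+ 2) / 2.
Proof.
have cc (u v : R[i]) : {within `[0, 1], continuous (fun t : R => u + t%:C * v : R[i]^o)}.
  by apply: continuous_subspaceT; exact: continuous_line.
have E t : k + l * (a + t%:C * (b - a)) = (k + l * a) + t%:C * (l * (b - a)).
  by ring.
rewrite /seg; under eq_cint do rewrite E.
have m1 : fine (mu `[0%R, 1%R]) = 1.
  by rewrite lebesgue_measure_itv/= lte_fin ltr01 -EFinD/= subr0.
have ci := continuous_cintegrable (cc 0 1).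
have c1 : cintegrable mu `[0%R, 1%R] (fun=> k + l * a).
  apply: eq_cintegrable (continuous_cintegrable (cc (k + l * a) 0)) => // x _.
  by rewrite mulr0 addr0.
have c2 : cintegrable mu `[0%R, 1%R] (fun t : R => t%:C).
  by apply: eq_cintegrable ci => // x _; rewrite add0r mulr1.
have c3 : cintegrable mu `[0%R, 1%R] (fun t : R => t%:C * (l * (b - a))).
  by apply: eq_cintegrable (cintegrableZ (l * (b - a)) _ c2) => // x _; rewrite mulrC.
rewrite cintD//.
have -> : cint mu `[0%R, 1%R] (fun=> k + l * a) = k + l * a.
  by apply: complex_eq => /=; rewrite Rintegral_cst// m1 mulr1.
have -> : cint mu `[0%R, 1%R] (fun t : R => t%:C * (l * (b - a))) =
    (l * (b - a)) * (2^-1)%:C.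
  under eq_cint do rewrite mulrC.
  rewrite cintZ//; congr (_ * _); rewrite cint_real; congr (_%:C).
  have ct : {within `[0, 1], continuous (id : R -> R)}.
    by apply: continuous_subspaceT => x; exact: cvg_id.
  have i1 : mu.-integrable `[0, 1] (EFin \o (id : R -> R)).
    exact: continuous_compact_integrable (@segment_compact _ _ _) ct.
  have i2 : mu.-integrable `[0, 1] (EFin \o (cst 1 : R -> R)).
    apply: continuous_compact_integrable; first exact: segment_compact.
    by apply: continuous_subspaceT => x; exact: cvg_cst.
  (* The substitution t -> 1 - t shows that the integral I of t over [0, 1] satisfies I = 1 - I. *)
  have := Rintegration_by_substitution_onem (r := 1) _ ct.
  rewrite ler01 lexx unstable.onem1 => /(_ isT); rewrite [X in _ = X -> _]RintegralB//.
  rewrite (Rintegral_cst mu (D := `[0, 1]%classic))// m1 mulr1 => h.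
  have h' : \int[mu]_(t in `[0, 1]) t = 1 - \int[mu]_(t in `[0, 1]) t := h. lra.
have -> : (2^-1)%:C = 2^-1 :> R[i].
  by rewrite fmorphV rmorph_nat.
by field.
Qed.
End SegmentIntegral.

(** * Goursat's theorem on closed convex sets *)

Section Goursat.
Context {R : realType}.
Implicit Types (F G : R[i] -> R[i]) (U : set R[i]) (a b c z w p : R[i]).

(** Closedness in the form in which it is used: the limit point of nested triangles is approximated
    by their vertices. *)
Definition closedC U := forall p,
  (forall e : R, 0 < e -> exists2 z, U z & cmod (z - p) < e) -> U p.

Definition tri F a b c : R[i] := seg F a b + seg F b c + seg F c a.

Definition perim a b c : R := cmod (b - a) + cmod (c - b) + cmod (a - c).

Let mid a b : R[i] := a + (2^-1)%:C * (b - a).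

Let triangle := (R[i] * R[i] * R[i])%type.

Let trit F (T : triangle) := tri F T.1.1 T.1.2 T.2.

Let pert (T : triangle) := perim T.1.1 T.1.2 T.2.

(** Bisection: the first of the three corner triangles carrying at least a quarter of the integral,
    otherwise the middle one, taken without a test because [stepP] shows that it then qualifies. *)
Let step F (T : triangle) : triangle :=
  let: (a, b, c) := T in
  if cmod (trit F T) <= 4 * cmod (tri F a (mid a b) (mid c a))
  then (a, mid a b, mid c a) else
  if cmod (trit F T) <= 4 * cmod (tri F (mid a b) b (mid b c))
  then (mid a b, b, mid b c) else
  if cmod (trit F T) <= 4 * cmod (tri F (mid c a) (mid b c) c)
  then (mid c a, mid b c, c) else
  (mid a b, mid b c, mid c a).

Let inU U (T : triangle) := [/\ U T.1.1, U T.1.2 & U T.2].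

Let convex_mid U a b : convexC U -> U a -> U b -> U (mid a b).
Proof.
move=> cU Ua Ub; apply: cU => //.
by rewrite invr_ge0 ler0n invf_le1 ?ler1n.
Qed.

(** Each side of the middle triangle is traversed twice, in opposite directions. *)
Lemma tri_split U F a b c : convexC U -> continuousC U F -> U a -> U b -> U c ->
  tri F a b c = tri F a (mid a b) (mid c a) + tri F (mid a b) b (mid b c) +
    tri F (mid c a) (mid b c) c + tri F (mid a b) (mid b c) (mid c a).
Proof.
move=> cU cF Ua Ub Uc; rewrite /tri.
have U1 := convex_mid cU Ua Ub; have U2 := convex_mid cU Ub Uc.
have U3 := convex_mid cU Uc Ua.
rewrite (seg_split cU cF Ua Ub) (seg_split cU cF Ub Uc) (seg_split cU cF Uc Ua).
rewrite -/(mid a b) -/(mid b c) -/(mid c a).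
rewrite (seg_rev cU cF U3 U1) (seg_rev cU cF U1 U2) (seg_rev cU cF U2 U3).
move: (seg F a (mid a b)) (seg F (mid a b) b) (seg F b (mid b c)) (seg F (mid b c) c)
  (seg F c (mid c a)) (seg F (mid c a) a) (seg F (mid c a) (mid a b))
  (seg F (mid a b) (mid b c)) (seg F (mid b c) (mid c a)) => *; ring.
Qed.

Let cmod_half z : cmod ((2^-1)%:C * z) = cmod z / 2.
Proof. by rewrite cmodM cmod_real ger0_norm ?invr_ge0// mulrC. Qed.

Let half_add : (2^-1 : R)%:C + (2^-1 : R)%:C = 1.
Proof. by apply: complex_eq => /=; lra. Qed.

Let half1 : 1 - (2^-1 : R)%:C = (2^-1)%:C.
Proof. by rewrite -half_add addrK. Qed.

Let mid_l a b : cmod (mid a b - a) = cmod (b - a) / 2.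
Proof. by rewrite -cmod_half; congr cmod; rewrite /mid; ring. Qed.

Let mid_r a b : cmod (b - mid a b) = cmod (b - a) / 2.
Proof.
rewrite -cmod_half -half1; congr cmod; rewrite /mid; ring.
Qed.

Let mid_mid a b c : cmod (mid b c - mid a b) = cmod (c - a) / 2.
Proof.
rewrite -cmod_half; congr cmod; rewrite /mid.
transitivity ((1 - (2^-1)%:C) * b + (2^-1)%:C * c - (1 - (2^-1)%:C) * a - (2^-1)%:C * b).
  by ring.
by rewrite half1; ring.
Qed.

Lemma stepP U F T : convexC U -> continuousC U F -> inU U T ->
  [/\ inU U (step F T), pert (step F T) = pert T / 2,
      cmod (trit F T) <= 4 * cmod (trit F (step F T)) &
      cmod ((step F T).1.1 - T.1.1) <= pert T].
Proof.
case: T => [[a b] c] cU cF [/= Ua Ub Uc].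
have U1 := convex_mid cU Ua Ub; have U2 := convex_mid cU Ub Uc.
have U3 := convex_mid cU Uc Ua.
have E := tri_split cU cF Ua Ub Uc.
have Dab := cmod_ge0 (b - a); have Dbc := cmod_ge0 (c - b).
have Dca := cmod_ge0 (a - c).
have la : cmod (mid a b - a) <= cmod (b - a) by rewrite mid_l; lra.
have lc : cmod (mid c a - a) <= cmod (a - c) by rewrite cmod_distC mid_r; lra.
have dba : cmod (a - b) = cmod (b - a) by rewrite cmod_distC.
have dcb : cmod (b - c) = cmod (c - b) by rewrite cmod_distC.
have dac : cmod (c - a) = cmod (a - c) by rewrite cmod_distC.
rewrite /step; case: ifPn => [h|h1].
  split=> //; rewrite /pert/perim/=; last by rewrite subrr cmod0; lra.
  rewrite mid_l mid_r (cmod_distC (mid c a)) mid_mid dcb; lra.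
case: ifPn => [h|h2].
  split=> //; rewrite /pert/perim/=; last by lra.
  rewrite mid_r mid_l (cmod_distC (mid a b)) mid_mid dac; lra.
case: ifPn => [h|h3].
  split=> //; rewrite /pert/perim/=; last by lra.
  rewrite mid_r mid_l (cmod_distC (mid b c)) mid_mid dba; lra.
split=> //; rewrite /pert/perim/=; last by lra.
  rewrite !mid_mid dac dba dcb; lra.
rewrite /trit/=; move: h1 h2 h3; rewrite -!ltNge /trit/= => h1 h2 h3.
(* If the middle triangle failed as well, four integrals each below a quarter of the whole would add
   up to the whole. *)
rewrite leNgt; apply/negP => h4.
have := cmodD (tri F a (mid a b) (mid c a) + tri F (mid a b) b (mid b c) +
    tri F (mid c a) (mid b c) c) (tri F (mid a b) (mid b c) (mid c a)).
have := cmodD (tri F a (mid a b) (mid c a) + tri F (mid a b) b (mid b c))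
    (tri F (mid c a) (mid b c) c).
have := cmodD (tri F a (mid a b) (mid c a)) (tri F (mid a b) b (mid b c)).
rewrite -E; lra.
Qed.

(** The intervals of centre [u n] and radius 2 C / 2^n are nested, since the radius drops by C / 2^n
    at each step; the supremum of their left ends lies in all of them. *)
Lemma geometric_cauchyR (u : nat -> R) (C : R) :
  (forall n, `|u n.+1 - u n| <= C / 2 ^+ n) ->
  exists l, forall n, `|u n - l| <= 2 * C / 2 ^+ n.
Proof.
move=> uC.
pose v n := u n - 2 * C / 2 ^+ n; pose w n := u n + 2 * C / 2 ^+ n.
have p2 n : (0 : R) < 2 ^+ n by rewrite exprn_gt0.
have half n : 2 * C / 2 ^+ n.+1 = C / 2 ^+ n.
  by rewrite exprS invfM mulrACA divff ?mul1r// pnatr_eq0.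
have dbl n : 2 * C / 2 ^+ n = C / 2 ^+ n + C / 2 ^+ n by rewrite -mulrDl; congr (_ / _); ring.
have vS n : v n <= v n.+1.
  by rewrite /v half dbl; have := uC n; rewrite ler_norml => /andP[]; lra.
have wS n : w n.+1 <= w n.
  by rewrite /w half dbl; have := uC n; rewrite ler_norml => /andP[]; lra.
have C0 : 0 <= C.
  by have := uC 0%N; rewrite expr0 divr1; apply: le_trans.
have vw n : v n <= w n.
  by rewrite /v /w lerD2l ge0_cp// divr_ge0 ?mulr_ge0// ltW.
have vm n m : (n <= m)%N -> v n <= v m.
  by move=> /subnKC <-; elim: (m - n)%N => [|k ih]; rewrite ?addn0// addnS (le_trans ih).
have wm n m : (n <= m)%N -> w m <= w n.
  by move=> /subnKC <-; elim: (m - n)%N => [|k ih]; rewrite ?addn0// addnS (le_trans _ ih).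
have vwnm n m : v n <= w m.
  rewrite (le_trans (vm _ _ (leq_maxl n m)))// (le_trans (vw _))//.
  exact: wm (leq_maxr n m).
exists (sup (range v)) => n.
have ub : has_ubound (range v) by exists (w 0%N) => _ [k _ <-]; exact: vwnm.
have h1 : v n <= sup (range v) by apply: ub_le_sup => //; exists n.
have h2 : sup (range v) <= w n.
  by apply: ge_sup; [exists (v 0%N), 0%N|move=> _ [k _ <-]].
by rewrite ler_norml; move: h1 h2; rewrite /v /w; lra.
Qed.

Lemma geometric_cauchyC (u : nat -> R[i]) (C : R) :
  (forall n, cmod (u n.+1 - u n) <= C / 2 ^+ n) ->
  exists l, forall n, cmod (u n - l) <= 4 * C / 2 ^+ n.
Proof.
move=> uC.
have [x hx] : exists l, forall n, `|reC (u n) - l| <= 2 * C / 2 ^+ n.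
  apply: geometric_cauchyR => n; rewrite (le_trans _ (uC n))//.
  by rewrite (le_trans _ (cmod_re _))// !reimE.
have [y hy] : exists l, forall n, `|imC (u n) - l| <= 2 * C / 2 ^+ n.
  apply: geometric_cauchyR => n; rewrite (le_trans _ (uC n))//.
  by rewrite (le_trans _ (cmod_im _))// !reimE.
exists (x +i* y) => n; rewrite (le_trans (cmod_le_reim _))// !reimE/=.
have -> : 4 * C / 2 ^+ n = 2 * C / 2 ^+ n + 2 * C / 2 ^+ n.
  by rewrite -mulrDl; congr (_ / _); ring.
exact: lerD.
Qed.

Lemma holomorphic_continuousC U F : holomorphic_on U F -> continuousC U F.
Proof. by move=> hF z Uz; exact/derivable_continuousC/hF. Qed.

Theorem Goursat U F a b c : convexC U -> closedC U -> holomorphic_on U F ->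
  U a -> U b -> U c -> tri F a b c = 0.
Proof.
move=> cU clU hF Ua Ub Uc.
have cF := holomorphic_continuousC hF.
apply/eqP; apply: contraT => tri0.
have eta0 := cmod_gt0 tri0; set eta := cmod _ in eta0.
pose T n := iter n (step F) (a, b, c); pose P0 := pert (a, b, c).
have TU n : inU U (T n).
  by elim: n => [|n ih] //=; have [] := stepP cU cF ih.
have TP n : pert (T n) = P0 / 2 ^+ n.
  elim: n => [|n ih]; first by rewrite expr0 divr1.
  by have [_ + _ _] := stepP cU cF (TU n); rewrite /= => ->; rewrite ih exprSr invfM mulrA.
have Teta n : eta <= 4 ^+ n * cmod (trit F (T n)).
  elim: n => [|n ih]; first by rewrite expr0 mul1r.
  have [_ _ + _] := stepP cU cF (TU n); rewrite /= => h.
  by rewrite (le_trans ih)// exprSr -mulrA ler_pM2l// exprn_gt0.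
have [p hp] : exists p, forall n, cmod ((T n).1.1 - p) <= 4 * P0 / 2 ^+ n.
  apply: (@geometric_cauchyC (fun n => (T n).1.1)) => n; rewrite -TP.
  by have [_ _ _] := stepP cU cF (TU n).
have P00 : 0 <= P0 by rewrite !addr_ge0 ?cmod_ge0.
have small (e : R) : 0 < e -> exists n, 6 * P0 / 2 ^+ n < e.
  move=> e0; exists (Num.truncn (6 * P0 / e)).+1; rewrite ltr_pdivrMr ?exprn_gt0//.
  rewrite [ltRHS]mulrC -ltr_pdivrMr//.
  have h k : (k%:R : R) <= 2 ^+ k by rewrite -natrX ler_nat ltnW// ltn_expl.
  by rewrite (lt_le_trans _ (h _))// truncnS_gt.
have Up : U p.
  apply: clU => e /small[n hn]; exists (T n).1.1; first by have [] := TU n.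
  rewrite (le_lt_trans (hp n))// (le_lt_trans _ hn)// ler_pM2r ?invr_gt0 ?exprn_gt0//; lra.
have [l hl] := derivable_cmod (hF p Up).
(* The estimates below end in eta <= 12 e P0^2, which this choice makes at most eta / 2; the added 1
   covers the case P0 = 0. *)
pose e := eta / (24 * (P0 ^+ 2 + 1)).
have P1 : 0 < P0 ^+ 2 + 1 by rewrite ltr_wpDl ?sqr_ge0.
have e0 : 0 < e by rewrite divr_gt0// mulr_gt0.
have [d d0 hd] := hl _ e0.
have [n hn] := small _ d0.
pose k := F p - l * p.
(* The remainder after the tangent at [p]; the affine part contributes nothing round the
   triangle. *)
pose r z := F z - (k + l * z).
have caff V : continuousC V (fun z => k + l * z).
  move=> z _; apply/continuous_cmodP => e1 e10; exists (e1 / (cmod l + 1)).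
    by rewrite divr_gt0// ltr_wpDl ?cmod_ge0.
  move=> w; rewrite ltr_pdivlMr ?ltr_wpDl ?cmod_ge0// => h.
  have -> : k + l * w - (k + l * z) = (w - z) * l by ring.
  rewrite cmodM (le_lt_trans _ h)// ler_wpM2l ?cmod_ge0//; lra.
have cr : continuousC U r.
  by move=> z Uz; exact: (continuousB (cF z Uz) (caff U z Uz)).
have segE x y : U x -> U y ->
    seg F x y = seg r x y + (k * (y - x) + l * (y ^+ 2 - x ^+ 2) / 2).
  move=> Ux Uy; rewrite -seg_affine_fun -(segD cU cr (caff U) Ux Uy).
  by apply: eq_seg cU Ux Uy _ => z _; rewrite /r subrK.
have [] := TU n; have := hp n; have := TP n; have := Teta n.
case: (T n) => [[x y] z]; rewrite /trit/pert/perim/tri/=.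
move=> h1 h2 h3 Ux Uy Uz.
set Pn := P0 / 2 ^+ n in h2.
have h3' : cmod (x - p) <= 4 * Pn by rewrite /Pn mulrA.
have hn' : 6 * Pn < d by rewrite /Pn mulrA.
have Dab := cmod_ge0 (y - x); have Dbc := cmod_ge0 (z - y).
have Dca := cmod_ge0 (x - z).
(* A point of the boundary is within 2 Pn of the vertex [x], itself within 4 Pn of [p]: hence the
   radius 6 Pn in the differentiability estimate. *)
have segr u v : U u -> U v -> cmod (u - x) + cmod (v - u) <= 2 * Pn ->
    cmod (seg r u v) <= 2 * (e * (6 * Pn)) * cmod (v - u).
  move=> Uu Uv uv; apply: (seg_le cU cr Uu Uv) => t /andP[t0 t1].
  set s := u + _.
  have sp : cmod (s - p) <= 6 * Pn.
    have -> : s - p = t%:C * (v - u) + ((u - x) + (x - p)) by rewrite /s; ring.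
    have := cmodD (t%:C * (v - u)) ((u - x) + (x - p)).
    have := cmodD (u - x) (x - p); rewrite cmodM cmod_real ger0_norm//.
    have := ler_piMl (cmod_ge0 (v - u)) t1; lra.
  have -> : r s = F s - F p - l * (s - p) by rewrite /r /k; ring.
  rewrite (le_trans (hd _ _))//; first by rewrite (le_lt_trans sp).
  by rewrite ler_pM2l.
rewrite !segE// in h1.
have rxy := segr x y Ux Uy; have ryz := segr y z Uy Uz; have rzx := segr z x Uz Ux.
rewrite subrr cmod0 in rxy; rewrite (cmod_distC z x) in rzx.
move: h1; set A := seg r x y; set B := seg r y z; set D := seg r z x.
have -> : A + (k * (y - x) + l * (y ^+ 2 - x ^+ 2) / 2) +
   (B + (k * (z - y) + l * (z ^+ 2 - y ^+ 2) / 2)) +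
   (D + (k * (x - z) + l * (x ^+ 2 - z ^+ 2) / 2)) = A + B + D by field.
move=> h1.
have ABD : cmod (A + B + D) <= 12 * e * Pn ^+ 2.
  have -> : 12 * e * Pn ^+ 2 = 2 * (e * (6 * Pn)) * (cmod (y - x) + cmod (z - y) + cmod
      (x - z)).
    by rewrite h2; ring.
  have := cmodD (A + B) D; have := cmodD A B.
  have := rxy _; have := ryz _; have := rzx _; rewrite !mulrDr.
  move=> q1 q2 q3.
  have := q1 ltac:(clear -h2 Dab Dbc Dca; lra).
  have := q2 ltac:(clear -h2 Dab Dbc Dca; lra).
  have := q3 ltac:(clear -h2 Dab Dbc Dca; lra).
  clear; lra.
have : eta <= 12 * e * P0 ^+ 2.
  rewrite (le_trans h1)//; have -> : 12 * e * P0 ^+ 2 = 4 ^+ n * (12 * e * Pn ^+ 2).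
    have -> : 4 ^+ n = (2 ^+ n) ^+ 2 :> R.
      by rewrite -exprM mulnC exprM; congr (_ ^+ n); rewrite expr2; ring.
    have : (2 ^+ n : R) != 0 by rewrite expf_neq0.
    by rewrite /Pn; move: (2 ^+ n) => q q0; field.
  by rewrite ler_pM2l// exprn_gt0.
have -> : 12 * e * P0 ^+ 2 = eta / 2 * (P0 ^+ 2 / (P0 ^+ 2 + 1)).
  by rewrite /e; field; rewrite gt_eqF.
have : P0 ^+ 2 / (P0 ^+ 2 + 1) <= 1 by rewrite ler_pdivrMr// mul1r lerDl.
move=> u1; have := ler_piMr (ltW (divr_gt0 eta0 (ltr0n _ 2))) u1; lra.
Qed.

(** Two triangles glued along the diagonal from [b] to [z]. *)
Corollary Cauchy_quadrilateral U F a b c z :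
  convexC U -> closedC U -> holomorphic_on U F -> U a -> U b -> U c -> U z ->
  seg F a b + seg F b c + seg F c z + seg F z a = 0.
Proof.
move=> cU clU hF Ua Ub Uc Uz.
have cF := holomorphic_continuousC hF.
have := Goursat cU clU hF Ua Ub Uz; have := Goursat cU clU hF Ub Uc Uz.
rewrite /tri (seg_rev cU cF Ub Uz) => h1 h2.
by rewrite -[RHS](addr0 0) -[X in _ = X + _]h1 -h2; ring.
Qed.

End Goursat.

(** * Differentiability of exponential, principal logarithm and powers *)

Section ComplexPower.
Context {R : realType}.
Implicit Types (z w : R[i]) (x y t e l : R) (f g : R[i] -> R[i]).

Lemma derivable_compC f g z :
  derivable (f : R[i]^o -> R[i]^o) z 1 ->
  derivable (g : R[i]^o -> R[i]^o) (f z) 1 ->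
  derivable ((fun w => g (f w)) : R[i]^o -> R[i]^o) z 1.
Proof.
move=> /derivable1_diffP df /derivable1_diffP dg.
by apply/derivable1_diffP; exact: (differentiable_comp df dg).
Qed.

Lemma derivableMC f g z :
  derivable (f : R[i]^o -> R[i]^o) z 1 ->
  derivable (g : R[i]^o -> R[i]^o) z 1 ->
  derivable ((fun w => f w * g w) : R[i]^o -> R[i]^o) z 1.
Proof. by move=> df dg; exact: (derivableM df dg). Qed.

Lemma derivableDC f g z :
  derivable (f : R[i]^o -> R[i]^o) z 1 ->
  derivable (g : R[i]^o -> R[i]^o) z 1 ->
  derivable ((fun w => f w + g w) : R[i]^o -> R[i]^o) z 1.
Proof. by move=> df dg; exact: (derivableD df dg). Qed.

Lemma derivableBC f g z :
  derivable (f : R[i]^o -> R[i]^o) z 1 ->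
  derivable (g : R[i]^o -> R[i]^o) z 1 ->
  derivable ((fun w => f w - g w) : R[i]^o -> R[i]^o) z 1.
Proof. by move=> df dg; exact: (derivableB df dg). Qed.

Lemma derivable_cstC (k : R[i]) z :
  derivable ((fun=> k) : R[i]^o -> R[i]^o) z 1.
Proof. exact: derivable_cst. Qed.

Lemma derivable_idC z : derivable ((fun w => w) : R[i]^o -> R[i]^o) z 1.
Proof. exact: derivable_id. Qed.

Lemma is_derive_realP (f : R -> R) x (l : R) : is_derive x (1 : R) f l ->
  forall e, 0 < e -> exists2 d, 0 < d & forall t, `|t| < d ->
    `|f (x + t) - f x - l * t| <= e * `|t|.
Proof.
move=> [df dl] e e0.
have : h^-1 *: (f (h *: 1 + x) - f x) @[h --> (0 : R)^'] --> l.
  by rewrite -dl; exact: df.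
move=> /cvgrPdist_lt/(_ _ e0)/nbhs_ballP[d /= d0 hd]; exists d => // t td.
have [->|t0] := eqVneq t 0; first by rewrite addr0 subrr mulr0 subrr normr0 mulr0.
have := hd t; rewrite /ball/= sub0r normrN => /(_ td t0) /ltW.
rewrite /GRing.scale/= mulr1 -(ler_pM2r (_ : 0 < `|t|)) ?normr_gt0// -normrM.
have -> : (l - t^-1 * (f (t + x) - f x)) * t = l * t - (f (t + x) - f x) by field.
by rewrite distrC [x + t]addrC.
Qed.

(** The derivative of [cexp] at 0, assembled from those of the real exponential, cosine and sine;
    the functional equation carries it to every other point. *)
Lemma cexp_sub1 e : 0 < e -> exists2 d, 0 < d & forall h : R[i], cmod h < d ->
  cmod (cexp h - 1 - h) <= e * cmod h.
Proof.
move=> e0.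
(* The real and imaginary parts will contribute 3 e1 and 4 e1, whence the 8. The radius e1 / 2
   chosen below makes |exp x - 1| at most e1. *)
pose e1 := Num.min 1 (e / 8).
have e10 : 0 < e1 by rewrite lt_min ltr01 divr_gt0.
have e11 : e1 <= 1 by rewrite ge_min lexx.
have e18 : 8 * e1 <= e.
  by rewrite mulrC -ler_pdivlMr// ge_min lexx orbT.
have [d1 d10 h1] := is_derive_realP (is_derive_expR (0 : R)) e10.
have [d2 d20 h2] := is_derive_realP (is_derive_sin (0 : R)) e10.
have [d3 d30 h3] := is_derive_realP (is_derive_cos (0 : R)) e10.
pose d := Num.min (Num.min d1 d2) (Num.min d3 (e1 / 2)).
have dd : [/\ d <= d1, d <= d2, d <= d3 & d <= e1 / 2].
  by split; rewrite /d !ge_min lexx ?orbT.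
exists d; first by rewrite !lt_min d10 d20 d30 divr_gt0.
case: dd => dd1 dd2 dd3 dd4 [x y] hd.
have xr := le_lt_trans (cmod_re (x +i* y)) hd.
have yr := le_lt_trans (cmod_im (x +i* y)) hd.
have xh := cmod_re (x +i* y); have yh := cmod_im (x +i* y).
rewrite /= in xr yr xh yh.
have {h1} := h1 x (lt_le_trans xr dd1).
have {h2} := h2 y (lt_le_trans yr dd2).
have {h3} := h3 y (lt_le_trans yr dd3).
rewrite !add0r expR0 sin0 cos0 mul1r subr0 oppr0 mul0r subr0 mul1r.
set X := expR x; set C := cos y; set S := sin y => h3 h2 h1.
have C1 : `|C| <= 1 := cos_max y.
have ax : 0 <= `|x| by []. have ay : 0 <= `|y| by [].
rewrite (le_trans (cmod_le_reim _))// !reimE/= -/X -/C -/S subr0.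
have R1 : `|X * C - 1 - x| <= 3 * e1 * cmod (x +i* y).
  have -> : X * C - 1 - x = C * (X - 1 - x) + (C - 1) * (1 + x) by ring.
  rewrite (le_trans (ler_normD _ _))// !normrM.
  have p1 : `|C| * `|X - 1 - x| <= e1 * `|x| by rewrite -[leRHS]mul1r ler_pM.
  have p2 : `|C - 1| * `|1 + x| <= e1 * `|y| * 2.
    rewrite ler_pM// (le_trans (ler_normD _ _))// normr1; lra.
  nra.
have R2 : `|X * S - y| <= 4 * e1 * cmod (x +i* y).
  have -> : X * S - y = (X - 1) * S + (S - y) by ring.
  rewrite (le_trans (ler_normD _ _))// normrM.
  have p1 : `|S| <= 2 * `|y|.
    have -> : S = (S - y) + y by ring.
    rewrite (le_trans (ler_normD _ _))//; nra.
  have p2 : `|X - 1| <= e1.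
    have -> : X - 1 = (X - 1 - x) + x by ring.
    rewrite (le_trans (ler_normD _ _))//; nra.
  have p3 : `|X - 1| * `|S| <= e1 * (2 * `|y|) by rewrite ler_pM.
  nra.
have := cmod_ge0 (x +i* y); nra.
Qed.

Lemma is_derive_cexp z : is_derive (z : R[i]^o) 1 (cexp : R[i]^o -> R[i]^o) (cexp z).
Proof.
apply/is_derive_cmodP => e e0.
have [d d0 hd] := cexp_sub1 (divr_gt0 e0 (expR_gt0 (reC z))).
exists d => // w wz.
have -> : cexp w - cexp z - cexp z * (w - z) = cexp z * (cexp (w - z) - 1 - (w - z)).
  have -> : cexp w = cexp z * cexp (w - z) by rewrite -cexpD addrC subrK.
  by ring.
rewrite cmodM cmod_cexp mulrC -ler_pdivlMr ?expR_gt0// mulrAC.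
exact: hd.
Qed.

Lemma derivable_cexp z : derivable (cexp : R[i]^o -> R[i]^o) z 1.
Proof. by have [] := is_derive_cexp z. Qed.

(** The plane without the half-line of nonpositive reals: the sum is never negative and vanishes
    exactly there. It is also the denominator of the half-angle formula in [carg_atan]. *)
Definition slit_plane : set R[i] := [set w | 0 < cmod w + reC w].

Lemma slit_plane_re w : 0 < reC w -> slit_plane w.
Proof. by move=> h; rewrite /slit_plane/= ltr_wpDl ?cmod_ge0. Qed.

Lemma slit_plane_im w : imC w != 0 -> slit_plane w.
Proof.
move=> h; rewrite /slit_plane/=.
have : `|reC w| < cmod w.
  rewrite -(@ltr_pXn2r _ 2)// ?nnegrE ?cmod_ge0// cmod_sqr real_normK ?num_real//.
  by rewrite ltrDl lt_neqAle eq_sym sqrf_eq0 h sqr_ge0.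
by rewrite ltr_norml => /andP[]; lra.
Qed.

Lemma slit_plane_neq0 w : slit_plane w -> w != 0.
Proof. by move=> + ; apply: contraPneq => ->; rewrite /slit_plane/= cmod0 addr0 ltxx. Qed.

(** The identity tan (theta / 2) = sin theta / (1 + cos theta). Unlike the definition of [carg], it
    involves no case distinction on the sign of the imaginary part, so continuity across the
    positive axis is immediate. *)
Lemma carg_atan w : slit_plane w ->
  carg w = 2 * atan (imC w / (cmod w + reC w)).
Proof.
move=> sw; have w0 := slit_plane_neq0 sw; have m0 := cmod_gt0 w0.
rewrite /slit_plane/= in sw.
set t := imC w / _; set th := 2 * atan t.
have E : reC w / cmod w = cos th.
  rewrite /th mulr_natl cos_mulr2n cos_atan exprVn sqr_sqrtr ?addr_ge0 ?sqr_ge0//.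
  have -> : 1 + t ^+ 2 = 2 * cmod w / (cmod w + reC w).
    have h := cmod_sqr w.
    have : (cmod w + reC w) ^+ 2 + imC w ^+ 2 = 2 * cmod w * (cmod w + reC w).
      by rewrite sqrrD -addrA -h; ring.
    have s0 : cmod w + reC w != 0 by rewrite gt_eqF.
    rewrite /t; move: (cmod w + reC w) s0 => s s0 hs.
    apply: (@mulIf _ (s ^+ 2)); first by rewrite expf_neq0.
    have -> : (1 + (imC w / s) ^+ 2) * s ^+ 2 = s ^+ 2 + imC w ^+ 2 by field.
    by rewrite hs; field.
  rewrite mulr2n; field; rewrite gt_eqF//= gt_eqF//.
have a1 := atan_ltpi2 t; have a2 := atan_gtNpi2 t.
rewrite /carg E; case: (leP 0 (imC w)) => im.
  rewrite cosK// in_itv/=; apply/andP; split; last by rewrite /th; lra.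
  rewrite mulr_ge0// -(@atan0 R) le_atan//.
  by rewrite /t divr_ge0// ltW.
rewrite cosKN ?opprK//; apply/andP; split; first by rewrite /th; lra.
rewrite /th -[leRHS](mulr0 2) ler_pM2l// -(@atan0 R) le_atan//.
by rewrite /t ler_pdivrMr// mul0r ltW.
Qed.

Lemma near_slit_plane z : slit_plane z ->
  \forall w \near (z : R[i]^o), slit_plane w.
Proof.
move=> sz.
have c : {for z, continuous ((fun w => cmod w + reC w) : R[i]^o -> R)}.
  exact: (continuousD (@continuous_cmod _ z) (@continuous_Re _ z)).
exact: (cvgr_gt _ c _ sz).
Qed.

Lemma continuous_clog z : slit_plane z ->
  {for z, continuous (clog : R[i]^o -> R[i]^o)}.
Proof.
move=> sz; apply: continuous_mkC.
  apply: (@continuous_comp _ _ _ (cmod : R[i]^o -> R) (@ln R)).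
    exact: continuous_cmod.
  by apply: continuous_ln; exact: cmod_gt0 (slit_plane_neq0 sz).
have c : {for z, continuous ((fun w => 2 * atan (imC w / (cmod w + reC w))) : R[i]^o -> R)}.
  have c1 := continuousD (@continuous_cmod _ z) (@continuous_Re _ z).
  have c2 : {for z, continuous ((fun w => (cmod w + reC w)^-1) : R[i]^o -> R)}.
    exact: (cvgV (lt0r_neq0 sz) c1).
  have c3 := continuousM (@continuous_Im _ z) c2.
  have c4 : {for z, continuous ((fun w => atan (imC w / (cmod w + reC w))) : R[i]^o -> R)}.
    exact: (continuous_comp c3 (@continuous_atan _ _)).
  exact: (continuous_comp c4 (@mulrl_continuous _ 2 _)).
have e : \forall w \near (z : R[i]^o), 2 * atan (imC w / (cmod w + reC w)) = imC (clog w).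
  by apply: filterS (near_slit_plane sz) => w sw; rewrite /clog/= carg_atan.
apply: cvg_trans (near_eq_cvg e) _.
by rewrite /= carg_atan.
Qed.

Lemma clogK z : z != 0 -> cexp (clog z) = z.
Proof.
move=> z0; rewrite [RHS]carg_polar// /cexp/clog/= lnK//.
exact: cmod_gt0.
Qed.

(** Inverse function argument: h = clog w - clog z tends to 0 by continuity, w = z exp h, and exp h
    - 1 = (w - z) / z is h up to a small multiple of h. *)
Lemma is_derive_clog z : slit_plane z ->
  is_derive (z : R[i]^o) 1 (clog : R[i]^o -> R[i]^o) z^-1.
Proof.
move=> sz; have z0 := slit_plane_neq0 sz; have m0 := cmod_gt0 z0.
apply/is_derive_cmodP => e e0.
(* The bound 1 / 2 yields |h| <= 2 |w - z| / |z|; inserting this into the error e1 |h| explains the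
   other bound. *)
pose e1 := Num.min (1 / 2) (e * cmod z / 2).
have e10 : 0 < e1 by rewrite lt_min !divr_gt0// mulr_gt0.
have e11 : e1 <= 1 / 2 by rewrite ge_min lexx.
have e12 : e1 <= e * cmod z / 2 by rewrite ge_min lexx orbT.
have [d1 d10 h1] := cexp_sub1 e10.
have [d2 d20 h2] := (continuous_cmodP clog z).1 (continuous_clog sz) _ d10.
exists (Num.min d2 (cmod z)); first by rewrite lt_min d20.
move=> w; rewrite lt_min => /andP[wz wz2].
have w0 : w != 0.
  by apply: contraTneq wz2 => ->; rewrite sub0r cmodN ltxx.
have := h1 _ (h2 _ wz); set h := clog w - clog z.
have E : w = z * cexp h.
  rewrite -[LHS](clogK w0) -[X in _ = X * _](clogK z0) -cexpD; congr cexp.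
  by rewrite /h addrC subrK.
have -> : cexp h - 1 - h = (w - z) / z - h by rewrite E; field.
rewrite [_ / z]mulrC => k1; rewrite (cmod_distC _ h) in k1.
have k2 : cmod h <= 2 * cmod (z^-1 * (w - z)).
  have := cmodD (h - z^-1 * (w - z)) (z^-1 * (w - z)); rewrite subrK.
  have := ler_wpM2r (cmod_ge0 h) e11; lra.
rewrite (le_trans k1)//.
rewrite cmodM cmodV in k2.
have u0 := cmod_ge0 (w - z).
rewrite (le_trans (ler_wpM2l (ltW e10) k2))//.
rewrite (le_trans (ler_wpM2r _ e12))//.
  by rewrite mulr_ge0// mulr_ge0// invr_ge0 ltW.
have -> : e * cmod z / 2 * (2 * ((cmod z)^-1 * cmod (w - z))) = e * cmod (w - z).
  by field; rewrite gt_eqF.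
by [].
Qed.

Lemma derivable_cpow z l : slit_plane z ->
  derivable ((fun w => cpow w l) : R[i]^o -> R[i]^o) z 1.
Proof.
move=> sz; apply: (@derivable_compC (fun w => l%:C * clog w) cexp).
  apply: derivableMC; first exact: derivable_cstC.
  by have [] := is_derive_clog sz.
exact: derivable_cexp.
Qed.

Lemma cmod_cpow z l : z != 0 -> cmod (cpow z l) = cmod z `^ l.
Proof.
move=> z0; rewrite /cpow cmod_cexp reMr /powR.
by rewrite gt_eqF// cmod_gt0.
Qed.

Lemma carg_real x : 0 < x -> carg x%:C = 0.
Proof. by move=> x0; rewrite /carg/= lexx cmod_real gtr0_norm// divff ?gt_eqF// acos1. Qed.

Lemma clog_real x : 0 < x -> clog x%:C = (ln x)%:C.
Proof. by move=> x0; rewrite /clog carg_real// cmod_real gtr0_norm. Qed.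

Lemma cpow_real x l : 0 < x -> cpow x%:C l = (x `^ l)%:C.
Proof.
move=> x0; rewrite /cpow clog_real//.
have -> : l%:C * (ln x)%:C = (l * ln x)%:C :> R[i] by rewrite -rmorphM.
by rewrite cexp_real /powR gt_eqF.
Qed.

Lemma clogM_real x z : 0 < x -> z != 0 -> clog (x%:C * z) = (ln x)%:C + clog z.
Proof.
move=> x0 z0; have m0 := cmod_gt0 z0.
have M : cmod (x%:C * z) = x * cmod z by rewrite cmodM cmod_real gtr0_norm.
have A : carg (x%:C * z) = carg z.
  rewrite /carg M reMr imMr pmulr_rge0//.
  by rewrite -mulf_div divff ?gt_eqF// mul1r.
by apply: complex_eq; rewrite ?reD ?imD /clog M A /= ?add0r// lnM.
Qed.

Lemma cpowM_real x z l : 0 < x -> z != 0 ->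
  cpow (x%:C * z) l = (x `^ l)%:C * cpow z l.
Proof.
move=> x0 z0; rewrite -cpow_real// /cpow clogM_real// clog_real//.
by rewrite mulrDr cexpD.
Qed.

Lemma cpowS z l : z != 0 -> cpow z (l + 1) = cpow z l * z.
Proof.
move=> z0; rewrite /cpow -{3}(clogK z0) -cexpD; congr cexp.
by rewrite rmorphD/= mulrDl mul1r.
Qed.

Lemma cpowN z l : cpow z (- l) = (cpow z l)^-1.
Proof. by rewrite /cpow -cexpN rmorphN/= mulNr. Qed.

Lemma cpow_neq0 z l : cpow z l != 0.
Proof. exact: cexp_neq0. Qed.

End ComplexPower.

(** * Dominated convergence for real-valued integrals *)

Section RealIntegrals.
Context d (T : measurableType d) (R : realType) (m : {measure set T -> \bar R}).
Implicit Types (D : set T) (f g : T -> R).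

Lemma Rdominated_convergence D (f_ : nat -> T -> R) f g : measurable D ->
  (forall n, measurable_fun D (f_ n)) -> measurable_fun D f ->
  (forall x, D x -> f_ n x @[n --> \oo] --> f x) ->
  m.-integrable D (EFin \o g) ->
  (forall n x, D x -> `|f_ n x| <= g x) ->
  m.-integrable D (EFin \o f) /\
  (\int[m]_(x in D) f_ n x) @[n --> \oo] --> \int[m]_(x in D) f x.
Proof.
move=> mD mf_ mf f_f ig fg.
have [|||//||if_ _ h] := @dominated_convergence _ _ _ m D mD (fun n => EFin \o f_ n)
    (EFin \o f) (EFin \o g).
- by move=> n; exact/measurable_EFinP/mf_.
- exact/measurable_EFinP/mf.
- apply: aeW => x Dx; apply: cvg_EFin; last exact: f_f.
  by apply: nearW.
- by apply: aeW => x n Dx; rewrite lee_fin; exact: fg.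
split=> //.
have ifn n : m.-integrable D (EFin \o f_ n).
  apply: le_integrable ig => //; first exact/measurable_EFinP/mf_.
  by move=> x Dx; rewrite /= lee_fin (le_trans (fg n x Dx))// ler_norm.
have h' : (\int[m]_(x in D) (f_ n x)%:E)%E @[n --> \oo] -->
    (\int[m]_(x in D) f x)%:E.
  by rewrite /Rintegral fineK; [exact: h|exact: integrable_fin_num].
exact: (fine_cvg h').
Qed.

Lemma Rintegral_cvg_sets D (D_ : nat -> set T) f : measurable D ->
  (forall n, measurable (D_ n)) -> (forall n, D_ n `<=` D) ->
  (forall x, D x -> \forall n \near \oo, D_ n x) ->
  m.-integrable D (EFin \o f) ->
  (\int[m]_(x in D_ n) f x) @[n --> \oo] --> \int[m]_(x in D) f x.
Proof.
move=> mD mD_ D_D D_x fi.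
have mf : measurable_fun D f by exact/measurable_EFinP/(measurable_int _ fi).
have [||||||_] := @Rdominated_convergence D (fun n => f \_ (D_ n)) f (fun x => `|f x|) => //.
- move=> n; apply/(measurable_restrict _ (mD_ n) mD) => //.
  by apply: measurable_funS mf => // x [].
- move=> x Dx; apply: cvg_near_cst; apply: filterS (D_x x Dx) => n Dnx.
  by rewrite patchE mem_set.
- exact: integrable_norm.
- move=> n x Dx; rewrite patchE; case: ifPn => _ //.
  by rewrite normr0.
by under eq_fun do rewrite -Rintegral_mkcondr setIidr//.
Qed.

End RealIntegrals.

(** * Fubini's theorem under a product bound *)

Section RealFubini.
Context d1 d2 (T1 : measurableType d1) (T2 : measurableType d2) (R : realType).
Context (m1 : {sigma_finite_measure set T1 -> \bar R}).
Context (m2 : {sigma_finite_measure set T2 -> \bar R}).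

(** The bound by a product reduces integrability on the product space to that of the two factors.
    Measurability of the inner integral is returned too, because such integrals become integrands
    later; it concerns the second variable only. *)
Lemma RFubini_dominated (f : T1 * T2 -> R) (a : T1 -> R) (b : T2 -> R) :
  measurable_fun setT f ->
  m1.-integrable setT (EFin \o a) -> m2.-integrable setT (EFin \o b) ->
  (forall x y, `|f (x, y)| <= a x * b y) ->
  \int[m1]_x (\int[m2]_y f (x, y)) = \int[m2]_y (\int[m1]_x f (x, y)) /\
  measurable_fun setT (fun y => \int[m1]_x f (x, y)).
Proof.
move=> mf ia ib fab.
have mEf : measurable_fun setT (EFin \o f) by exact/measurable_EFinP.
have i2 x : m2.-integrable setT (EFin \o (fun y => f (x, y))).
  apply: (le_integrable _ _ _ (integrable_realZ (a x) measurableT ib)) => //.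
    by apply/measurable_EFinP; exact: measurableT_comp mf (pair1_measurable _).
  by move=> y _; rewrite /= lee_fin (le_trans (fab x y))// ler_norm.
have i1 y : m1.-integrable setT (EFin \o (fun x => f (x, y))).
  apply: (le_integrable _ _ _ (integrable_realZ (b y) measurableT ia)) => //.
    by apply/measurable_EFinP; exact: measurableT_comp mf (pair2_measurable _).
  by move=> x _; rewrite /= lee_fin (le_trans (fab x y))// mulrC ler_norm.
have iab : (m1 \x m2)%E.-integrable setT (EFin \o f).
  apply/integrable12ltyP => //.
  have mb : measurable_fun setT (fun y => `|b y|%:E).
    apply/measurable_EFinP; apply: measurableT_comp => //.
    exact/measurable_EFinP/(measurable_int _ ib).
  have ma : measurable_fun setT (fun x => `|a x|%:E).
    apply/measurable_EFinP; apply: measurableT_comp => //.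
    exact/measurable_EFinP/(measurable_int _ ia).
  apply: (@le_lt_trans _ _ (\int[m1]_x (`|a x|%:E * \int[m2]_y `|b y|%:E))%E).
    apply: ge0_le_integral => //.
    - by move=> x _; exact: integral_ge0.
    - apply: (measurable_fun_fubini_tonelli_F (abse \o (EFin \o f))).
        exact: measurableT_comp.
      by move=> x; rewrite /= lee_fin.
    - by apply: emeasurable_funM.
    - move=> x _; rewrite -ge0_integralZl//.
      apply: ge0_le_integral => //.
      + apply: measurableT_comp => //.
        exact: (measurable_int _ (i2 x)).
      + by apply: emeasurable_funM.
      + move=> y _; rewrite -EFinM lee_fin (le_trans (fab x y))//.
        by rewrite -normrM ler_norm.
  rewrite ge0_integralZr//; last exact: integral_ge0.
  apply: lte_mul_pinfty; first exact: integral_ge0.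
    exact: (integrable_fin_num measurableT (integrable_norm ia)).
  by have /integrableP[] := ib.
have := Fubini iab; rewrite /Rintegral/= => h.
have E1 x : (fine (\int[m2]_y (f (x, y))%:E))%:E = (\int[m2]_y (f (x, y))%:E)%E.
  by rewrite fineK//; exact: (integrable_fin_num _ (i2 x)).
have E2 y : (fine (\int[m1]_x (f (x, y))%:E))%:E = (\int[m1]_x (f (x, y))%:E)%E.
  by rewrite fineK//; exact: (integrable_fin_num _ (i1 y)).
split.
  by under eq_integral do rewrite E1; under [in RHS]eq_integral do rewrite E2; rewrite h.
apply/measurable_EFinP; rewrite (_ : EFin \o _ = fubini_G m1 (EFin \o f)).
  exact: measurable_fubini_G iab.
by apply/funext => y /=; rewrite E2.
Qed.

End RealFubini.

(** * Shifting the contour of a Gaussian integral *)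

Section GaussianTransform.
Context {R : realType}.
Notation mu := (@lebesgue_measure R).
Implicit Types (s t y u : R).

Definition gauss_kernel s t : R := expR (- (s ^+ 2 * t ^+ 2 / 2)).

Lemma convexC_setT : convexC (@setT R[i]). Proof. by []. Qed.
Lemma closedC_setT : closedC (@setT R[i]). Proof. by []. Qed.

Lemma cint_Re (f : R -> R[i]) (D : set R) :
  reC (cint mu D f) = \int[mu]_(x in D) reC (f x).
Proof. by []. Qed.

Lemma continuous_gauss_kernel s : continuous (gauss_kernel s).
Proof.
move=> t; apply: (@continuous_comp _ _ _ (fun t => - (s ^+ 2 * t ^+ 2 / 2)) expR).
  apply: cvgN; apply: cvgM; last exact: cvg_cst.
  by apply: cvgM; [exact: cvg_cst|exact: exprn_continuous].
exact: continuous_expR.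
Qed.

Lemma gauss_kernel_gt0 s t : 0 < gauss_kernel s t. Proof. exact: expR_gt0. Qed.

Lemma add_horizontal (p t : R) : (0 +i* p) + t%:C * 1 = t +i* p.
Proof.
by apply: complex_eq; rewrite !reimE/= ?mulr1 ?mulr0 ?add0r ?addr0.
Qed.

Lemma sub_vertical (v p q : R) : (v +i* q) - (v +i* p) = (q - p)%:C * 'i.
Proof.
by apply: complex_eq; rewrite !reimE/= ?mulr0 ?mulr1 ?subrr.
Qed.

Lemma vertical_line (v p q t : R) :
  (v +i* p) + t%:C * ((v +i* q) - (v +i* p)) = v +i* (p + t * (q - p)).
Proof. by apply: complex_eq; rewrite !reimE/=; ring. Qed.

(** Completing the square: the segment [-N, N] is moved vertically inside the domain of the entire
    function exp (- s^2 z^2 / 2), and the error is the contribution of the two vertical sides. *)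
Lemma gauss_shift s y (N : R) : 0 < s -> 0 < N ->
  `|\int[mu]_(t in `[- N, N]) gauss_kernel s t -
    expR (y ^+ 2 / (2 * s ^+ 2)) *
    \int[mu]_(t in `[- N, N]) (gauss_kernel s t * cos (t * y))| <=
  4 * (expR (y ^+ 2 / (2 * s ^+ 2)) * expR (- (s ^+ 2 * N ^+ 2 / 2))) *
  (`|y| / s ^+ 2).
Proof.
move=> s0 N0.
pose F (z : R[i]) := cexp ((- (s ^+ 2 / 2))%:C * (z * z)).
have hF : holomorphic_on setT F.
  move=> z _; apply: (@derivable_compC _ (fun z => (- (s ^+ 2 / 2))%:C * (z * z)) cexp).
    apply: derivableMC; first exact: derivable_cstC.
    by apply: derivableMC; exact: derivable_idC.
  exact: derivable_cexp.
have cF : continuousC setT F by move=> z _; exact/derivable_continuousC/hF.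
(* At this height the imaginary part of the exponent is - t y and its real part gains the constant
   y^2 / (2 s^2). *)
pose eta := y / s ^+ 2.
have s2 : s ^+ 2 != 0 by rewrite expf_neq0 ?gt_eqF.
have s20 : 0 < s ^+ 2 by rewrite exprn_gt0.
have ReF t v : reC (F (t +i* v)) =
    expR (- (s ^+ 2 * t ^+ 2 / 2)) * expR (s ^+ 2 * v ^+ 2 / 2) * cos (s ^+ 2 * t * v).
  rewrite /F /= -expRD; congr (expR _ * _); first by field.
  rewrite -cosN; congr cos; by field.
have mF t v : cmod (F (t +i* v)) =
    expR (- (s ^+ 2 * t ^+ 2 / 2)) * expR (s ^+ 2 * v ^+ 2 / 2).
  by rewrite /F cmod_cexp -expRD !reimE /=; congr expR; field.
pose A : R[i] := 0 + (- N)%:C * 1; pose B : R[i] := 0 + N%:C * 1.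
pose C : R[i] := (0 +i* eta) + N%:C * 1; pose D : R[i] := (0 +i* eta) + (- N)%:C * 1.
have NN : - N < N by rewrite gtrN.
have Q := Cauchy_quadrilateral convexC_setT closedC_setT hF
  (I : setT A) (I : setT B) (I : setT C) (I : setT D).
have SAB : reC (seg F A B) = \int[mu]_(t in `[- N, N]) gauss_kernel s t.
  rewrite /A /B (seg_line NN cF)// mul1r cint_Re; apply: eq_Rintegral => t _.
  have -> : 0 + t%:C * 1 = t +i* 0 :> R[i] by exact: add_horizontal.
  by rewrite ReF expr0n/= !(mulr0, mul0r) expR0 cos0 !mulr1.
have SDC : reC (seg F D C) = expR (y ^+ 2 / (2 * s ^+ 2)) *
    \int[mu]_(t in `[- N, N]) (gauss_kernel s t * cos (t * y)).
  rewrite /D /C (seg_line NN cF)// mul1r cint_Re -RintegralZl//.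
    apply: eq_Rintegral => t _.
    rewrite add_horizontal.
    rewrite ReF [in RHS]mulrA [X in _ = X * _]mulrC; congr (_ * expR _ * cos _).
    - by rewrite /eta; field; rewrite gt_eqF.
    - by rewrite /eta; field; rewrite gt_eqF.
  apply: continuous_compact_integrable; first exact: segment_compact.
  apply: continuous_subspaceT => t; apply: cvgM; first exact: continuous_gauss_kernel.
  apply: (@continuous_comp _ _ _ (fun t => t * y) cos); last exact: continuous_cos.
  by apply: cvgM; [exact: cvg_id|exact: cvg_cst].
have side (v0 p q : R) : v0 ^+ 2 = N ^+ 2 -> `|p| <= `|eta| -> `|q| <= `|eta| ->
    `|q - p| = `|eta| ->
    cmod (seg F (v0 +i* p) (v0 +i* q)) <= 2 * (expR (y ^+ 2 / (2 * s ^+ 2)) *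
      expR (- (s ^+ 2 * N ^+ 2 / 2))) * (`|y| / s ^+ 2).
  move=> vN pe qe qpe.
  have -> : `|y| / s ^+ 2 = cmod ((v0 +i* q) - (v0 +i* p)).
    rewrite sub_vertical cmodM cmod_real qpe /eta normrM (gtr0_norm (_ : 0 < (s ^+
        2)^-1)) ?invr_gt0//.
    by rewrite /cmod/= expr0n/= expr1n add0r sqrtr1 mulr1.
  apply: (seg_le convexC_setT cF) => // t /andP[t0 t1].
  rewrite vertical_line mF vN mulrC ler_pM2r ?expR_gt0// ler_expR.
  have : `|p + t * (q - p)| <= `|eta|.
    move: pe qe; rewrite !ler_norml => /andP[p1 p2] /andP[q1 q2].
    by clear -t0 t1 p1 p2 q1 q2; apply/andP; split; nra.
  rewrite -(@ler_pXn2r _ 2)// ?nnegrE// !real_normK ?num_real// => h.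
  have -> : y ^+ 2 / (2 * s ^+ 2) = s ^+ 2 * eta ^+ 2 / 2.
    by rewrite /eta; field; rewrite gt_eqF.
  by rewrite ler_pM2r ?invr_gt0// ler_pM2l.
have BE : B = N +i* 0 by exact: add_horizontal.
have AE : A = (- N) +i* 0 by exact: add_horizontal.
have CE : C = N +i* eta by exact: add_horizontal.
have DE : D = (- N) +i* eta by exact: add_horizontal.
have e1 : cmod (seg F B C) <= 2 * (expR (y ^+ 2 / (2 * s ^+ 2)) * expR (- (s ^+ 2 * N
    ^+ 2 / 2))) * (`|y| / s ^+ 2).
  by rewrite BE CE side// ?normr0// subr0.
have e2 : cmod (seg F D A) <= 2 * (expR (y ^+ 2 / (2 * s ^+ 2)) * expR (- (s ^+ 2 * N
    ^+ 2 / 2))) * (`|y| / s ^+ 2).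
  by rewrite DE AE side// ?sqrrN ?normr0// sub0r normrN.
clearbody A B C D.
have SCD : reC (seg F C D) = - reC (seg F D C).
  by rewrite -reN -(seg_rev convexC_setT cF (I : setT D) (I : setT C)).
have h : reC (seg F A B) + reC (seg F B C) + reC (seg F C D) + reC (seg F D A) = 0.
  by rewrite -3!reD Q.
rewrite SAB SCD SDC in h.
have combine (p q X Y K Z : R) : X + p - Y + q = 0 -> `|p| <= 2 * K * Z ->
    `|q| <= 2 * K * Z -> `|X - Y| <= 4 * K * Z.
  clear=> h0 pK qK; have -> : X - Y = - (p + q) by lra.
  rewrite normrN (le_trans (ler_normD _ _))//; lra.
exact: combine h (le_trans (cmod_re _) e1) (le_trans (cmod_re _) e2).
Qed.

End GaussianTransform.

(** * The Fourier transform of the Gaussian, as a limit of truncated integrals *)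

Section GaussianSmoothing.
Context {R : realType}.
Notation mu := (@lebesgue_measure R).
Implicit Types (s t y u : R).

Lemma normal_pdfE2 u s y : s != 0 ->
  normal_pdf u s y = normal_peak s * expR (- ((y - u) ^+ 2 / (2 * s ^+ 2))).
Proof.
move=> s0; rewrite normal_pdfE// -[LHS]/(normal_peak s * normal_fun u s y) /normal_fun.
congr (_ * expR _).
by rewrite mulNr mulr_natl.
Qed.

Lemma gauss_kernelE s t : 0 < s ->
  gauss_kernel s t = normal_pdf 0 s^-1 t / normal_peak s^-1.
Proof.
move=> s0; have sv : s^-1 != 0 by rewrite invr_neq0// gt_eqF.
rewrite normal_pdfE2// mulrAC divff ?mul1r; last by rewrite gt_eqF// normal_peak_gt0.
by rewrite /gauss_kernel subr0; congr expR; field; rewrite gt_eqF.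
Qed.

Lemma normal_peakM s : 0 < s -> (normal_peak s^-1)^-1 = 2 * pi * normal_peak s.
Proof.
move=> s0; rewrite /normal_peak invrK.
have p0 := @pi_gt0 R.
have A : 0 < Num.sqrt (s ^+ 2 * pi *+ 2).
  by rewrite sqrtr_gt0 mulrn_wgt0// mulr_gt0// exprn_gt0.
apply: (mulIf (lt0r_neq0 A)); rewrite divfK ?gt_eqF// -sqrtrM; last first.
  by rewrite mulrn_wge0// mulr_ge0 ?sqr_ge0// ltW.
have -> : s^-1 ^+ 2 * pi *+ 2 * (s ^+ 2 * pi *+ 2) = (2 * pi) ^+ 2.
  by rewrite !mulr2n; field; rewrite gt_eqF.
by rewrite sqrtr_sqr ger0_norm// mulr_ge0// ltW.
Qed.

Lemma integrable_gauss_kernel s : 0 < s ->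
  mu.-integrable setT (EFin \o gauss_kernel s).
Proof.
move=> s0.
have := integrable_realZ (normal_peak s^-1)^-1 measurableT (@integrable_normal_pdf R 0 s^-1).
by apply: eq_integrable => // t _; rewrite /= gauss_kernelE// mulrC.
Qed.

Lemma Rintegral_gauss_kernel s : 0 < s ->
  \int[mu]_t gauss_kernel s t = 2 * pi * normal_peak s.
Proof.
move=> s0; rewrite -normal_peakM//.
transitivity (\int[mu]_t ((normal_peak s^-1)^-1 * normal_pdf 0 s^-1 t)).
  by apply: eq_Rintegral => t _; rewrite gauss_kernelE// mulrC.
rewrite RintegralZl//; last exact: integrable_normal_pdf.
by rewrite /Rintegral integral_normal_pdf mulr1.
Qed.

Let itv_n (n : nat) : set R := `[- n%:R, n%:R].

Lemma near_itv_n (t : R) : \forall n \near \oo, itv_n n t.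
Proof.
near=> n; rewrite /itv_n/= in_itv/= -ler_norml.
by near: n; exact: nbhs_infty_ger.
Unshelve. all: by end_near. Qed.

Lemma gauss_kernel_cvg s : 0 < s ->
  (\int[mu]_(t in `[- n%:R, n%:R]) gauss_kernel s t) @[n --> \oo] -->
  2 * pi * normal_peak s.
Proof.
move=> s0; rewrite -Rintegral_gauss_kernel//.
apply: (@Rintegral_cvg_sets _ (measurableTypeR R) R mu setT itv_n (gauss_kernel s)) => //.
- by move=> n; exact: measurable_itv.
- by move=> t _; exact: near_itv_n.
- exact: integrable_gauss_kernel.
Qed.

Lemma gauss_kernel_cvg0 s : 0 < s -> gauss_kernel s n%:R @[n --> \oo] --> (0 : R).
Proof.
move=> s0; apply/cvgrPdist_lt => e e0; near=> n.
rewrite sub0r normrN gtr0_norm ?expR_gt0// /gauss_kernel expRN.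
rewrite invf_plt ?posrE ?expR_gt0// (lt_le_trans _ (expR_ge1Dx _))//.
have n1 : 1 <= n%:R :> R by near: n; exact: nbhs_infty_ger.
have n2 : 2 * e^-1 / s ^+ 2 < n%:R.
  by near: n; exact: nbhs_infty_gtr.
rewrite ltr_pdivrMr ?exprn_gt0// in n2.
have : n%:R * s ^+ 2 <= n%:R ^+ 2 * s ^+ 2.
  by rewrite ler_wpM2r ?sqr_ge0// expr2 ler_peMl// ler0n.
rewrite [s ^+ 2 * _]mulrC; lra.
Unshelve. all: by end_near. Qed.

(** By [gauss_shift] the truncated integral is exp (- y^2 / (2 s^2)) times the truncated mass of the
    kernel, up to vertical sides of order [gauss_kernel s n%:R]. *)
Lemma gauss_cos_cvg s y : 0 < s ->
  (\int[mu]_(t in `[- n%:R, n%:R]) (gauss_kernel s t * cos (t * y))) @[n --> \oo]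
  --> 2 * pi * normal_pdf 0 s y.
Proof.
move=> s0.
set c := expR (y ^+ 2 / (2 * s ^+ 2)).
have c0 : 0 < c by exact: expR_gt0.
pose G n := \int[mu]_(t in `[- n%:R, n%:R]) gauss_kernel s t.
pose K n := \int[mu]_(t in `[- n%:R, n%:R]) (gauss_kernel s t * cos (t * y)).
have h1 : G n - c * K n @[n --> \oo] --> (0 : R).
  have b0 : 4 * (c * gauss_kernel s n%:R) * (`|y| / s ^+ 2) @[n --> \oo] --> (0 : R).
    rewrite (_ : (fun n => _) = (fun n => 4 * c * (`|y| / s ^+ 2) * gauss_kernel s n%:R)).
      by rewrite -[X in _ --> X](mulr0 (4 * c * (`|y| / s ^+ 2))); apply: cvgM;
        [exact: cvg_cst|exact: gauss_kernel_cvg0].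
    by apply/funext => n; ring.
  apply/cvgrPdist_le => e e0; near=> n.
  rewrite sub0r normrN (le_trans (gauss_shift y s0 _))//.
    by near: n; exact: nbhs_infty_gtr.
  apply: (le_trans (ler_norm _)); rewrite -normrN -sub0r.
  by near: n; move/cvgrPdist_le : b0; exact.
have -> : 2 * pi * normal_pdf 0 s y = (2 * pi * normal_peak s - 0) / c.
  rewrite normal_pdfE2 ?gt_eqF// !subr0 mulrA; congr (_ * _).
  by rewrite /c expRN.
rewrite (_ : (fun n => _) = (fun n => (G n - (G n - c * K n)) / c)).
  apply: cvgM; last exact: cvg_cst.
  by apply: cvgB; [exact: gauss_kernel_cvg|exact: h1].
by apply/funext => n; rewrite opprB addrC subrK mulrC mulKf// gt_eqF.
Unshelve. all: by end_near. Qed.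

Lemma Rintegral_even (h : R -> R) (N : R) : continuous h ->
  (forall t, h (- t) = h t) -> 0 <= N ->
  \int[mu]_(t in `[- N, N]) h t = 2 * \int[mu]_(t in `[0%R, N]) h t.
Proof.
move=> ch hN N0.
have NN : - N <= 0 by rewrite oppr_le0.
rewrite (Rintegral_itv_cat NN N0); last first.
  apply: continuous_compact_integrable; first exact: segment_compact.
  exact: continuous_subspaceT.
suff -> : \int[mu]_(x in `[- N, 0%R]) h x = \int[mu]_(x in `[0%R, N]) h x by ring.
rewrite /Rintegral; congr fine.
have := @integration_by_substitution_oppr R h 0 N N0; rewrite oppr0 => ->.
  by apply: eq_integral => t _ /=; rewrite hN.
exact: continuous_subspaceT.
Qed.

(** The halved form is the one that matches the folded contour, which runs over t >= 0 only. *)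
Lemma gauss_cos_half_cvg s y : 0 < s ->
  (\int[mu]_(t in `[0%R, n%:R]) (gauss_kernel s t * cos (t * y))) @[n --> \oo]
  --> pi * normal_pdf 0 s y.
Proof.
move=> s0; pose h t := gauss_kernel s t * cos (t * y).
have ch : continuous h.
  move=> t; apply: cvgM; first exact: continuous_gauss_kernel.
  apply: (@continuous_comp _ _ _ (fun t => t * y) cos); last exact: continuous_cos.
  by apply: cvgM; [exact: cvg_id|exact: cvg_cst].
have hN t : h (- t) = h t by rewrite /h /gauss_kernel sqrrN mulNr cosN.
have E n : \int[mu]_(t in `[0%R, n%:R]) h t = 2^-1 * \int[mu]_(t in `[- n%:R, n%:R]) h t.
  by rewrite (Rintegral_even ch hN (ler0n _ n)) mulKf.
rewrite (_ : (fun n => _) = (fun n => 2^-1 * \int[mu]_(t in `[- n%:R, n%:R]) h t)); last first.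
  by apply/funext => n; exact: E.
have -> : pi * normal_pdf 0 s y = 2^-1 * (2 * pi * normal_pdf 0 s y) by field.
by apply: cvgM; [exact: cvg_cst|exact: gauss_cos_cvg].
Qed.

End GaussianSmoothing.

(** * Fourier inversion for a smoothed weighted measure *)

Section SmoothingIdentity.
Context {R : realType} (m : {sigma_finite_measure set (measurableTypeR R) -> \bar R}).
Notation mu := (@lebesgue_measure R).
Implicit Types (s t y u : R).

Lemma measurable_cos_shift (s u : R) (D : set R) (w : R -> R) :
  measurable D -> measurable_fun setT w ->
  measurable_fun setT (fun p : measurableTypeR R * measurableTypeR R =>
    (gauss_kernel s \_ D) p.1 * (cos (p.1 * (p.2 - u)) * w p.2)).
Proof.
move=> mD mw; apply: measurable_funM.
  apply: (measurableT_comp (f := gauss_kernel s \_ D)); last exact: measurable_fst.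
  have mg : measurable_fun setT (gauss_kernel s).
    exact: continuous_measurable_fun (@continuous_gauss_kernel _ s).
  apply/(measurable_restrictT _ mD).
  exact: measurable_funTS.
apply: measurable_funM; last exact: measurableT_comp mw measurable_snd.
apply: measurableT_comp; first exact: continuous_measurable_fun (@continuous_cos R).
apply: measurable_funM; first exact: measurable_fst.
by apply: measurable_funB; [exact: measurable_snd|exact: measurable_cst].
Qed.

(** Fubini on the truncated strip turns the left side into an integral of [w] against truncated
    Gaussian transforms, which converge boundedly. The general pair of a measure [m] and a weight
    [w] covers both [nu] and densities with respect to Lebesgue measure. *)
Lemma gauss_smoothing (w : R -> R) s u : 0 < s ->
  m.-integrable setT (EFin \o w) ->
  (\int[mu]_(t in `[0%R, n%:R])
     (gauss_kernel s t * \int[m]_y (cos (t * (y - u)) * w y))) @[n --> \oo] -->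
  pi * \int[m]_y (normal_pdf u s y * w y).
Proof.
move=> s0 iw.
have mw : measurable_fun setT w by have /integrableP[/measurable_EFinP] := iw.
pose D (n : nat) : set R := `[0%R, n%:R]%classic.
pose f n (p : measurableTypeR R * measurableTypeR R) :=
  (gauss_kernel s \_ (D n)) p.1 * (cos (p.1 * (p.2 - u)) * w p.2).
have icos t : m.-integrable setT (EFin \o (fun y => cos (t * (y - u)) * w y)).
  apply: le_integrable (integrable_norm iw) => //.
    apply/measurable_EFinP; apply: measurable_funM => //.
    apply: measurableT_comp; first exact: continuous_measurable_fun (@continuous_cos R).
    apply: measurable_funM => //; exact: measurable_funB.
  by move=> y _; rewrite /= lee_fin normrM normr_id ler_piMl// cos_max.
have igD n : mu.-integrable setT (EFin \o (gauss_kernel s \_ (D n))).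
  rewrite -restrict_EFin; apply/integrable_restrict => //; first exact: measurable_itv.
  rewrite setTI; apply: (@integrableS _ _ _ _ setT) => //; first exact: measurable_itv.
  exact: integrable_gauss_kernel.
have gD0 n t : 0 <= (gauss_kernel s \_ (D n)) t.
  by rewrite patchE; case: ifP => // _; exact/ltW/gauss_kernel_gt0.
have fab n x y : `|f n (x, y)| <= (gauss_kernel s \_ (D n)) x * `|w y|.
  rewrite /f/= normrM (ger0_norm (gD0 n x)) ler_wpM2l// normrM ler_piMl//.
  exact: cos_max.
have F n := @RFubini_dominated _ _ _ _ R mu m (f n) (gauss_kernel s \_ (D n))
  (fun y => `|w y|) (measurable_cos_shift s u _ mw) (igD n) (integrable_norm iw) (fab n).
have {}F := F (fun n => measurable_itv _).
have E1 n : \int[mu]_(t in `[0%R, n%:R])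
     (gauss_kernel s t * \int[m]_y (cos (t * (y - u)) * w y)) =
  \int[m]_y (\int[mu]_t f n (t, y)).
  rewrite -(F n).1 Rintegral_mkcond; apply: eq_Rintegral => t _.
  by rewrite /f/= RintegralZl// !patchE; case: ifP => // _; rewrite mul0r.
have E2 n y : \int[mu]_t f n (t, y) =
    w y * \int[mu]_(t in `[0%R, n%:R]) (gauss_kernel s t * cos (t * (y - u))).
  rewrite -RintegralZl//.
    rewrite [RHS]Rintegral_mkcond; apply: eq_Rintegral => t _.
    rewrite /f/= !patchE; case: ifP => _; last by rewrite mul0r.
    by rewrite mulrA mulrC.
  apply: continuous_compact_integrable; first exact: segment_compact.
  apply: continuous_subspaceT => t; apply: cvgM; first exact: continuous_gauss_kernel.
  apply: (@continuous_comp _ _ _ (fun t => t * (y - u)) cos); last exact: continuous_cos.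
  by apply: cvgM; [exact: cvg_id|exact: cvg_cst].
rewrite (_ : (fun n => _) = (fun n => \int[m]_y (\int[mu]_t f n (t, y)))); last first.
  by apply/funext => n; exact: E1.
have -> : pi * \int[m]_y (normal_pdf u s y * w y) =
    \int[m]_y (pi * (normal_pdf u s y * w y)).
  rewrite RintegralZl//; apply: le_integrable (integrable_realZ (normal_peak s)
      measurableT (integrable_norm iw)) => //.
    apply/measurable_EFinP; apply: measurable_funM => //.
    exact: measurable_normal_pdf.
  move=> y _; rewrite /= lee_fin !normrM normr_id ler_wpM2r//.
  rewrite !ger0_norm ?normal_pdf_ge0 ?normal_peak_ge0//.
  by rewrite normal_pdf_ub// gt_eqF.
have [||||||_] := @Rdominated_convergence _ _ _ m setT
    (fun n y => \int[mu]_t f n (t, y)) (fun y => pi * (normal_pdf u s y * w y))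
    (fun y => \int[mu]_t gauss_kernel s t * `|w y|) => //.
- by move=> n; exact: (F n).2.
- apply: measurable_funM => //; apply: measurable_funM => //.
  exact: measurable_normal_pdf.
- move=> y _; rewrite (_ : (fun n => _) = (fun n => w y *
    \int[mu]_(t in `[0%R, n%:R]) (gauss_kernel s t * cos (t * (y - u))))).
    rewrite mulrA mulrC; apply: cvgM; first exact: cvg_cst.
    have -> : normal_pdf u s y = normal_pdf 0 s (y - u).
      by rewrite !normal_pdfE2 ?gt_eqF// subr0.
    exact: gauss_cos_half_cvg.
  by apply/funext => n; exact: E2.
- exact: (integrable_realZ _ measurableT (integrable_norm iw)).
- move=> n y _.
  have : mu.-integrable setT (EFin \o (fun t => f n (t, y))).
    apply: le_integrable (integrable_realZ `|w y| measurableT (igD n)) => //.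
      apply/measurable_EFinP; apply: measurable_fun_pair1.
      exact: measurable_cos_shift (measurable_itv _) mw.
    by move=> t _; rewrite /= lee_fin (le_trans (fab n t y))// mulrC ler_norm.
  move=> ify; rewrite (le_trans (le_normr_Rintegral measurableT ify))//.
  rewrite -RintegralZr//; last exact: integrable_gauss_kernel.
  apply: le_Rintegral => //; first exact: integrable_norm.
    have := integrable_realZ `|w y| measurableT (integrable_gauss_kernel s0).
    by apply: eq_integrable => // t _; rewrite /= mulrC.
  move=> t _; rewrite (le_trans (fab n t y))// ler_wpM2r//.
  by rewrite patchE; case: ifP => // _; exact/ltW/gauss_kernel_gt0.
Qed.

Lemma integrable_gauss_cos (w : R -> R) s u (N : R) : 0 < s ->
  m.-integrable setT (EFin \o w) ->
  mu.-integrable `[0%R, N] (EFin \o (fun t =>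
    gauss_kernel s t * \int[m]_y (cos (t * (y - u)) * w y))).
Proof.
move=> s0 iw.
have mw : measurable_fun setT w by have /integrableP[/measurable_EFinP] := iw.
pose D : set R := `[0%R, N]%classic.
have mD : measurable D by exact: measurable_itv.
(* The variables are exchanged here, since [RFubini_dominated] gives measurability in the second one
   and that must be [t]. *)
pose f (p : measurableTypeR R * measurableTypeR R) :=
  (gauss_kernel s \_ D) p.2 * (cos (p.2 * (p.1 - u)) * w p.1).
have mf : measurable_fun setT f.
  exact: measurableT_comp (measurable_cos_shift s u mD mw) (@measurable_swap _ _ _ _).
have igD : mu.-integrable setT (EFin \o (gauss_kernel s \_ D)).
  rewrite -restrict_EFin; apply/integrable_restrict => //.
  rewrite setTI; apply: (@integrableS _ _ _ _ setT) => //.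
  exact: integrable_gauss_kernel.
have gD0 t : 0 <= (gauss_kernel s \_ D) t.
  by rewrite patchE; case: ifP => // _; exact/ltW/gauss_kernel_gt0.
have fab y t : `|f (y, t)| <= `|w y| * (gauss_kernel s \_ D) t.
  rewrite /f/= normrM (ger0_norm (gD0 t)) mulrC ler_wpM2r// normrM ler_piMl//.
  exact: cos_max.
have icos t : m.-integrable setT (EFin \o (fun y => cos (t * (y - u)) * w y)).
  apply: le_integrable (integrable_norm iw) => //.
    apply/measurable_EFinP; apply: measurable_funM => //.
    apply: measurableT_comp; first exact: continuous_measurable_fun (@continuous_cos R).
    apply: measurable_funM => //; exact: measurable_funB.
  by move=> y _; rewrite /= lee_fin normrM normr_id ler_piMl// cos_max.
have [_ mF] := @RFubini_dominated _ _ _ _ R m mu f _ _ mf (integrable_norm iw) igD fab.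
have E t : \int[m]_y f (y, t) =
    ((fun t => gauss_kernel s t * \int[m]_y (cos (t * (y - u)) * w y)) \_ D) t.
  by rewrite /f/= RintegralZl// !patchE; case: ifP => // _; rewrite mul0r.
have : mu.-integrable setT (EFin \o (fun t => \int[m]_y f (y, t))).
  apply: le_integrable (integrable_realZ (\int[m]_y `|w y|) measurableT igD) => //.
    exact/measurable_EFinP.
  move=> t _; rewrite /= lee_fin.
  have ify : m.-integrable setT (EFin \o (fun y => f (y, t))).
    have := integrable_realZ ((gauss_kernel s \_ D) t) measurableT (icos t).
    by apply: eq_integrable.
  rewrite (le_trans (le_normr_Rintegral measurableT ify))// ger0_norm; last first.
    by rewrite mulr_ge0// Rintegral_ge0.
  rewrite -RintegralZr//; last exact: integrable_norm.
  apply: le_Rintegral => //; first exact: integrable_norm.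
  have := integrable_realZ ((gauss_kernel s \_ D) t) measurableT (integrable_norm iw).
  by apply: eq_integrable => // y _; rewrite /= mulrC.
rewrite (_ : EFin \o _ = (EFin \o (fun t =>
    gauss_kernel s t * \int[m]_y (cos (t * (y - u)) * w y))) \_ D); last first.
  by rewrite restrict_EFin; apply/funext => t /=; rewrite E.
by move/integrable_restrict => /(_ mD measurableT); rewrite setTI.
Qed.

End SmoothingIdentity.

(** * Improper integrals over the positive half-line *)

Section PositiveAxis.
Context {R : realType}.
Notation mu := (@lebesgue_measure R).
Implicit Types (l q g y t : R).

Definition shrinking_itv (n : nat) : set R := `[n.+1%:R^-1, n.+1%:R]%classic.

(** The index starts at [n.+2] because [shrinking_itv 0] is the single point 1, whereas the
    fundamental theorem below asks for a nondegenerate interval. *)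
Lemma inv_lt_succ (n : nat) : (n.+2%:R^-1 : R) < n.+2%:R.
Proof. by rewrite invf_plt ?posrE// (@lt_trans _ _ 1)// ?invf_lt1// ltr1n. Qed.

Lemma near_shrinking_itv y : 0 < y -> \forall n \near \oo, shrinking_itv n y.
Proof.
move=> y0; near=> n; rewrite /shrinking_itv/= in_itv/=.
have n1 : y <= n%:R by near: n; exact: nbhs_infty_ger.
have n2 : y^-1 <= n%:R by near: n; exact: nbhs_infty_ger.
have n3 : (n%:R : R) <= n.+1%:R by rewrite ler_nat.
rewrite (le_trans n1 n3) andbT invf_ple ?posrE// (le_trans n2)//.
Unshelve. all: by end_near. Qed.

Lemma shrinking_itv_sub n : shrinking_itv n `<=` `]0, +oo[.
Proof.
move=> y; rewrite /shrinking_itv/= !in_itv/= andbT => /andP[h _].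
by rewrite (lt_le_trans _ h)// invr_gt0.
Qed.

Lemma Rintegral_shrinking_cvg (f : R -> R) :
  mu.-integrable `]0, +oo[ (EFin \o f) ->
  (\int[mu]_(y in `[n.+1%:R^-1, n.+1%:R]) f y) @[n --> \oo] -->
  \int[mu]_(y in `]0, +oo[) f y.
Proof.
move=> fi.
apply: (@Rintegral_cvg_sets _ (measurableTypeR R) R mu `]0, +oo[%classic
  shrinking_itv f) => //.
- by move=> n; exact: measurable_itv.
- exact: shrinking_itv_sub.
- by move=> y /=; rewrite in_itv/= andbT; exact: near_shrinking_itv.
Qed.

Lemma integral_FTC (h P : R -> R) (a b : R) : a < b ->
  (forall x, a <= x <= b -> is_derive x (1 : R) P (h x)) ->
  (forall x, a <= x <= b -> {for x, continuous h}) ->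
  (\int[mu]_(x in `[a, b]) (h x)%:E = (P b - P a)%:E)%E.
Proof.
move=> ab dP ch.
have cP x : a <= x <= b -> {for x, continuous P}.
  move=> xab; apply/differentiable_continuous/derivable1_diffP.
  by have [] := dP x xab.
have aab : a <= a <= b by rewrite lexx ltW.
have bab : a <= b <= b by rewrite lexx ltW.
rewrite (continuous_FTC2 (F := P) ab)//.
- by apply: continuous_in_subspaceT => x; rewrite inE/= in_itv/=; exact: ch.
- split.
  + move=> x; rewrite in_itv/= => /andP[ax xb].
    by have [] := dP x _; rewrite ?(ltW ax) ?(ltW xb).
  + by apply: cvg_at_right_filter; exact: cP.
  + by apply: cvg_at_left_filter; exact: cP.
- move=> x; rewrite in_itv/= => /andP[ax xb]; rewrite derive1E.
  by have [] := dP x _; rewrite ?(ltW ax) ?(ltW xb).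
Qed.

Lemma Rintegral_FTC (h P : R -> R) (a b : R) : a < b ->
  (forall x, a <= x <= b -> is_derive x (1 : R) P (h x)) ->
  (forall x, a <= x <= b -> {for x, continuous h}) ->
  \int[mu]_(x in `[a, b]) h x = P b - P a.
Proof. by move=> ab dP ch; rewrite /Rintegral (integral_FTC ab dP ch). Qed.

(** Monotone convergence along [shrinking_itv], each integral being P b - P a <= 2 M. *)
Lemma integrable_of_bounded_primitive (h P : R -> R) (M : R) :
  (forall y, 0 < y -> is_derive y (1 : R) P (h y)) ->
  (forall y, 0 < y -> {for y, continuous h}) ->
  (forall y, 0 < y -> 0 <= h y) -> (forall y, 0 < y -> `|P y| <= M) ->
  mu.-integrable `]0, +oo[ (EFin \o h).
Proof.
move=> dP ch h0 PM.
have mh : measurable_fun (`]0, +oo[%classic : set R) (EFin \o h).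
  apply/measurable_EFinP; apply: open_continuous_measurable_fun => //.
  by move=> y; rewrite inE/= in_itv/= andbT; exact: ch.
apply/integrableP; split => //.
have U : \bigcup_n shrinking_itv n = `]0, +oo[%classic.
  apply/seteqP; split => [y [n _]|y]; first exact: shrinking_itv_sub.
  rewrite /= in_itv/= andbT => /near_shrinking_itv[n _ hn].
  by exists n => //; exact: (hn n (leqnn n)).
have nd : nondecreasing_seq shrinking_itv.
  move=> n k nk; apply/subsetPset => y; rewrite /shrinking_itv/= !in_itv/= => /andP[a b].
  rewrite (le_trans _ a)/= ?(le_trans b) ?ler_nat//.
  by rewrite lef_pV2 ?posrE// ler_nat.
have := @ge0_nondecreasing_set_cvg_integral _ (measurableTypeR R) R shrinking_itv
  (fun y => `|(h y)%:E|)%E mu nd (fun n => measurable_itv _).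
rewrite U => cvgI.
apply: (@le_lt_trans _ _ (2 * M)%:E); last exact: ltry.
have m1 n : measurable_fun (shrinking_itv n) (fun y => `|(h y)%:E|)%E.
  apply: measurableT_comp => //.
  by apply: measurable_funS mh => //; exact: shrinking_itv_sub.
have {}cvgI := cvgI m1 (fun n y _ => abse_ge0 _).
apply: (cvge_le _ cvgI).
  near=> n => /=.
  have n0 : (0 < n)%N by near: n; exact: nbhs_infty_gt.
  rewrite -(prednK n0); set k := n.-1.
  have pos y : k.+2%:R^-1 <= y <= k.+2%:R -> 0 < y.
    by move=> /andP[+ _]; apply: lt_le_trans; rewrite invr_gt0.
  have -> : (\int[mu]_(x in shrinking_itv k.+1) `|h x|%:E =
      \int[mu]_(x in shrinking_itv k.+1) (h x)%:E)%E.
    apply: eq_integral => y; rewrite inE /shrinking_itv/= in_itv/= => /pos y0.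
    by rewrite ger0_norm// h0.
  rewrite /shrinking_itv (integral_FTC (inv_lt_succ k) (fun y hy => dP y (pos y hy))
    (fun y hy => ch y (pos y hy))) lee_fin.
  have := PM k.+2%:R; have := PM k.+2%:R^-1; rewrite !ler_norml invr_gt0 ltr0n.
  by move=> /(_ isT)/andP[a b] /(_ isT)/andP[c d]; lra.
Unshelve. all: by end_near. Qed.

End PositiveAxis.

(** * Integrability of power times exponential *)

Section GammaTransform.
Context {R : realType}.
Notation mu := (@lebesgue_measure R).
Implicit Types (l q g y t : R).

(** The inequality u <= exp u at u = g y / q, raised to the power q. *)
Lemma powR_le_expR q g : 0 < q -> 0 < g ->
  exists2 c, 0 < c & forall y, 0 < y -> y `^ q <= c * expR (g * y).
Proof.
move=> q0 g0; exists ((q / g) `^ q).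
  by rewrite powR_gt0// divr_gt0.
move=> y y0.
have qg : 0 < q / g by rewrite divr_gt0.
have E : y = q / g * (g * y / q) by field; rewrite !gt_eqF.
have p0 : 0 <= g * y / q by rewrite divr_ge0// ?mulr_ge0// ltW.
rewrite [leLHS](_ : _ = (q / g) `^ q * (g * y / q) `^ q); last first.
  by rewrite -powRM// -?E// ltW.
rewrite ler_pM2l ?powR_gt0//.
have -> : expR (g * y) = expR (g * y / q) `^ q.
  by rewrite -expRM; congr expR; field; rewrite gt_eqF.
apply: ge0_ler_powR; rewrite ?nnegrE ?expR_ge0//; first exact: ltW.
by rewrite (le_trans _ (expR_ge1Dx _))// lerDr.
Qed.

Lemma is_derive_powR l y : 0 < y ->
  is_derive y (1 : R) (fun x => x `^ l) (l * y `^ (l - 1)).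
Proof. by move=> y0; exact: is_derive1_powR. Qed.

Lemma is_derive_expRM g y :
  is_derive y (1 : R) (fun x => expR (g * x)) (g * expR (g * y)).
Proof.
apply: is_derive_eq; rewrite /GRing.scale/=; ring.
Qed.

Lemma continuous_powRl l y : 0 < y -> {for y, continuous (fun x => x `^ l)}.
Proof.
move=> y0; apply/differentiable_continuous/derivable1_diffP.
by have [] := is_derive_powR l y0.
Qed.

Lemma continuous_expRM g : continuous (fun x : R => expR (g * x)).
Proof.
move=> y; apply/differentiable_continuous/derivable1_diffP.
by have [] := is_derive_expRM g y.
Qed.

Lemma integrable_powR_expR l g : -1 < l -> 0 < g ->
  mu.-integrable `]0, +oo[ (EFin \o (fun y => y `^ l * expR (- g * y))).
Proof.
move=> l1 g0; set q := l + 1.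
have q0 : 0 < q by rewrite /q; lra.
have [c c0 hc] := powR_le_expR q0 (divr_gt0 g0 (ltr0n _ 2)).
(* A majorant with the elementary primitive [P], valid for all -1 < l at both ends of the half-line:
   since 1 + y^q <= (1 + c) exp (g y / 2), squaring gives exp (- g y) <= (1 + c)^2 / (1 + y^q)^2. *)
pose h y := y `^ l / (1 + y `^ q) ^+ 2.
pose P y := - (q * (1 + y `^ q))^-1.
have pos y : 0 < 1 + y `^ q by rewrite ltr_wpDr// powR_ge0.
have ih : mu.-integrable `]0, +oo[ (EFin \o h).
  apply: (@integrable_of_bounded_primitive _ h P q^-1).
  - move=> y y0; rewrite /P.
    have d1 := is_derive_powR q y0.
    have d2 : is_derive y (1 : R) (fun x => q * (1 + x `^ q)) (q * (q * y `^ (q - 1))).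
      by apply: is_derive_eq; rewrite /GRing.scale/=; ring.
    have n0 : q * (1 + y `^ q) != 0 by rewrite mulf_neq0 ?gt_eqF.
    have d3 := @is_deriveV R (fun x => q * (1 + x `^ q)) y _ 1 n0 d2.
    apply: (is_derive_eq (is_deriveN d3)).
    rewrite /h /GRing.scale/= (_ : q - 1 = l); last by rewrite /q; ring.
    by field; rewrite !gt_eqF.
  - move=> y y0; apply: continuousM; first exact: continuous_powRl.
    apply: cvgV; first by rewrite expf_neq0// gt_eqF.
    apply: (@continuous_comp _ _ _ (fun x => 1 + x `^ q) (fun x => x ^+ 2)).
      by apply: cvgD; [exact: cvg_cst|exact: continuous_powRl].
    exact: exprn_continuous.
  - by move=> y y0; rewrite divr_ge0 ?powR_ge0// exprn_ge0// ltW.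
  - move=> y y0; rewrite /P normrN gtr0_norm ?invr_gt0 ?mulr_gt0//.
    by rewrite lef_pV2 ?posrE ?mulr_gt0// ler_peMr ?lerDl ?powR_ge0// ltW.
have ih2 : mu.-integrable `]0, +oo[ (EFin \o (fun y => (1 + c) ^+ 2 * h y)).
  by apply: integrable_realZ.
apply: (le_integrable _ _ _ ih2) => //.
  apply/measurable_EFinP; apply: open_continuous_measurable_fun => //.
  move=> y; rewrite inE/= in_itv/= andbT => y0.
  by apply: cvgM; [exact: continuous_powRl|exact: continuous_expRM].
move=> y /=; rewrite in_itv/= andbT => y0; rewrite lee_fin.
rewrite !ger0_norm; last 2 first.
  by rewrite mulr_ge0 ?sqr_ge0// divr_ge0 ?powR_ge0// exprn_ge0// ltW.
  by rewrite mulr_ge0 ?powR_ge0 ?expR_ge0.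
rewrite /h mulrCA ler_wpM2l ?powR_ge0// ler_pdivlMr ?exprn_gt0//.
rewrite mulNr expRN mulrC ler_pdivrMr ?expR_gt0//.
have -> : expR (g * y) = expR (g / 2 * y) ^+ 2.
  by rewrite -expRM_natl; congr expR; field.
have a1 : 0 <= 1 + y `^ q by exact: ltW.
have a2 : 0 <= (1 + c) * expR (g / 2 * y) by rewrite mulr_ge0 ?expR_ge0//; lra.
rewrite -exprMn ler_pXn2r ?nnegrE//.
rewrite mulrDl mul1r lerD//; last exact: hc.
by rewrite (le_trans _ (expR_ge1Dx _))// lerDl mulr_ge0 ?divr_ge0// ltW.
Qed.

(** The sizes of the boundary terms at the two ends of [shrinking_itv], in the rotation of the ray
    for the gamma integral and in the integrations by parts. *)
Lemma powR_expR_cvg0 q g : 0 < q -> 0 < g ->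
  (n.+1%:R `^ q * expR (- g * n.+1%:R)) @[n --> \oo] --> (0 : R) /\
  ((n.+1%:R^-1) `^ q * expR (- g * n.+1%:R^-1)) @[n --> \oo] --> (0 : R).
Proof.
move=> q0 g0; split.
  have [c c0 hc] := powR_le_expR q0 (divr_gt0 g0 (ltr0n _ 2)).
  apply/cvgrPdist_le => e e0; near=> n.
  rewrite sub0r normrN ger0_norm ?mulr_ge0 ?powR_ge0 ?expR_ge0//.
  have n0 : (0 : R) < n.+1%:R by [].
  rewrite (le_trans (ler_wpM2r (expR_ge0 _) (hc _ n0)))//.
  rewrite -mulrA -expRD (_ : _ + _ = - (g / 2 * n.+1%:R)); last by field.
  rewrite expRN ler_pdivrMr ?expR_gt0// -ler_pdivrMl//.
  rewrite (le_trans _ (expR_ge1Dx _))// -[leLHS]add0r lerD//.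
  rewrite [leRHS]mulrC -ler_pdivrMr ?divr_gt0//.
  have : e^-1 * c / (g / 2) <= n%:R by near: n; exact: nbhs_infty_ger.
  by move=> /le_trans; apply; rewrite ler_nat.
apply/cvgrPdist_le => e e0; near=> n.
rewrite sub0r normrN ger0_norm ?mulr_ge0 ?powR_ge0 ?expR_ge0//.
rewrite (@le_trans _ _ ((n.+1%:R^-1) `^ q))//.
  rewrite ler_piMr ?powR_ge0// mulNr -(expR0 R) ler_expR oppr_le0 mulr_ge0//.
  exact: ltW.
have -> : e = (e `^ q^-1) `^ q.
  by rewrite -powRrM mulVf ?powRr1 ?gt_eqF// ltW.
apply: ge0_ler_powR; rewrite ?nnegrE ?invr_ge0 ?powR_ge0//; first exact: ltW.
rewrite invf_ple ?posrE ?powR_gt0//.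
have : (e `^ q^-1)^-1 <= n%:R by near: n; exact: nbhs_infty_ger.
by move=> /le_trans; apply; rewrite ler_nat.
Unshelve. all: by end_near. Qed.

End GammaTransform.

(** * The gamma integral with a complex parameter *)

Section ComplexGamma.
Context {R : realType}.
Notation mu := (@lebesgue_measure R).
Implicit Types (l q g y t : R) (z w : R[i]).

Definition gamma_fun l z : R[i] := cpow z l * cexp (- z).

(** The power is monotone in one direction or the other according to the sign of [l]; the sum of the
    end values covers both cases. *)
Lemma powR_between l (m1 m2 x : R) : 0 < m1 -> m1 <= x <= m2 ->
  x `^ l <= m1 `^ l + m2 `^ l.
Proof.
move=> m10 /andP[m1x xm2]; have x0 := lt_le_trans m10 m1x.
have m20 := lt_le_trans x0 xm2.
case: (leP 0 l) => l0.
  rewrite -[leLHS]add0r lerD ?powR_ge0//.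
  by apply: ge0_ler_powR; rewrite ?nnegrE// ltW.
rewrite -[leLHS]addr0 lerD ?powR_ge0//.
have [k k0 ->] : exists2 k, 0 <= k & l = - k by exists (- l); lra.
rewrite !(powRN _ k) lef_pV2 ?posrE ?powR_gt0//.
by apply: ge0_ler_powR; rewrite ?nnegrE// ltW.
Qed.

Definition right_half (r : R) : set R[i] := [set z | r <= reC z].

Lemma convexC_right_half r : convexC (right_half r).
Proof.
move=> a b t; rewrite /right_half/= => ra rb /andP[t0 t1]; rewrite !reimE; nra.
Qed.

Lemma closedC_right_half r : closedC (right_half r).
Proof.
move=> p h; rewrite /right_half/=; apply/ler_addgt0Pr => e e0.
have [z rz zp] := h e e0.
have := le_lt_trans (cmod_re (z - p)) zp; rewrite !reimE ltr_norml => /andP[_].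
by move: rz; rewrite /right_half/=; lra.
Qed.

Lemma holomorphic_gamma_fun l r : 0 < r ->
  holomorphic_on (right_half r) (gamma_fun l).
Proof.
move=> r0 z; rewrite /right_half/= => rz.
apply: derivableMC.
  by apply: derivable_cpow; apply: slit_plane_re; exact: lt_le_trans rz.
apply: (@derivable_compC _ (fun z => - z) cexp); last exact: derivable_cexp.
exact: (derivableN (@derivable_idC _ z)).
Qed.

(** These segments close the quadrilateral between the rays through 1 and [w]. On the one from 1 to
    [w] the real part is at least min (1, Re w), and scaling by s gives the powers of s. *)
Lemma gamma_side l w : 0 < reC w -> exists K : R, forall s : R, 0 < s ->
  cmod (seg (gamma_fun l) s%:C (s%:C * w)) <=
  K * (s `^ (l + 1) * expR (- Num.min 1 (reC w) * s)).
Proof.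
move=> w0; set g := Num.min 1 (reC w).
have g0 : 0 < g by rewrite /g lt_min ltr01.
have g1 : g <= 1 by rewrite /g ge_min lexx.
have gw : g <= reC w by rewrite /g ge_min lexx orbT.
pose M := 1 + cmod w.
exists (2 * (g `^ l + M `^ l) * cmod (w - 1)) => s s0.
have sg : 0 < s * g by rewrite mulr_gt0.
have cF := holomorphic_continuousC (holomorphic_gamma_fun (l := l) sg).
have U1 : right_half (s * g) s%:C.
  by rewrite /right_half/= ler_piMr// ltW.
have U2 : right_half (s * g) (s%:C * w).
  by rewrite /right_half/= reMr ler_pM2l.
have -> : 2 * (g `^ l + M `^ l) * cmod (w - 1) * (s `^ (l + 1) * expR (- g * s)) =
    2 * ((g `^ l + M `^ l) * s `^ l * expR (- g * s)) * cmod (s%:C * w - s%:C).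
  have -> : s%:C * w - s%:C = s%:C * (w - 1) by ring.
  have -> : s `^ (l + 1) = s `^ l * s.
    by rewrite powRD ?powRr1 ?(ltW s0)// (gt_eqF s0) implybT.
  by rewrite cmodM cmod_real gtr0_norm//; ring.
apply: (seg_le (convexC_right_half (r := s * g)) cF U1 U2) => t /andP[t0 t1].
have -> : s%:C + t%:C * (s%:C * w - s%:C) = s%:C * (1 + t%:C * (w - 1)) by ring.
set u := 1 + _.
have gu : g <= reC u.
  rewrite /u !reimE; nra.
have u0 : u != 0.
  by apply: contraTneq gu => ->; rewrite -ltNge.
have gu2 : g <= cmod u by rewrite (le_trans gu)// (le_trans (ler_norm _))// cmod_re.
have uM : cmod u <= M.
  have -> : u = (1 - t)%:C * 1 + t%:C * w.
    by rewrite /u rmorphB/=; ring.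
  rewrite (le_trans (cmodD _ _))// !cmodM !cmod_real normr1 !ger0_norm ?subr_ge0//.
  have := cmod_ge0 w; rewrite /M; nra.
rewrite /gamma_fun cmodM cmod_cexp cpowM_real// cmodM cmod_real ger0_norm ?powR_ge0//.
rewrite cmod_cpow// reN reMr; apply: ler_pM; rewrite ?mulr_ge0 ?powR_ge0 ?expR_ge0//.
  rewrite mulrC ler_wpM2r ?powR_ge0// powR_between//.
  by rewrite gu2.
by rewrite ler_expR mulNr lerN2 mulrC ler_pM2l.
Qed.

Lemma cint_shrinking_cvg (f : R -> R[i]) : cintegrable mu `]0, +oo[ f ->
  (cint mu `[n.+1%:R^-1, n.+1%:R] f : R[i]^o) @[n --> \oo] -->
  (cint mu `]0, +oo[ f : R[i]^o).
Proof.
move=> [f1 f2]; apply: cvg_complexP.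
  exact: (Rintegral_shrinking_cvg f1).
exact: (Rintegral_shrinking_cvg f2).
Qed.

Lemma cvgC_mull (T : Type) (F : set_system T) (FF : Filter F)
    (f : T -> R[i]) (k a : R[i]) :
  (f x : R[i]^o) @[x --> F] --> (a : R[i]^o) ->
  (k * f x : R[i]^o) @[x --> F] --> (k * a : R[i]^o).
Proof.
move=> fa; apply/cvg_cmodP => e e0.
have k0 : 0 < cmod k + 1 by rewrite ltr_wpDl ?cmod_ge0.
have : \forall x \near F, cmod (f x - a) < e / (cmod k + 1).
  by move/cvg_cmodP : fa; apply; rewrite divr_gt0.
apply: filterS => x; rewrite ltr_pdivlMr// -mulrBr cmodM => h.
by rewrite (le_lt_trans _ h)// mulrC ler_wpM2l ?cmod_ge0//; lra.
Qed.

Lemma cvgC_sub (T : Type) (F : set_system T) (FF : Filter F)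
    (f g : T -> R[i]) (a b : R[i]) :
  (f x : R[i]^o) @[x --> F] --> (a : R[i]^o) ->
  (g x : R[i]^o) @[x --> F] --> (b : R[i]^o) ->
  (f x - g x : R[i]^o) @[x --> F] --> (a - b : R[i]^o).
Proof. by move=> fa gb; exact: (cvgB fa gb). Qed.

Lemma cvgC_le0 (u : nat -> R[i]^o) (b : nat -> R) (L : R[i]^o) :
  u n @[n --> \oo] --> L -> b n @[n --> \oo] --> (0 : R) ->
  (\forall n \near \oo, cmod (u n) <= b n) -> L = 0.
Proof.
move=> uL b0 ub; apply/eqP; rewrite -cmod_eq0 eq_le cmod_ge0 andbT.
apply/ler_addgt0Pr => e e0; have e2 : 0 < e / 2 by rewrite divr_gt0.
have uL' : \forall n \near \oo, cmod (u n - L) < e / 2.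
  by move/cvg_cmodP : uL; exact.
have b0' : \forall n \near \oo, `|0 - b n| < e / 2.
  by move/cvgrPdist_lt : b0; exact.
near \oo => n.
have h1 : cmod (u n - L) < e / 2 by near: n.
have h2 : `|0 - b n| < e / 2 by near: n.
have h3 : cmod (u n) <= b n by near: n.
rewrite add0r; have := cmodD (L - u n) (u n); rewrite subrK cmod_distC.
have := ler_norm (b n); rewrite sub0r normrN in h2; lra.
Unshelve. all: by end_near. Qed.

Lemma cintegrable_gamma l w : -1 < l -> 0 < reC w ->
  cintegrable mu `]0, +oo[ (fun y => (y `^ l)%:C * cexp (- (y%:C * w))).
Proof.
move=> l1 w0; have ig := integrable_powR_expR l1 w0.
have c1 (y : R) : {for y, continuous (fun y => - (y * imC w))}.
  by apply: cvgN; apply: cvgM; [exact: cvg_id|exact: cvg_cst].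
have H (y : R) : cmod ((y `^ l)%:C * cexp (- (y%:C * w))) =
    y `^ l * expR (- reC w * y).
  rewrite cmodM cmod_real cmod_cexp !reimE ger0_norm ?powR_ge0//.
  by congr (_ * expR _); ring.
split; apply: (le_integrable _ _ _ ig) => //.
- apply/measurable_EFinP; apply: open_continuous_measurable_fun => //.
  move=> y; rewrite inE/= in_itv/= andbT => y0.
  rewrite (_ : (fun x => _) = (fun x => x `^ l * (expR (- reC w * x) * cos (- (x * imC w))))).
    apply: cvgM; first exact: continuous_powRl.
    apply: cvgM; first exact: continuous_expRM.
    exact: (continuous_comp (c1 y) (@continuous_cos _ _)).
  apply/funext => x; rewrite mul0r subr0 !reimE; congr (_ * (expR _ * _)); ring.
- move=> y /=; rewrite in_itv/= andbT => y0; rewrite lee_fin.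
  have := cmod_re ((y `^ l)%:C * cexp (- (y%:C * w))); rewrite H => h.
  exact: (le_trans h (ler_norm _)).
- apply/measurable_EFinP; apply: open_continuous_measurable_fun => //.
  move=> y; rewrite inE/= in_itv/= andbT => y0.
  rewrite (_ : (fun x => _) = (fun x => x `^ l * (expR (- reC w * x) * sin (- (x * imC w))))).
    apply: cvgM; first exact: continuous_powRl.
    apply: cvgM; first exact: continuous_expRM.
    exact: (continuous_comp (c1 y) (@continuous_sin _ _)).
  apply/funext => x; rewrite mul0r addr0 !reimE; congr (_ * (expR _ * _)); ring.
- move=> y /=; rewrite in_itv/= andbT => y0; rewrite lee_fin.
  have := cmod_im ((y `^ l)%:C * cexp (- (y%:C * w))); rewrite H => h.
  exact: (le_trans h (ler_norm _)).
Qed.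

(** Rotation of the ray: up to the factor w^(l + 1), the left integral is that of [gamma_fun] along
    the ray through [w], which Cauchy's theorem compares with the positive axis; the two connecting
    segments vanish at 0 and at infinity. *)
Theorem gamma_transform l w : -1 < l -> 0 < reC w ->
  cint mu `]0, +oo[ (fun y => (y `^ l)%:C * cexp (- (y%:C * w))) =
  (gamma_int (l + 1))%:C * cpow w (- (l + 1)).
Proof.
move=> l1 w0; set f := (fun y : R => _); set g := Num.min 1 (reC w).
have g0 : 0 < g by rewrite /g lt_min ltr01.
have wN0 : w != 0 by apply: contraTneq w0 => ->; rewrite ltxx.
have [K hK] := gamma_side l w0.
pose f1 (y : R) : R[i] := (y `^ l)%:C * cexp (- (y%:C * 1)).
have i1 : cintegrable mu `]0, +oo[ f1 by apply: cintegrable_gamma.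
have i2 : cintegrable mu `]0, +oo[ f by exact: cintegrable_gamma.
have ray (v : R[i]) (a b : R) : 0 < reC v -> 0 < a -> a < b ->
    seg (gamma_fun l) (a%:C * v) (b%:C * v) =
    cpow v (l + 1) * cint mu `[a, b] (fun y => (y `^ l)%:C * cexp (- (y%:C * v))).
  move=> v0 a0 ab.
  have vN0 : v != 0 by apply: contraTneq v0 => ->; rewrite ltxx.
  have av : 0 < a * reC v by rewrite mulr_gt0.
  have cF := holomorphic_continuousC (holomorphic_gamma_fun (l := l) av).
  have hU t : a <= t <= b -> right_half (a * reC v) (0 + t%:C * v).
    by move=> /andP[at_ _]; rewrite /right_half/= add0r reMr ler_pM2r.
  have := seg_line ab cF hU; rewrite !add0r => ->.
  rewrite cpowS// [cpow v l * v]mulrC -mulrA; congr (_ * _).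
  rewrite -cintZ//; last first.
    have [s1 s2] := cintegrable_gamma l1 v0.
    split; [apply: integrableS s1|apply: integrableS s2] => //.
    - by move=> y /=; rewrite !in_itv/= andbT => /andP[ay _]; exact: lt_le_trans ay.
    - by move=> y /=; rewrite !in_itv/= andbT => /andP[ay _]; exact: lt_le_trans ay.
  apply: eq_cint => y /=; rewrite in_itv/= => /andP[ay _].
  rewrite add0r /gamma_fun cpowM_real//; last exact: lt_le_trans ay.
  by ring.
pose a n : R := n.+1%:R^-1; pose b n : R := n.+1%:R.
pose D n : R[i]^o := cpow w (l + 1) * cint mu `[a n, b n] f - cint mu `[a n, b n] f1.
pose L : R[i]^o := cpow w (l + 1) * cint mu `]0, +oo[ f - cint mu `]0, +oo[ f1.
have DL : D n @[n --> \oo] --> L.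
  have h1 := cint_shrinking_cvg i1; have h2 := cint_shrinking_cvg i2.
  have h3 : (cpow w (l + 1) * cint mu `[n.+1%:R^-1, n.+1%:R] f : R[i]^o) @[n --> \oo] -->
      (cpow w (l + 1) * cint mu `]0, +oo[ f : R[i]^o).
    exact: cvgC_mull.
  exact: cvgC_sub h3 h1.
have l10 : 0 < l + 1 by lra.
have [k1 k2] := powR_expR_cvg0 l10 g0.
pose B n := K * (b n `^ (l + 1) * expR (- g * b n)) +
  K * (a n `^ (l + 1) * expR (- g * a n)).
have B0 : B n @[n --> \oo] --> (0 : R).
  rewrite -[X in _ --> X](addr0 0) -{1}(mulr0 K) -{2}(mulr0 K).
  by apply: cvgD; (apply: cvgM; first exact: cvg_cst).
have L0 : L = 0.
  apply: (cvgC_le0 DL B0); near=> n.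
  have n0 : (0 < n)%N by near: n; exact: nbhs_infty_gt.
  have ab : a n < b n by rewrite /a /b -(prednK n0); exact: inv_lt_succ.
  have a0 : 0 < a n by rewrite invr_gt0.
  have b0 : 0 < b n by [].
  have r0 : 0 < a n * g by rewrite mulr_gt0.
  have hF := holomorphic_gamma_fun (l := l) r0.
  have cF := holomorphic_continuousC hF.
  have g1 : g <= 1 by rewrite /g ge_min lexx.
  have gw : g <= reC w by rewrite /g ge_min lexx orbT.
  have U (c : R) (v : R[i]) : a n <= c -> g <= reC v -> right_half (a n * g) (c%:C * v).
    by move=> ac gv; rewrite /right_half/= reMr ler_pM// ltW.
  have Ua1 := U (a n) 1 (lexx _) g1; have Ub1 := U (b n) 1 (ltW ab) g1.
  have Ua := U (a n) w (lexx _) gw; have Ub := U (b n) w (ltW ab) gw.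
  have Q := Cauchy_quadrilateral (@convexC_right_half (a n * g))
    (@closedC_right_half (a n * g)) hF Ua1 Ub1 Ub Ua.
  have cU := @convexC_right_half (a n * g).
  rewrite (seg_rev cU cF Ua Ub) (seg_rev cU cF Ua1 Ua) in Q.
  rewrite ray// ray ?re1// in Q.
  have c1 : cpow (1 : R[i]) (l + 1) = 1.
    have -> : (1 : R[i]) = 1%:C by [].
    by rewrite cpow_real// powR1.
  rewrite c1 mul1r !mulr1 in Q.
  have -> : D n = seg (gamma_fun l) (b n)%:C ((b n)%:C * w) -
      seg (gamma_fun l) (a n)%:C ((a n)%:C * w).
    by rewrite /D -[RHS]addr0 -[X in _ = _ + X]oppr0 -{}Q /f1 /f; ring.
  by rewrite (le_trans (cmodB _ _))// lerD// hK.
have E1 : cint mu `]0, +oo[ f1 = (gamma_int (l + 1))%:C.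
  rewrite /gamma_int -cint_real; apply: eq_cint => y _.
  by rewrite /f1 mulr1 -rmorphN/= cexp_real -rmorphM/= addrK.
move/eqP : L0; rewrite subr_eq0 E1 => /eqP <-.
by rewrite cpowN; field; exact: cpow_neq0.
Unshelve. all: by end_near. Qed.

End ComplexGamma.

(** * The transform of the comparison density *)

Section Comparator.
Context {R : realType}.
Notation mu := (@lebesgue_measure R).
Implicit Types (l q g x y t : R).

(* The second exponential makes the density integrable at [0] for all
   [-1 < l], including the range [l <= 0]. *)
Definition comp_density l g y : R :=
  y `^ (l - 1) * (expR (- g * y) - expR (- (g + 1) * y)).

Lemma powR_pred l y : 0 < y -> y `^ l = y `^ (l - 1) * y.
Proof.
move=> y0; have yN : y != 0 by rewrite gt_eqF.
have -> : y `^ l = y `^ (l - 1 + 1) by rewrite subrK.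
by rewrite [LHS]powRD ?yN ?implybT// powRr1// ltW.
Qed.

Lemma expR_diff_bounds g y : 0 < y ->
  0 <= expR (- g * y) - expR (- (g + 1) * y) <= y * expR (- g * y).
Proof.
move=> y0.
have -> : expR (- (g + 1) * y) = expR (- g * y) * expR (- y).
  by rewrite -expRD; congr expR; ring.
have h1 : expR (- y) <= 1 by rewrite expR_le1 oppr_le0 ltW.
have h2 : 1 - y <= expR (- y) by exact: expR_ge1Dx.
have := expR_gt0 (- g * y); nra.
Qed.

Lemma comp_density_ge0 l g y : 0 < y -> 0 <= comp_density l g y.
Proof. by move=> y0; rewrite mulr_ge0 ?powR_ge0//; have /andP[] := expR_diff_bounds g y0. Qed.

Lemma comp_density_le l g y : 0 < y ->
  comp_density l g y <= y `^ l * expR (- g * y).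
Proof.
move=> y0; rewrite (powR_pred l y0) -mulrA ler_wpM2l ?powR_ge0//.
by have /andP[] := expR_diff_bounds g y0.
Qed.

Lemma continuous_comp_density l g y : 0 < y ->
  {for y, continuous (comp_density l g)}.
Proof.
move=> y0; apply: cvgM; first exact: continuous_powRl.
by apply: cvgB; exact: continuous_expRM.
Qed.

Lemma integrable_comp_density l g : -1 < l -> 0 < g ->
  mu.-integrable `]0, +oo[ (EFin \o comp_density l g).
Proof.
move=> l1 g0; have ig := integrable_powR_expR l1 g0.
apply: (le_integrable _ _ _ ig) => //.
  apply/measurable_EFinP; apply: open_continuous_measurable_fun => //.
  by move=> y; rewrite inE/= in_itv/= andbT; exact: continuous_comp_density.
move=> y /=; rewrite in_itv/= andbT => y0; rewrite lee_fin.
by rewrite ger0_norm ?comp_density_ge0// (le_trans (comp_density_le _ _ y0))// ler_norm.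
Qed.

Lemma is_derive_cosM t y :
  is_derive y (1 : R) (fun x => cos (t * x)) (- t * sin (t * y)).
Proof. by apply: is_derive_eq; rewrite /GRing.scale/=; ring. Qed.

Lemma is_derive_sinM t y :
  is_derive y (1 : R) (fun x => sin (t * x)) (t * cos (t * y)).
Proof. by apply: is_derive_eq; rewrite /GRing.scale/=; ring. Qed.

Lemma continuous_cosM t : continuous (fun x : R => cos (t * x)).
Proof.
move=> y; apply/differentiable_continuous/derivable1_diffP.
by have [] := is_derive_cosM t y.
Qed.

Lemma continuous_sinM t : continuous (fun x : R => sin (t * x)).
Proof.
move=> y; apply/differentiable_continuous/derivable1_diffP.
by have [] := is_derive_sinM t y.
Qed.

Lemma cexp_imag t y : cexp ((0 +i* t) * y%:C) = cos (t * y) +i* sin (t * y).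
Proof.
have -> : (0 +i* t) * y%:C = 0 +i* (t * y).
  by rewrite mulrC; apply: complex_eq; rewrite ?reMr ?imMr /= ?mulr0// mulrC.
by rewrite /cexp /= expR0 !mul1r.
Qed.

Lemma cexpN_realM (w : R[i]) y :
  cexp (- (y%:C * w)) = (expR (- reC w * y) * cos (- imC w * y)) +i*
    (expR (- reC w * y) * sin (- imC w * y)).
Proof.
have -> : - (y%:C * w) = (- reC w * y) +i* (- imC w * y).
  by apply: complex_eq; rewrite ?reN ?imN ?reMr ?imMr/= mulNr mulrC.
by [].
Qed.

Lemma cintegrable_comp_transform l g t : -1 < l -> 0 < g ->
  cintegrable mu `]0, +oo[
    (fun y => (comp_density l g y)%:C * cexp ((0 +i* t) * y%:C)).
Proof.
move=> l1 g0; have ig := integrable_comp_density l1 g0.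
have H y : (comp_density l g y)%:C * cexp ((0 +i* t) * y%:C) =
    (comp_density l g y * cos (t * y)) +i* (comp_density l g y * sin (t * y)).
  by rewrite cexp_imag; apply: complex_eq; rewrite ?reMr ?imMr.
have H2 : cintegrable mu `]0, +oo[ (fun y => (comp_density l g y * cos (t * y)) +i*
    (comp_density l g y * sin (t * y))).
  split; apply: (le_integrable _ _ _ ig) => //.
  - apply/measurable_EFinP; apply: open_continuous_measurable_fun => //.
    move=> y; rewrite inE/= in_itv/= andbT => y0.
    by apply: cvgM; [exact: continuous_comp_density|exact: continuous_cosM].
  - move=> y _; rewrite /= lee_fin normrM ler_piMr// cos_max//.
  - apply/measurable_EFinP; apply: open_continuous_measurable_fun => //.
    move=> y; rewrite inE/= in_itv/= andbT => y0.
    by apply: cvgM; [exact: continuous_comp_density|exact: continuous_sinM].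
  - move=> y _; rewrite /= lee_fin normrM ler_piMr// sin_max//.
by apply: eq_cintegrable H2 => // y _; rewrite H.
Qed.

(** For l <= 0 the two terms of the density are not integrable separately, so they cannot be
    transformed one by one. Integration by parts raises the exponent from l - 1 to l > -1, where
    [gamma_transform] applies; this produces the factor l on the left. *)
Theorem comp_transform l g t : -1 < l -> 0 < g ->
  l%:C * cint mu `]0, +oo[
    (fun y => (comp_density l g y)%:C * cexp ((0 +i* t) * y%:C)) =
  (gamma_int (l + 1))%:C *
    (cpow (g%:C - (0 +i* t)) (- l) - cpow ((g + 1)%:C - (0 +i* t)) (- l)).
Proof.
move=> l1 g0; have g10 : 0 < g + 1 by lra.
set w1 := g%:C - _; set w2 := (g + 1)%:C - _.
have rw1 : reC w1 = g by rewrite /w1 !reimE/= subr0.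
have rw2 : reC w2 = g + 1 by rewrite /w2 !reimE/= subr0.
have iw1 : imC w1 = - t by rewrite /w1 !reimE/= sub0r.
have iw2 : imC w2 = - t by rewrite /w2 !reimE/= sub0r.
have w10 : 0 < reC w1 by rewrite rw1.
have w20 : 0 < reC w2 by rewrite rw2.
pose A (w : R[i]) (y : R) : R[i] := (y `^ l)%:C * cexp (- (y%:C * w)).
pose W (y : R) : R[i] := (comp_density l g y)%:C * cexp ((0 +i* t) * y%:C).
have iW : cintegrable mu `]0, +oo[ W by exact: cintegrable_comp_transform.
have iA1 : cintegrable mu `]0, +oo[ (A w1) by exact: cintegrable_gamma.
have iA2 : cintegrable mu `]0, +oo[ (A w2) by exact: cintegrable_gamma.
(* The derivative of [Q] below, that is of y^l E(y) e^(i t y) = y^l (e^(- y w1) - e^(- y w2)). *)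
pose h y := l%:C * W y + (w2 * A w2 y - w1 * A w1 y).
have ih : cintegrable mu `]0, +oo[ h.
  apply: cintegrableD => //; first exact: cintegrableZ.
  by apply: cintegrableB => //; exact: cintegrableZ.
have Eh : cint mu `]0, +oo[ h = l%:C * cint mu `]0, +oo[ W +
    (w2 * cint mu `]0, +oo[ (A w2) - w1 * cint mu `]0, +oo[ (A w1)).
  rewrite cintD//; first last.
  - by apply: cintegrableB => //; exact: cintegrableZ.
  - exact: cintegrableZ.
  rewrite cintZ// cintB//; try exact: cintegrableZ.
  by rewrite !cintZ.
pose E y := expR (- g * y) - expR (- (g + 1) * y).
pose Q (y : R) : R[i] := (y `^ l * E y * cos (t * y)) +i* (y `^ l * E y * sin (t * y)).
have AE w y : A w y = (y `^ l * (expR (- reC w * y) * cos (- imC w * y))) +i*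
    (y `^ l * (expR (- reC w * y) * sin (- imC w * y))).
  by rewrite /A cexpN_realM; apply: complex_eq; rewrite ?reMr ?imMr.
have WE y : W y = (comp_density l g y * cos (t * y)) +i* (comp_density l g y * sin (t * y)).
  by rewrite /W cexp_imag; apply: complex_eq; rewrite ?reMr ?imMr.
have dE y : is_derive y (1 : R) E (- g * expR (- g * y) + (g + 1) * expR (- (g + 1) * y)).
  have d1 := is_derive_expRM (- g) y; have d2 := is_derive_expRM (- (g + 1)) y.
  by apply: is_derive_eq; ring.
have FTC a b : 0 < a -> a < b -> cint mu `[a, b] h = Q b - Q a.
  move=> a0 ab.
  have pos y : a <= y <= b -> 0 < y by move=> /andP[+ _]; exact: lt_le_trans.
  have cA w (y : R) : 0 < y -> {for y, continuous (fun y => reC (A w y))} /\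
      {for y, continuous (fun y => imC (A w y))}.
    move=> y0; split.
      rewrite (_ : (fun y => _) = (fun y => y `^ l * (expR (- reC w * y) * cos (- imC w * y)))).
        apply: cvgM; first exact: continuous_powRl.
        by apply: cvgM; [exact: continuous_expRM|exact: continuous_cosM].
      by apply/funext => x; rewrite AE.
    rewrite (_ : (fun y => _) = (fun y => y `^ l * (expR (- reC w * y) * sin (- imC w * y)))).
      apply: cvgM; first exact: continuous_powRl.
      by apply: cvgM; [exact: continuous_expRM|exact: continuous_sinM].
    by apply/funext => x; rewrite AE.
  apply: complex_eq; rewrite ?reD ?imD ?reN ?imN /=.
  - apply: (@Rintegral_FTC _ (fun y => reC (h y)) (fun y => reC (Q y)) a b ab) => y /pos y0.
    + have d1 := is_derive_powR l y0; have d2 := dE y; have d3 := is_derive_cosM t y.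
      have d4 : is_derive y (1 : R) (fun y => y `^ l * E y * cos (t * y))
        ((y `^ l * E y) * (- t * sin (t * y)) + cos (t * y) * (y `^ l * (- g * expR (-
            g * y) + (g + 1) * expR (- (g + 1) * y)) + E y * (l * y `^ (l - 1)))).
        by apply: is_derive_eq; rewrite /GRing.scale/=.
      apply: (is_derive_eq d4).
      rewrite /h !reD !reN reMr [reC (w1 * _)]reM [reC (w2 * _)]reM WE !AE rw1 rw2 iw1
          iw2 /= !opprK.
      by rewrite /comp_density /E; ring.
    + rewrite (_ : (fun y => _) = (fun y => l * (comp_density l g y * cos (t * y)) +
        ((reC w2 * reC (A w2 y) - imC w2 * imC (A w2 y)) - (reC w1 * reC (A w1 y) - imC
            w1 * imC (A w1 y))))).
        have [a1 a2] := cA w1 y y0; have [a3 a4] := cA w2 y y0.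
        apply: cvgD.
          apply: cvgM; first exact: cvg_cst.
          by apply: cvgM; [exact: continuous_comp_density|exact: continuous_cosM].
        by apply: cvgB; apply: cvgB; (apply: cvgM; first exact: cvg_cst).
      by apply/funext => x; rewrite /h !reD !reN reMr [reC (w1 * _)]reM [reC (w2 * _)]reM WE.
  - apply: (@Rintegral_FTC _ (fun y => imC (h y)) (fun y => imC (Q y)) a b ab) => y /pos y0.
    + have d1 := is_derive_powR l y0; have d2 := dE y; have d3 := is_derive_sinM t y.
      have d4 : is_derive y (1 : R) (fun y => y `^ l * E y * sin (t * y))
        ((y `^ l * E y) * (t * cos (t * y)) + sin (t * y) * (y `^ l * (- g * expR (- g
            * y) + (g + 1) * expR (- (g + 1) * y)) + E y * (l * y `^ (l - 1)))).
        by apply: is_derive_eq; rewrite /GRing.scale/=.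
      apply: (is_derive_eq d4).
      rewrite /h !imD !imN imMr [imC (w1 * _)]imM [imC (w2 * _)]imM WE !AE rw1 rw2 iw1
          iw2 /= !opprK.
      by rewrite /comp_density /E; ring.
    + rewrite (_ : (fun y => _) = (fun y => l * (comp_density l g y * sin (t * y)) +
        ((reC w2 * imC (A w2 y) + imC w2 * reC (A w2 y)) - (reC w1 * imC (A w1 y) + imC
            w1 * reC (A w1 y))))).
        have [a1 a2] := cA w1 y y0; have [a3 a4] := cA w2 y y0.
        apply: cvgD.
          apply: cvgM; first exact: cvg_cst.
          by apply: cvgM; [exact: continuous_comp_density|exact: continuous_sinM].
        by apply: cvgB; apply: cvgD; (apply: cvgM; first exact: cvg_cst).
      by apply/funext => x; rewrite /h !imD !imN imMr [imC (w1 * _)]imM [imC (w2 * _)]imM WE.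
(* E(y) <= y exp (- g y) supplies the extra power of y that makes the boundary term vanish at 0 for
   every -1 < l. *)
have Qle y : 0 < y -> cmod (Q y) <= y `^ (l + 1) * expR (- g * y).
  move=> y0; have -> : Q y = (y `^ l * E y)%:C * cexp (0 +i* (t * y)).
    by apply: complex_eq; rewrite ?reMr ?imMr /= expR0 !mul1r.
  rewrite cmodM cmod_cexp /= expR0 mulr1 cmod_real.
  have /andP[E0 E1] := expR_diff_bounds g y0.
  rewrite ger0_norm ?mulr_ge0 ?powR_ge0//.
  by rewrite (powR_pred (l + 1) y0) addrK -mulrA ler_wpM2l ?powR_ge0.
have l10 : 0 < l + 1 by lra.
have [k1 k2] := powR_expR_cvg0 l10 g0.
have int0 : cint mu `]0, +oo[ h = 0.
  apply: (cvgC_le0 (cint_shrinking_cvg ih) (b := fun n =>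
    n.+1%:R `^ (l + 1) * expR (- g * n.+1%:R) +
    (n.+1%:R^-1) `^ (l + 1) * expR (- g * n.+1%:R^-1))).
    by rewrite -[X in _ --> X](addr0 0); exact: cvgD.
  near=> n.
  have n0 : (0 < n)%N by near: n; exact: nbhs_infty_gt.
  have ab : (n.+1%:R^-1 : R) < n.+1%:R by rewrite -(prednK n0); exact: inv_lt_succ.
  by rewrite FTC// (le_trans (cmodB _ _))// lerD// Qle.
have G1 := gamma_transform l1 w10; have G2 := gamma_transform l1 w20.
move: Eh; rewrite int0 /A G1 G2 => /esym/eqP; rewrite addr_eq0 => /eqP ->.
have w1N : w1 != 0 by apply: contraTneq w10 => ->; rewrite ltxx.
have w2N : w2 != 0 by apply: contraTneq w20 => ->; rewrite ltxx.
have P w : w != 0 -> w * cpow w (- (l + 1)) = cpow w (- l).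
  move=> wN; rewrite -[in RHS](subrK 1 (- l)) (_ : - l - 1 = - (l + 1)); last by ring.
  by rewrite cpowS// mulrC.
by rewrite -(P w1)// -(P w2)//; ring.
Unshelve. all: by end_near. Qed.

End Comparator.

(** * Positivity and recursion of the gamma function *)

Section GammaValues.
Context {R : realType}.
Notation mu := (@lebesgue_measure R).
Implicit Types (l q g x y t : R).

Lemma gamma_intE l : gamma_int (l + 1) = \int[mu]_(t in `]0, +oo[) (t `^ l * expR (- 1 * t)).
Proof. by apply: eq_Rintegral => t _; rewrite addrK mulN1r. Qed.

(** On [1, 2] the integrand is at least the constant min (1, 2^l) exp (- 2). *)
Lemma gamma_int_gt0 l : -1 < l -> 0 < gamma_int (l + 1).
Proof.
move=> l1; rewrite gamma_intE; set f := (fun t => t `^ l * expR (- 1 * t)).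
have fi : mu.-integrable `]0, +oo[ (EFin \o f) by exact: integrable_powR_expR.
pose c := Num.min ((1:R) `^ l) (2 `^ l) * expR (- 2).
have c0 : 0 < c by rewrite mulr_gt0 ?expR_gt0// lt_min !powR_gt0.
have fc t : 1 <= t <= 2 -> c <= f t.
  move=> /andP[t1 t2]; have t0 : 0 < t by lra.
  apply: ler_pM; rewrite ?expR_ge0 ?le_min ?powR_ge0//; last first.
    by rewrite ler_expR; lra.
  rewrite ge_min; case: (leP 0 l) => l0.
    by rewrite ge0_ler_powR ?nnegrE// ltW.
  apply/orP; right; have [k k0 ->] : exists2 k, 0 <= k & l = - k by exists (- l); lra.
  rewrite !(powRN _ k) lef_pV2 ?posrE ?powR_gt0//.
  by rewrite ge0_ler_powR ?nnegrE// ltW.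
have f12 : mu.-integrable `[1, 2] (EFin \o f).
  apply: integrableS fi => //; move=> t /=; rewrite !in_itv/= andbT => /andP[t1 _].
  by rewrite (lt_le_trans ltr01).
rewrite (lt_le_trans c0)//.
have -> : c = \int[mu]_(t in `[1, 2]) cst c t.
  rewrite Rintegral_cst//= lebesgue_measure_itv/= lte_fin ltr1n -EFinB/=.
  by rewrite (_ : 2 - 1 = 1) ?mulr1//; ring.
apply: (@le_trans _ _ (\int[mu]_(t in `[1, 2]) f t)).
  apply: le_Rintegral => //.
  apply: continuous_compact_integrable; first exact: segment_compact.
  by apply: continuous_subspaceT => x; exact: cvg_cst.
rewrite /Rintegral fine_le//; try exact: integrable_fin_num.
apply: ge0_subset_integral => //.
- by have /integrableP[] := fi.
- by move=> t /=; rewrite lee_fin mulr_ge0 ?powR_ge0 ?expR_ge0.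
- move=> t /=; rewrite !in_itv/= andbT => /andP[t1 _].
  by rewrite (lt_le_trans ltr01).
Qed.

(** The integrand [h] of the difference has primitive y^l exp (- y), which vanishes at both ends. *)
Lemma gamma_int_rec l : 0 < l -> gamma_int (l + 1) = l * gamma_int l.
Proof.
move=> l0; have l1 : -1 < l by lra. have l2 : -1 < l - 1 by lra.
have i1 := integrable_powR_expR l1 (@ltr01 R).
have i2 := integrable_powR_expR l2 (@ltr01 R).
have G : gamma_int l = \int[mu]_(t in `]0, +oo[) (t `^ (l - 1) * expR (- 1 * t)).
  by rewrite -gamma_intE subrK.
pose h y := l * (y `^ (l - 1) * expR (- 1 * y)) - y `^ l * expR (- 1 * y).
have i3 : mu.-integrable `]0, +oo[ (EFin \o (fun y => l * (y `^ (l - 1) * expR (- 1 * y)))).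
  exact: integrable_realZ.
have ih : mu.-integrable `]0, +oo[ (EFin \o h).
  by apply: eq_integrable (integrableB _ i3 i1) => // y _ /=; rewrite EFinB.
have E : \int[mu]_(y in `]0, +oo[) h y = l * gamma_int l - gamma_int (l + 1).
  have -> : l * gamma_int l = \int[mu]_(y in `]0, +oo[) (l * (y `^ (l - 1) * expR (- 1 * y))).
    by rewrite G; apply/esym/RintegralZl.
  by rewrite gamma_intE; exact: RintegralB.
suff : \int[mu]_(y in `]0, +oo[) h y = 0 by rewrite E => /eqP; rewrite subr_eq0 => /eqP.
have [k1 k2] := powR_expR_cvg0 l0 (@ltr01 R).
have c1 := Rintegral_shrinking_cvg ih.
have c2 : n.+1%:R `^ l * expR (- 1 * n.+1%:R) -
    n.+1%:R^-1 `^ l * expR (- 1 * n.+1%:R^-1) @[n --> \oo] --> (0 : R).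
  by rewrite -[X in _ --> X](subr0 0); exact: cvgB k1 k2.
suff e : \forall n \near \oo, n.+1%:R `^ l * expR (- 1 * n.+1%:R) -
    n.+1%:R^-1 `^ l * expR (- 1 * n.+1%:R^-1) =
    \int[mu]_(y in `[n.+1%:R^-1, n.+1%:R]) h y.
  exact: (cvg_unique _ c1 (cvg_trans (near_eq_cvg e) c2)).
near=> n.
have n0 : (0 < n)%N by near: n; exact: nbhs_infty_gt.
have ab : (n.+1%:R^-1 : R) < n.+1%:R by rewrite -(prednK n0); exact: inv_lt_succ.
symmetry; apply: (@Rintegral_FTC _ h (fun y => y `^ l * expR (- 1 * y)) _ _ ab) => y
    /andP[ay _].
- have y0 : 0 < y by rewrite (lt_le_trans _ ay)// invr_gt0.
  have d1 := is_derive_powR l y0; have d2 := is_derive_expRM (- 1) y.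
  by apply: is_derive_eq; rewrite /h /GRing.scale/=; ring.
- have y0 : 0 < y by rewrite (lt_le_trans _ ay)// invr_gt0.
  apply: cvgB; last by apply: cvgM; [exact: continuous_powRl|exact: continuous_expRM].
  apply: cvgM; first exact: cvg_cst.
  by apply: cvgM; [exact: continuous_powRl|exact: continuous_expRM].
Unshelve. all: by end_near. Qed.

(** One formula for both branches of [Gamma]: for l > 0 it is the recursion, and for -1 < l < 0 the
    truncation of - l is 0, so the defining product has the single factor l. *)
Lemma GammaE l : -1 < l -> l != 0 -> Gamma l = gamma_int (l + 1) / l.
Proof.
move=> l1 l0; rewrite /Gamma; case: ifPn => lp.
  by rewrite gamma_int_rec// mulrAC divff ?mul1r.
have ln : l < 0 by rewrite lt_neqAle l0 leNgt.
have -> : Num.truncn (- l) = 0%N.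
  have h0 : 0 <= - l by lra.
  have h1 : - l < 1 by lra.
  by apply/eqP; rewrite truncn_eq// h0 h1.
by rewrite big_ord_recl big_ord0 mulr1 addr0.
Qed.

Lemma Gamma_neq0 l : -1 < l -> l != 0 -> Gamma l != 0.
Proof.
by move=> l1 l0; rewrite GammaE// mulf_neq0 ?invr_neq0// gt_eqF// gamma_int_gt0.
Qed.

End GammaValues.

(** * Tails of power times exponential *)

Section Tails.
Context {R : realType}.
Notation mu := (@lebesgue_measure R).
Implicit Types (l q g x y t : R).

Definition decay l g x : R := x `^ (l - 1) * expR (- g * x).

Lemma decay_gt0 l g x : 0 < x -> 0 < decay l g x.
Proof. by move=> x0; rewrite mulr_gt0 ?expR_gt0 ?powR_gt0. Qed.

Lemma decay_cvg0 l g : 0 < g -> decay l g x @[x --> +oo] --> (0 : R).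
Proof.
move=> g0; have q0 : 0 < `|l - 1| + 1 by rewrite ltr_wpDl.
have [c c0 hc] := powR_le_expR q0 (divr_gt0 g0 (ltr0n _ 2)).
apply/cvgrPdist_le => e e0; near=> x.
have x1 : 1 <= x by near: x; exact: nbhs_pinfty_ge.
have x0 : 0 < x by exact: lt_le_trans x1.
rewrite sub0r normrN ger0_norm ?(ltW (decay_gt0 _ _ x0))//.
have h : x `^ (l - 1) <= c * expR (g / 2 * x).
  rewrite (le_trans _ (hc x x0))// ler_powR//.
  by rewrite (le_trans (ler_norm _))// lerDl.
rewrite (le_trans (ler_wpM2r (expR_ge0 _) h))//.
have -> : c * expR (g / 2 * x) * expR (- g * x) = c * expR (- (g / 2 * x)).
  by rewrite -[LHS]mulrA -expRD; congr (_ * expR _); field.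
rewrite expRN ler_pdivrMr ?expR_gt0// -ler_pdivrMl//.
rewrite (le_trans _ (expR_ge1Dx _))// -[leLHS]add0r lerD//.
rewrite [leRHS]mulrC -ler_pdivrMr ?divr_gt0//.
Unshelve. all: by end_near. Qed.

Lemma is_derive_decay l g x : 0 < x ->
  is_derive x (1 : R) (decay l g) (- (decay l g x * (g - (l - 1) / x))).
Proof.
move=> x0; have d1 := is_derive_powR (l - 1) x0; have d2 := is_derive_expRM (- g) x.
have d3 : is_derive x (1 : R) (decay l g)
    (x `^ (l - 1) * (- g * expR (- g * x)) + expR (- g * x) * ((l - 1) * x `^ (l - 1 - 1))).
  by apply: is_derive_eq; rewrite /GRing.scale/=.
apply: (is_derive_eq d3); rewrite /decay [in LHS](powR_pred (l - 1) x0).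
by rewrite [in RHS](powR_pred (l - 1) x0); field; rewrite gt_eqF.
Qed.

Lemma continuous_decay l g x : 0 < x -> {for x, continuous (decay l g)}.
Proof.
move=> x0; apply/differentiable_continuous/derivable1_diffP.
by have [] := is_derive_decay l g x0.
Qed.

(** The function - decay' equals decay (y) (g - (l - 1) / y), and on [x, +oo[ the second factor lies
    between g - |l - 1| / x and g + |l - 1| / x. *)
Lemma integral_decay_bounds l g x : 0 < g -> 0 < x -> `|l - 1| / x < g ->
  [/\ mu.-integrable `[x, +oo[ (EFin \o decay l g),
   (g - `|l - 1| / x) * \int[mu]_(y in `[x, +oo[) decay l g y <= decay l g x &
   decay l g x <= (g + `|l - 1| / x) * \int[mu]_(y in `[x, +oo[) decay l g y].
Proof.
move=> g0 x0 cg; set c := `|l - 1| in cg *.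
pose h y := decay l g y * (g - (l - 1) / y).
have bnd y : x <= y -> [/\ 0 < y, g - c / x <= g - (l - 1) / y & g - (l - 1) / y <= g + c / x].
  move=> xy; have y0 : 0 < y by exact: lt_le_trans xy.
  have : `|(l - 1) / y| <= c / x.
    rewrite normrM normfV (gtr0_norm y0) ler_wpM2l//.
    by rewrite lef_pV2 ?posrE.
  by rewrite ler_norml => /andP[]; split => //; lra.
have gc : 0 < g - c / x by lra.
have h0 y : x <= y -> 0 <= h y.
  by move=> /bnd[y0 b1 b2]; rewrite mulr_ge0 ?(ltW (decay_gt0 _ _ y0))//; lra.
have ch y : x <= y -> {for y, continuous h}.
  move=> /bnd[y0 _ _]; apply: cvgM; first exact: continuous_decay.
  apply: cvgB; first exact: cvg_cst.
  apply: cvgM; first exact: cvg_cst.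
  by apply: cvgV; rewrite ?gt_eqF//; exact: cvg_id.
have chW : {within `[x, +oo[, continuous h}.
  by apply: continuous_in_subspaceT => y; rewrite inE/= in_itv/= andbT; exact: ch.
have cdW : {within `[x, +oo[, continuous (decay l g)}.
  apply: continuous_in_subspaceT => y; rewrite inE/= in_itv/= andbT => /bnd[y0 _ _].
  exact: continuous_decay.
have mh : measurable_fun (`[x, +oo[%classic : set R) h.
  exact: subspace_continuous_measurable_fun.
have md : measurable_fun (`[x, +oo[%classic : set R) (decay l g).
  exact: subspace_continuous_measurable_fun.
pose P := fun y => - decay l g y.
have dP y : x <= y -> is_derive y (1 : R) P (h y).
  move=> /bnd[y0 _ _]; have d := is_derive_decay l g y0.
  by apply: (is_derive_eq (is_deriveN d)); rewrite opprK.
have I : (\int[mu]_(y in `[x, +oo[) (h y)%:E = (decay l g x)%:E)%E.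
  rewrite (@ge0_continuous_FTC2y _ h P x 0)//.
  - by rewrite /P sub0e EFinN oppeK.
  - by rewrite -oppr0; apply: cvgN; exact: decay_cvg0.
  - by move=> y /ltW xy; have [] := dP y xy.
  - apply: cvg_at_right_filter; apply: cvgN; exact: continuous_decay.
  - move=> y; rewrite in_itv/= andbT => /ltW xy; rewrite derive1E.
    by have [] := dP y xy.
have ih : mu.-integrable `[x, +oo[ (EFin \o h).
  apply/integrableP; split; first exact/measurable_EFinP.
  rewrite (_ : (\int[mu]_(y in _) _)%E = (decay l g x)%:E) ?ltry// -I.
  by apply: eq_integral => y; rewrite inE/= in_itv/= andbT => xy; rewrite ger0_norm// h0.
have d0 y : x <= y -> 0 <= decay l g y by move=> /bnd[y0 _ _]; exact/ltW/decay_gt0.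
have id' : mu.-integrable `[x, +oo[ (EFin \o decay l g).
  have ih2 : mu.-integrable `[x, +oo[ (EFin \o (fun y => (g - c / x)^-1 * h y)).
    exact: integrable_realZ.
  apply: (le_integrable _ _ _ ih2) => //; first exact/measurable_EFinP.
  move=> y /=; rewrite in_itv/= andbT => xy; rewrite lee_fin.
  have [y0 b1 b2] := bnd y xy.
  rewrite !ger0_norm ?d0//; last by rewrite mulr_ge0 ?h0// invr_ge0 ltW.
  by rewrite ler_pdivlMl// mulrC ler_wpM2l// d0.
have Ih : \int[mu]_(y in `[x, +oo[) h y = decay l g x by rewrite /Rintegral I.
split => //.
- rewrite -Ih -RintegralZl//; apply: le_Rintegral => //; first exact: integrable_realZ.
  move=> y /=; rewrite in_itv/= andbT => xy; have [y0 b1 b2] := bnd y xy.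
  by rewrite mulrC ler_wpM2l// d0.
- rewrite -Ih -RintegralZl//; apply: le_Rintegral => //; first exact: integrable_realZ.
  move=> y /=; rewrite in_itv/= andbT => xy; have [y0 b1 b2] := bnd y xy.
  by rewrite [leRHS]mulrC ler_wpM2l// d0.
Qed.

Lemma comp_densityE l g y : comp_density l g y = decay l g y * (1 - expR (- y)).
Proof.
rewrite /comp_density /decay.
have -> : expR (- (g + 1) * y) = expR (- g * y) * expR (- y).
  by rewrite -expRD; congr expR; ring.
by ring.
Qed.

End Tails.

(** * The tail of the comparison density *)

Section TailLimit.
Context {R : realType}.
Notation mu := (@lebesgue_measure R).

(** Beyond [x] the density lies between (1 - exp (- x)) decay and decay, and [integral_decay_bounds]
    squeezes both tails. *)
Lemma comp_tail_cvg (l g : R) : -1 < l -> 0 < g ->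
  (\int[mu]_(y in `]x, +oo[) comp_density l g y) / decay l g x @[x --> +oo]
  --> g^-1.
Proof.
move=> l1 g0; set c : R := `|l - 1|.
have c0 : 0 <= c by rewrite /c.
have cx : c / x @[x --> +oo] --> (0 : R).
  apply/cvgrPdist_le => e e0; near=> x.
  have x1 : 1 <= x by near: x; exact: nbhs_pinfty_ge.
  have x0 : 0 < x by exact: lt_le_trans x1.
  have x2 := ltW x0.
  rewrite sub0r normrN ger0_norm ?divr_ge0//.
  rewrite ler_pdivrMr// mulrC -ler_pdivrMr//.
have ex : expR (- x) @[x --> +oo] --> (0 : R) by exact: cvgr_expR.
apply: (@squeeze_cvgr _ _ _ _ (fun x => (1 - expR (- x)) / (g + c / x)) (fun x => (g -
    c / x)^-1)).
- near=> x.
  have x1 : 1 <= x by near: x; exact: nbhs_pinfty_ge.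
  have x0 : 0 < x by exact: lt_le_trans x1.
  have cg : c / x < g.
    have : c / g + 1 <= x by near: x; apply: nbhs_pinfty_ge; rewrite num_real.
    move=> h; have : c / g < x by lra.
    by rewrite !ltr_pdivrMr// mulrC.
  have [id' b1 b2] := integral_decay_bounds g0 x0 cg.
  rewrite -/c in b1 b2.
  set J := \int[mu]_(y in _) _ in b1 b2.
  have dx := decay_gt0 l g x0.
  have iW : mu.-integrable `[x, +oo[ (EFin \o comp_density l g).
    apply: integrableS (integrable_comp_density l1 g0) => //.
    by move=> y /=; rewrite !in_itv/= !andbT; exact: lt_le_trans.
  rewrite Rintegral_itv_obnd_cbnd//; last first.
    apply: integrableS iW => //.
    by move=> y /=; rewrite !in_itv/= !andbT => /ltW.
  set K := \int[mu]_(y in _) _.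
  have h1 : (1 - expR (- x)) * J <= K.
    rewrite -RintegralZl//; apply: le_Rintegral => //; first exact: integrable_realZ.
    move=> y /=; rewrite in_itv/= andbT => xy.
    rewrite comp_densityE mulrC ler_wpM2l ?(ltW (decay_gt0 _ _ (lt_le_trans x0 xy)))//.
    by rewrite lerD2l lerN2 ler_expR lerN2.
  have h2 : K <= J.
    apply: le_Rintegral => // y /=; rewrite in_itv/= andbT => xy.
    have d0 := ltW (decay_gt0 l g (lt_le_trans x0 xy)).
    rewrite comp_densityE; apply: ler_piMr => //.
  have e1 : 0 <= 1 - expR (- x) by rewrite subr_ge0 expR_le1 oppr_le0 ltW.
  have cx0 : 0 <= c / x by rewrite divr_ge0// ltW.
  have p1 : 0 < g + c / x by lra.
  have p2 : 0 < g - c / x by lra.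
  apply/andP; split.
    rewrite ler_pdivlMr// mulrAC ler_pdivrMr// [leRHS]mulrC.
    rewrite (le_trans (ler_wpM2l e1 b2))// mulrCA ler_pM2l//.
  rewrite ler_pdivrMr// mulrC ler_pdivlMr//.
  rewrite mulrC (le_trans _ b1)// ler_pM2l//.
- have -> : g^-1 = (1 - 0) / (g + 0) by rewrite subr0 addr0 mul1r.
  apply: cvgM; first by apply: cvgB => //; exact: cvg_cst.
  apply: cvgV; first by rewrite addr0 gt_eqF.
  by apply: cvgD => //; exact: cvg_cst.
- have -> : g^-1 = (g - 0)^-1 by rewrite subr0.
  apply: cvgV; first by rewrite subr0 gt_eqF.
  by apply: cvgB => //; exact: cvg_cst.
Unshelve. all: by end_near. Qed.

End TailLimit.

(** * Deformation of the imaginary axis to two rays *)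

Section Contour.
Context {R : realType}.
Notation mu := (@lebesgue_measure R).
Implicit Types (k v p q t x N : R) (z w : R[i]) (F : R[i] -> R[i]).

Lemma re_mk x v : reC (x +i* v) = x. Proof. by []. Qed.
Lemma im_mk x v : imC (x +i* v) = v. Proof. by []. Qed.

Lemma reB z w : reC (z - w) = reC z - reC w. Proof. by rewrite reD reN. Qed.
Lemma imB z w : imC (z - w) = imC z - imC w. Proof. by rewrite imD imN. Qed.

(** With slope k e, e = 1 or e = -1, the boundary line carries the ray from p in the direction k + i
    e. The region to the left of both rays is the union of two such half-planes; each is convex, the
    union is not. *)
Definition half_plane k p : set R[i] := [set z | reC z <= p + k * imC z].

Lemma convexC_half_plane k p : convexC (half_plane k p).
Proof.
move=> a b t; rewrite /half_plane/= => ha hb /andP[t0 t1].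
rewrite !reimE.
have -> : reC a + t * (reC b - reC a) = (1 - t) * reC a + t * reC b by ring.
have -> : p + k * (imC a + t * (imC b - imC a)) =
  (1 - t) * (p + k * imC a) + t * (p + k * imC b) by ring.
by apply: lerD; apply: ler_wpM2l => //; rewrite subr_ge0.
Qed.

Lemma closedC_half_plane k p : closedC (half_plane k p).
Proof.
move=> z h; rewrite /half_plane/=; apply/ler_addgt0Pr => e e0.
have k0 : 0 < 1 + `|k| by rewrite ltr_pwDl.
have [w /= wU wz] := h (e / (1 + `|k|)) (divr_gt0 e0 k0).
rewrite /half_plane/= in wU.
have h1 := cmod_re (w - z); have h2 := cmod_im (w - z).
rewrite !reimE in h1 h2.
have h3 : `|k * (imC w - imC z)| <= `|k| * cmod (w - z).
  by rewrite normrM ler_wpM2l.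
have h4 : (1 + `|k|) * cmod (w - z) < e by rewrite mulrC -ltr_pdivlMr.
have h5 := ler_norm (k * (imC w - imC z)).
have h6 := ler_norm (- (reC w - reC z)); rewrite normrN in h6.
lra.
Qed.

(* One half of the contour: the segment from [0] to [e i N] is replaced by
   the polygonal line [0, v, v + N (k e + e i), e i N], where [e = 1] or
   [e = -1]. *)
Lemma half_contour F (B : R -> R) (k e v N K : R) : 0 <= k <= 1 -> e ^+ 2 = 1 ->
  0 <= v -> 0 < N ->
  holomorphic_on (half_plane (k * e) v) F ->
  mu.-integrable `[0, N] (EFin \o B) ->
  (forall t, 0 <= t <= N -> cmod (F (v%:C + t%:C * (k +i* e))) <= B t) ->
  (forall x, 0 <= x <= v + k * N -> cmod (F (x +i* (e * N))) <= K) ->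
  cmod (('i * e%:C) * cint mu `[0, N] (fun t => F (0 +i* (e * t))) - seg F 0 v%:C) <=
  4 * \int[mu]_(t in `[0, N]) B t + 2 * K * (v + k * N).
Proof.
move=> /andP[k0 k1] e2 v0 N0 hF iB hB hK.
set U := half_plane (k * e) v in hF.
have cU : convexC U by exact: convexC_half_plane.
have clU : closedC U by exact: closedC_half_plane.
have cF := holomorphic_continuousC hF.
have kN : 0 <= k * N by rewrite mulr_ge0// ltW.
have U0 : U 0 by rewrite /U/half_plane/= mulr0 addr0.
have Uv : U v%:C by rewrite /U/half_plane/= mulr0 addr0.
have ee x : k * e * (e * x) = k * x.
  by rewrite -[RHS]mulr1 -e2; ring.
have Ux x : x <= v + k * N -> U (x +i* (e * N)).
  by move=> h; rewrite /U/half_plane/= ee.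
pose c : R[i] := (v + k * N) +i* (e * N).
pose d : R[i] := 0 +i* (e * N).
have Uc : U c by apply: Ux.
have Ud : U d by apply: Ux; rewrite addr_ge0.
have := Cauchy_quadrilateral cU clU hF U0 Uv Uc Ud.
rewrite (seg_rev cU cF U0 Ud).
have -> : seg F 0 d = ('i * e%:C) * cint mu `[0, N] (fun t => F (0 +i* (e * t))).
  have E t : 0 + t%:C * ('i * e%:C) = 0 +i* (e * t) :> R[i].
    apply: complex_eq; first by rewrite !reimE mulr0 mul0r subrr mulr0 addr0.
    by rewrite !reimE im_mk; ring.
  have := @seg_line _ U F 0 ('i * e%:C) 0 N N0 cF.
  rewrite !E mulr0.
  move=> -> //.
    by congr (_ * _); apply: eq_cint => t _; rewrite E.
  by move=> t /andP[t0 tN]; rewrite E /U/half_plane/= ee addr_ge0// mulr_ge0.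
have Ec t : v%:C + t%:C * (k +i* e) = (v + k * t) +i* (e * t) :> R[i].
  apply: complex_eq; first by rewrite [RHS]re_mk !reimE; ring.
  by rewrite [RHS]im_mk !reimE im_mk; ring.
have Ut t : 0 <= t <= N -> U (v%:C + t%:C * (k +i* e)).
  by move=> _; rewrite Ec /U/half_plane/= ee.
have hr : cmod (seg F v%:C c) <= 4 * \int[mu]_(t in `[0, N]) B t.
  have := @seg_line _ U F v%:C (k +i* e) 0 N N0 cF Ut.
  have -> : v%:C + 0%:C * (k +i* e) = v%:C :> R[i].
    by rewrite Ec !mulr0 addr0.
  rewrite Ec -/c => ->; rewrite cmodM.
  have I0 : 0 <= \int[mu]_(t in `[0, N]) B t.
    apply: Rintegral_ge0 => t /=; rewrite in_itv/= => tN.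
    by rewrite (le_trans _ (hB _ tN))// /cmod sqrtr_ge0.
  (* One factor 2 bounds the modulus of k + i e, the other is the constant of [cmod_cint_le]. *)
  have -> : 4 * \int[mu]_(t in `[0, N]) B t = 2 * (2 * \int[mu]_(t in `[0, N]) B t).
    by ring.
  apply: ler_pM; rewrite ?/cmod ?sqrtr_ge0//.
    rewrite -/(cmod _) (le_trans (cmod_le_reim _))//=.
    have : `|e| = 1.
      by apply/eqP; rewrite -sqrp_eq1// real_normK ?num_real// e2.
    by move=> ->; rewrite ger0_norm//; lra.
  rewrite -/(cmod _); apply: cmod_cint_le => //.
  apply: continuous_cintegrable; exact: (continuous_on_line cF).
have hh : cmod (seg F c d) <= 2 * K * (v + k * N).
  have -> : v + k * N = cmod (d - c).
    rewrite (_ : d - c = (- (v + k * N))%:C).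
      by rewrite cmod_real normrN ger0_norm// addr_ge0.
    by apply: complex_eq; rewrite /c /d ?reB ?imB ?re_mk ?im_mk ?re_real ?im_real; ring.
  apply: (seg_le cU cF Uc Ud) => t /andP[t0 t1].
  have -> : c + t%:C * (d - c) = ((1 - t) * (v + k * N)) +i* (e * N).
    by apply: complex_eq; rewrite /c /d ?(reD, imD) ?(reMr, imMr) ?(reB, imB) ?re_mk
        ?im_mk; ring.
  have v1 : 0 <= v + k * N by exact: addr_ge0.
  have t2 : 0 <= 1 - t by rewrite subr_ge0.
  apply: hK; rewrite mulr_ge0//=; apply: ler_piMl => //.
  by lra.
move=> E.
rewrite [X in cmod X](_ : _ = seg F v%:C c + seg F c d).
  exact: le_trans (cmodD _ _) (lerD hr hh).
by move/eqP: E; rewrite subr_eq0 => /eqP <-; ring.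
Qed.

(** In the difference of the two half contours the segments from 0 to v cancel, and the opposite
    factors i and - i turn the difference of the axis integrals into i times their sum. *)
Theorem contour_bound F (B : R -> R) (k v N K : R) : 0 <= k <= 1 ->
  0 <= v -> 0 < N ->
  (forall e, e ^+ 2 = 1 -> holomorphic_on (half_plane (k * e) v) F) ->
  mu.-integrable `[0, N] (EFin \o B) ->
  (forall e t, e ^+ 2 = 1 -> 0 <= t <= N -> cmod (F (v%:C + t%:C * (k +i* e))) <= B t) ->
  (forall e x, e ^+ 2 = 1 -> 0 <= x <= v + k * N -> cmod (F (x +i* (e * N))) <= K) ->
  cmod (cint mu `[0, N] (fun t => F (0 +i* t) + F (0 +i* - t))) <=
  8 * \int[mu]_(t in `[0, N]) B t + 4 * K * (v + k * N).
Proof.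
move=> k01 v0 N0 hF iB hB hK.
have e1 : (1 : R) ^+ 2 = 1 by rewrite expr1n.
have e2 : (-1 : R) ^+ 2 = 1 by rewrite sqrrN expr1n.
have h1 := half_contour k01 e1 v0 N0 (hF _ e1) iB (hB _ ^~ e1) (hK _ ^~ e1).
have h2 := half_contour k01 e2 v0 N0 (hF _ e2) iB (hB _ ^~ e2) (hK _ ^~ e2).
have ci e : e ^+ 2 = 1 -> cintegrable mu `[0, N] (fun t => F (0 +i* (e * t))).
  move=> ee; apply: continuous_cintegrable.
  have E t : 0 + t%:C * ('i * e%:C) = 0 +i* (e * t) :> R[i].
    apply: complex_eq; first by rewrite !reimE mulr0 mul0r subrr mulr0 addr0.
    by rewrite !reimE im_mk; ring.
  have : {within `[0, N], continuous (fun t : R => F (0 + t%:C * ('i * e%:C)) : R[i]^o)}.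
    apply: (continuous_on_line (holomorphic_continuousC (hF _ ee))) => t /andP[t0 tN].
    rewrite E /half_plane/=.
    have -> : k * e * (e * t) = k * t by rewrite -[RHS]mulr1 -ee; ring.
    by rewrite addr_ge0// mulr_ge0//; case/andP: k01.
  by rewrite (_ : (fun t : R => F (0 +i* (e * t))) = (fun t : R => F (0 + t%:C * ('i *
      e%:C))))//; apply/funext => t; rewrite E.
have -> : cint mu `[0, N] (fun t => F (0 +i* t) + F (0 +i* - t)) =
  cint mu `[0, N] (fun t => F (0 +i* (1 * t))) +
  cint mu `[0, N] (fun t => F (0 +i* (- 1 * t))).
  rewrite -cintD//; [|exact: ci|exact: ci].
  by apply: eq_cint => t _; rewrite mul1r mulN1r.
set X := cint _ _ _ in h1 *; set Y := cint _ _ _ in h2 *.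
have -> : cmod (X + Y) = cmod (('i * 1%:C * X - seg F 0 v%:C) - ('i * (-1)%:C * Y - seg
    F 0 v%:C)).
  have -> : 'i * 1%:C * X - seg F 0 v%:C - ('i * (-1)%:C * Y - seg F 0 v%:C) = 'i * (X + Y).
    have -> : (-1)%:C = - 1 :> R[i] by apply: complex_eq; rewrite /= ?oppr0.
    have -> : 1%:C = 1 :> R[i] by [].
    by ring.
  rewrite cmodM.
  have -> : cmod ('i : R[i]) = 1 by rewrite /cmod/= expr0n expr1n add0r sqrtr1.
  by rewrite mul1r.
apply: (le_trans (cmodB _ _)); apply: (le_trans (lerD h1 h2)).
by rewrite le_eqVlt; apply/orP; left; apply/eqP; ring.
Qed.

End Contour.

(** * Bounds for the Gaussian-damped integrand on the contour *)

Section GaussianContour.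
Context {R : realType}.
Notation mu := (@lebesgue_measure R).
Implicit Types (k v p q t x N s u m : R) (z w : R[i]) (H : R[i] -> R[i]).

Lemma integral_linear_exp_le p q m N : 0 <= p -> 0 <= q -> 0 < m -> 0 < N ->
  mu.-integrable `[0, N] (EFin \o (fun t => (p + q * t) * expR (- m * t))) /\
  \int[mu]_(t in `[0, N]) ((p + q * t) * expR (- m * t)) <= p / m + q / m ^+ 2.
Proof.
move=> p0 q0 m0 N0.
have m1 : m != 0 by rewrite gt_eqF.
pose h t := (p + q * t) * expR (- m * t).
have ch : continuous h.
  move=> t; apply: cvgM; last exact: continuous_expRM.
  by apply: cvgD; [exact: cvg_cst|apply: cvgM; [exact: cvg_cst|exact: cvg_id]].
split.
  apply: continuous_compact_integrable; first exact: segment_compact.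
  exact: continuous_subspaceT.
pose P t := - ((p / m + q / m ^+ 2 + q / m * t) * expR (- m * t)).
have dP t : is_derive t (1 : R) P (h t).
  have d1 := is_derive_expRM (- m) t.
  have d : is_derive t (1 : R) P
      (- ((p / m + q / m ^+ 2 + q / m * t) * (- m * expR (- m * t)) +
          expR (- m * t) * (q / m))).
    by apply: is_derive_eq; rewrite /GRing.scale/=; ring.
  by apply: (is_derive_eq d); rewrite /h; field.
have -> : \int[mu]_(t in `[0, N]) h t = P N - P 0.
  by apply: Rintegral_FTC => // x _; exact: ch.
rewrite /P !mulr0 addr0 expR0 mulr1 opprK addrC gerDl oppr_le0.
have m2 := ltW m0.
have m3 : 0 <= m ^+ 2 by rewrite exprn_ge0.
apply: mulr_ge0; last exact: expR_ge0.
apply: addr_ge0; first by rewrite addr_ge0 ?divr_ge0.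
by rewrite mulr_ge0 ?divr_ge0 ?(ltW N0).
Qed.

(** On the imaginary axis, z = i t, the exponential is [gauss_kernel s t] times e^(- i u t): the
    inversion integrand, continued analytically. *)
Definition gauss_twist H s u z : R[i] :=
  H z * cexp ((s ^+ 2 / 2)%:C * (z * z) - u%:C * z).

Lemma cmod_gauss_twist H s u z : cmod (gauss_twist H s u z) =
  cmod (H z) * expR (s ^+ 2 / 2 * (reC z ^+ 2 - imC z ^+ 2) - u * reC z).
Proof.
rewrite /gauss_twist cmodM cmod_cexp; congr (_ * expR _).
by rewrite reB !reMr reM.
Qed.

Lemma holomorphic_gauss_twist H s u (U : set R[i]) : holomorphic_on U H ->
  holomorphic_on U (gauss_twist H s u).
Proof.
move=> hH z Uz; apply: derivableMC; first exact: hH.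
apply: (@derivable_compC _ (fun z => (s ^+ 2 / 2)%:C * (z * z) - u%:C * z)).
  apply: (@derivableBC _ (fun z => (s ^+ 2 / 2)%:C * (z * z)) (fun z => u%:C * z)).
    apply: (@derivableMC _ (fun=> (s ^+ 2 / 2)%:C) (fun z => z * z)).
      exact: derivable_cstC.
    by apply: (@derivableMC _ (fun z => z) (fun z => z)); exact: derivable_idC.
  apply: (@derivableMC _ (fun=> u%:C) (fun z => z)); first exact: derivable_cstC.
  exact: derivable_idC.
exact: derivable_cexp.
Qed.

(** The contribution of the rays is bounded independently of [s]. Only the horizontal sides,
    collected in [e_], depend on [s]; for fixed [s] they vanish as their height n + 1 grows. *)
Theorem gauss_contour H (k v s u p q C : R) : 0 < k <= 1 / 2 -> 0 <= v -> 0 < s <= 1 ->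
  0 < u -> 0 <= p -> 0 <= q -> 0 <= C ->
  (forall e, e ^+ 2 = 1 -> holomorphic_on (half_plane (k * e) v) H) ->
  (forall e t, e ^+ 2 = 1 -> 0 <= t ->
     cmod (H (v%:C + t%:C * (k +i* e))) <= p + q * t) ->
  (forall z, 0 <= reC z <= v + k * `|imC z| -> 1 <= `|imC z| ->
     cmod (H z) <= C * `|imC z|) ->
  exists e_ : nat -> R, e_ n @[n --> \oo] --> (0 : R) /\
  forall n, cmod (cint mu `[0, n.+1%:R] (fun t =>
      gauss_twist H s u (0 +i* t) + gauss_twist H s u (0 +i* - t))) <=
    8 * (expR (v ^+ 2) * expR (- v * u) * (p / (k * u) + q / (k * u) ^+ 2)) + e_ n.
Proof.
move=> /andP[k0 k2] v0 /andP[s0 s1] u0 p0 q0 C0 hH hray hhor.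
have s2 : 0 < s ^+ 2 by rewrite exprn_gt0.
have s21 : s ^+ 2 <= 1 by rewrite expr_le1// ltW.
have ku : 0 < k * u by exact: mulr_gt0.
(* At height N and abscissa at most v + N / 2 one has x^2 - N^2 <= 2 v^2 - N^2 / 2; multiplied by
   s^2 / 2 this leaves the rate s^2 / 4. *)
pose a := s ^+ 2 / 4.
pose e_ (n : nat) : R := 4 * (C * (v + 1) * expR (v ^+ 2)) *
  (n.+1%:R `^ 2 * expR (- a * n.+1%:R)).
exists e_; split.
  have a0 : 0 < a by rewrite /a divr_gt0.
  have [h _] := @powR_expR_cvg0 R 2 a (ltr0n R 2) a0.
  rewrite -(mulr0 (4 * (C * (v + 1) * expR (v ^+ 2)))).
  by apply: cvgM => //; exact: cvg_cst.
move=> n; set N : R := n.+1%:R.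
have N1 : 1 <= N by rewrite ler1n.
have N0 : 0 < N by exact: lt_le_trans N1.
have e2 e : e ^+ 2 = 1 -> `|e| = 1.
  move=> h; have /eqP : `|e| ^+ 2 = 1 by rewrite -normrX h normr1.
  by rewrite sqrp_eq1// => /eqP.
have [iB IB] := integral_linear_exp_le p0 q0 ku N0.
pose A := expR (v ^+ 2) * expR (- v * u).
pose B t := A * ((p + q * t) * expR (- (k * u) * t)).
pose K := C * N * expR (v ^+ 2 - a * N).
have A0 : 0 <= A by rewrite mulr_ge0 ?expR_ge0.
have K0 : 0 <= K by rewrite !mulr_ge0 ?expR_ge0// ltW.
apply: (@le_trans _ _ (8 * \int[mu]_(t in `[0, N]) B t + 4 * K * (v + k * N))).
  apply: (@contour_bound _ (gauss_twist H s u) B k v N K).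
  - by rewrite (ltW k0)/=; lra.
  - exact: v0.
  - exact: N0.
  - by move=> e ee; apply: holomorphic_gauss_twist; exact: hH.
  - exact: integrable_realZ.
  - move=> e t ee /andP[t0 tN]; rewrite cmod_gauss_twist /B.
    rewrite mulrCA; apply: ler_pM; rewrite ?cmod_ge0 ?expR_ge0//; first exact: hray.
    rewrite /A -!expRD ler_expR.
    have -> : reC (v%:C + t%:C * (k +i* e)) = v + t * k by rewrite !reimE.
    have -> : imC (v%:C + t%:C * (k +i* e)) = t * e by rewrite imD imMr im_real add0r.
    have -> : (t * e) ^+ 2 = t ^+ 2 by rewrite exprMn ee mulr1.
    (* With k <= 1 / 2 the square (v + t k)^2 is at most 2 v^2 + t^2 / 2; for s <= 1 the Gaussian
       factor on the ray is therefore at most exp (v^2). *)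
    have h1 : (v + t * k) ^+ 2 - t ^+ 2 <= 2 * v ^+ 2.
      have := sqr_ge0 (v - t * k).
      have : (t * k) ^+ 2 <= t ^+ 2 / 4.
        rewrite exprMn; have : k ^+ 2 <= 1 / 4 by nra.
        by have := sqr_ge0 t; nra.
      nra.
    have h2 : s ^+ 2 / 2 * ((v + t * k) ^+ 2 - t ^+ 2) <= v ^+ 2.
      have := ler_wpM2l (ltW s2) h1; have := sqr_ge0 v; nra.
    nra.
  - move=> e x ee /andP[x0 xv]; rewrite cmod_gauss_twist re_mk im_mk /K.
    have eN : `|e * N| = N by rewrite normrM e2// mul1r gtr0_norm.
    apply: ler_pM; rewrite ?cmod_ge0 ?expR_ge0//.
      have := hhor (x +i* (e * N)); rewrite re_mk im_mk eN; apply => //.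
      by rewrite x0 xv.
    rewrite ler_expR exprMn ee mul1r.
    have h1 : x ^+ 2 <= 2 * v ^+ 2 + N ^+ 2 / 2.
      have : x ^+ 2 <= (v + N / 2) ^+ 2.
        have : x <= v + N / 2 by nra.
        by move=> h; rewrite ler_sqr// nnegrE//; lra.
      have := sqr_ge0 (v - N / 2); nra.
    have h2 : s ^+ 2 / 2 * (x ^+ 2 - N ^+ 2) <= v ^+ 2 - a * N ^+ 2.
      have h3 : x ^+ 2 - N ^+ 2 <= 2 * v ^+ 2 - N ^+ 2 / 2 by lra.
      have := ler_wpM2l (ltW s2) h3; rewrite /a; have := sqr_ge0 v; nra.
    have : a * N <= a * N ^+ 2.
      by rewrite ler_wpM2l ?/a ?divr_ge0 ?(ltW s2)//; nra.
    have : 0 <= u * x by rewrite mulr_ge0// ltW.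
    lra.
apply: lerD.
  rewrite ler_pM2l// RintegralZl// ler_wpM2l//.
have -> : e_ n = 4 * K * ((v + 1) * N).
  rewrite /e_ /K -/N powR_mulrn ?(ltW N0)// expRD mulNr; ring.
apply: ler_wpM2l; first by rewrite mulr_ge0.
nra.
Qed.

End GaussianContour.

(** * Characteristic functions and smoothed densities of weighted measures *)

Section CharacteristicFunction.
Context {R : realType} (m : {sigma_finite_measure set (measurableTypeR R) -> \bar R}).
Notation mu := (@lebesgue_measure R).
Implicit Types (s t u y : R) (w : R -> R).

Definition char_fun w t : R[i] :=
  cint m setT (fun y => (w y)%:C * cexp ((0 +i* t) * y%:C)).

(** The density at [u] of the measure w m convolved with the centred normal law of deviation [s]. *)
Definition smooth_density w s u : R := \int[m]_y (normal_pdf u s y * w y).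

Lemma integrable_bounded_mul w (f : R -> R) : m.-integrable setT (EFin \o w) ->
  measurable_fun setT (f : measurableTypeR R -> R) -> (forall y, `|f y| <= 1) ->
  m.-integrable setT (EFin \o (fun y => w y * f y)).
Proof.
move=> iw mf f1.
have mw : measurable_fun setT w by have /integrableP[/measurable_EFinP] := iw.
apply: (le_integrable _ _ _ iw) => //.
  by apply/measurable_EFinP; exact: measurable_funM.
by move=> y _; rewrite /= lee_fin normrM ler_piMr.
Qed.

Lemma integrable_cos_mul w t u : m.-integrable setT (EFin \o w) ->
  m.-integrable setT (EFin \o (fun y => w y * cos (t * (y - u)))) /\
  m.-integrable setT (EFin \o (fun y => w y * sin (t * (y - u)))).
Proof.
move=> iw.
have mf : measurable_fun setT (fun y : measurableTypeR R => t * (y - u)).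
  by apply: measurable_funM => //; exact: measurable_funB.
split; (apply: integrable_bounded_mul; first exact: iw).
- by apply: measurableT_comp mf; exact: continuous_measurable_fun (@continuous_cos R).
- by move=> y; exact: cos_max.
- by apply: measurableT_comp mf; exact: continuous_measurable_fun (@continuous_sin R).
- by move=> y; exact: sin_max.
Qed.

Lemma cexp_shift t u y :
  cexp ((0 +i* t) * y%:C) * cexp (- (u%:C * (0 +i* t))) =
  cos (t * (y - u)) +i* sin (t * (y - u)).
Proof.
rewrite -cexpD.
have -> : (0 +i* t) * y%:C - u%:C * (0 +i* t) = (0 +i* t) * (y - u)%:C :> R[i].
  have -> : (y - u)%:C = y%:C - u%:C :> R[i].
    by apply: complex_eq; rewrite ?reB ?imB ?re_real ?im_real ?subr0.
  by ring.
exact: cexp_imag.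
Qed.

Lemma cintegrable_char w t : m.-integrable setT (EFin \o w) ->
  cintegrable m setT (fun y => (w y)%:C * cexp ((0 +i* t) * y%:C)).
Proof.
move=> iw; have [h1 h2] := integrable_cos_mul t 0 iw.
have H : cintegrable m setT (fun y => (w y * cos (t * (y - 0))) +i* (w y * sin (t * (y - 0)))).
  by split.
apply: eq_cintegrable H => // y _.
by rewrite subr0 cexp_imag; apply: complex_eq; rewrite ?reMr ?imMr.
Qed.

(** For a real weight the two terms are complex conjugates, so their sum is twice the cosine
    integral occurring in [gauss_smoothing]. *)
Lemma char_fun_pair w t u : m.-integrable setT (EFin \o w) ->
  char_fun w t * cexp (- (u%:C * (0 +i* t))) +
  char_fun w (- t) * cexp (- (u%:C * (0 +i* - t))) =
  (2 * \int[m]_y (cos (t * (y - u)) * w y))%:C.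
Proof.
move=> iw.
have [h1 h2] := integrable_cos_mul t u iw.
have [h3 h4] := integrable_cos_mul (- t) u iw.
have E r : char_fun w r * cexp (- (u%:C * (0 +i* r))) =
    (\int[m]_y (w y * cos (r * (y - u)))) +i* (\int[m]_y (w y * sin (r * (y - u)))).
  rewrite mulrC /char_fun -cintZ//; last exact: cintegrable_char.
  rewrite /cint; congr (_ +i* _); apply: eq_Rintegral => y _;
    by rewrite mulrCA [cexp (- _) * _]mulrC cexp_shift ?reMr ?imMr.
rewrite !E; apply: complex_eq.
  rewrite [RHS]re_real reD !re_mk.
  have -> : \int[m]_y (w y * cos (- t * (y - u))) = \int[m]_y (w y * cos (t * (y - u))).
    by apply: eq_Rintegral => y _; rewrite mulNr cosN.
  have -> : \int[m]_y (cos (t * (y - u)) * w y) = \int[m]_y (w y * cos (t * (y - u))).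
    by apply: eq_Rintegral => y _; rewrite mulrC.
  by ring.
rewrite [RHS]im_real imD !im_mk.
have -> : \int[m]_y (w y * sin (- t * (y - u))) = \int[m]_y (- 1 * (w y * sin (t * (y - u)))).
  by apply: eq_Rintegral => y _; rewrite [- t * _]mulNr sinN; ring.
by rewrite RintegralZl//; ring.
Qed.

End CharacteristicFunction.

(** * From the contour estimate to the smoothed densities *)

Section ContourToDensity.
Context {R : realType} (m : {sigma_finite_measure set (measurableTypeR R) -> \bar R}).
Notation mu := (@lebesgue_measure R).
Implicit Types (s t u k v p q C : R) (z : R[i]) (H : R[i] -> R[i]).

Lemma gauss_twist_imag H s u t : gauss_twist H s u (0 +i* t) =
  (gauss_kernel s t)%:C * (H (0 +i* t) * cexp (- (u%:C * (0 +i* t)))).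
Proof.
rewrite /gauss_twist cexpD mulrCA; congr (_ * _).
have -> : (s ^+ 2 / 2)%:C * ((0 +i* t) * (0 +i* t)) = (- (s ^+ 2 * t ^+ 2 / 2))%:C :> R[i].
  apply: complex_eq; rewrite ?reMr ?imMr ?(reM, imM) ?re_mk ?im_mk ?re_real ?im_real.
    by rewrite mul0r sub0r; ring.
  by rewrite mulr0 mul0r addr0 mulr0.
exact: cexp_real.
Qed.

Lemma cvg_realC (T : Type) (F : set_system T) (FF : Filter F) (f : T -> R) (l : R) :
  f x @[x --> F] --> l -> ((f x)%:C : R[i]^o) @[x --> F] --> (l%:C : R[i]^o).
Proof. by move=> fl; apply: cvg_complexP => //=; exact: cvg_cst. Qed.

(** As the truncation grows, the axis integral tends to 2 pi times the combination of smoothed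
    densities by Fourier inversion, while the horizontal sides of [gauss_contour] disappear. *)
Theorem smooth_density_bound H (w w1 w2 : R -> R) (b c : R[i]) (k v s u p q C : R) :
  m.-integrable setT (EFin \o w) -> mu.-integrable setT (EFin \o w1) ->
  mu.-integrable setT (EFin \o w2) ->
  (forall t, H (0 +i* t) =
    char_fun m w t - b * char_fun mu w1 t - c * char_fun mu w2 t) ->
  0 < k <= 1 / 2 -> 0 <= v -> 0 < s <= 1 -> 0 < u -> 0 <= p -> 0 <= q -> 0 <= C ->
  (forall e, e ^+ 2 = 1 -> holomorphic_on (half_plane (k * e) v) H) ->
  (forall e t, e ^+ 2 = 1 -> 0 <= t ->
     cmod (H (v%:C + t%:C * (k +i* e))) <= p + q * t) ->
  (forall z, 0 <= reC z <= v + k * `|imC z| -> 1 <= `|imC z| ->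
     cmod (H z) <= C * `|imC z|) ->
  cmod ((smooth_density m w s u)%:C - b * (smooth_density mu w1 s u)%:C -
    c * (smooth_density mu w2 s u)%:C) <=
  8 * (expR (v ^+ 2) * expR (- v * u) * (p / (k * u) + q / (k * u) ^+ 2)).
Proof.
move=> iw iw1 iw2 HE k0 v0 s01 u0 p0 q0 C0 hH hray hhor.
have s0 : 0 < s by case/andP: s01.
have [e_ [e0 he]] := gauss_contour k0 v0 s01 u0 p0 q0 C0 hH hray hhor.
set E := 8 * _ in he *; set D := _ - c * _.
pose I (m' : {sigma_finite_measure set (measurableTypeR R) -> \bar R}) (w' : R -> R) (n
    : nat) : R :=
  \int[mu]_(t in `[0%R, n.+1%:R]) (gauss_kernel s t * \int[m']_y (cos (t * (y - u)) * w' y)).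
have cI (m' : {sigma_finite_measure set (measurableTypeR R) -> \bar R}) (w' : R -> R) :
    m'.-integrable setT (EFin \o w') ->
    I m' w' n @[n --> \oo] --> pi * smooth_density m' w' s u.
  move=> iw'; have := @gauss_smoothing R m' w' s u s0 iw'.
  (* [gauss_smoothing] truncates at n, the contour at n + 1 so that its height is positive. *)
  by rewrite -(cvg_shiftS _).
pose X n := 2%:C * ((I m w n)%:C - b * (I mu w1 n)%:C - c * (I mu w2 n)%:C).
have EX n : cint mu `[0, n.+1%:R] (fun t =>
      gauss_twist H s u (0 +i* t) + gauss_twist H s u (0 +i* - t)) = X n.
  pose G (m' : {sigma_finite_measure set (measurableTypeR R) -> \bar R}) (w' : R -> R) t : R :=
    gauss_kernel s t * \int[m']_y (cos (t * (y - u)) * w' y).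
  have iG (m' : {sigma_finite_measure set (measurableTypeR R) -> \bar R}) (w' : R -> R)
      : m'.-integrable setT (EFin \o w') ->
      cintegrable mu `[0%R, n.+1%:R] (fun t => (G m' w' t)%:C).
    by move=> iw'; apply: cintegrable_real => //; exact: integrable_gauss_cos.
  rewrite (_ : cint _ _ _ = cint mu `[0%R, n.+1%:R] (fun t => 2%:C * ((G m w t)%:C - b
      * (G mu w1 t)%:C - c * (G mu w2 t)%:C))).
    have i1 := iG _ _ iw; have i2 := iG _ _ iw1; have i3 := iG _ _ iw2.
    have j2 : cintegrable mu `[0%R, n.+1%:R] (fun t => b * (G mu w1 t)%:C).
      exact: cintegrableZ.
    have j3 : cintegrable mu `[0%R, n.+1%:R] (fun t => c * (G mu w2 t)%:C).
      exact: cintegrableZ.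
    have j12 : cintegrable mu `[0%R, n.+1%:R] (fun t => (G m w t)%:C - b * (G mu w1 t)%:C).
      exact: cintegrableB.
    rewrite cintZ//; last exact: cintegrableB.
    by rewrite cintB// cintB// !cintZ// !cint_real.
  apply: eq_cint => t _; rewrite !gauss_twist_imag.
  have -> : gauss_kernel s (- t) = gauss_kernel s t by rewrite /gauss_kernel sqrrN.
  rewrite !HE -mulrDr.
  have P1 := char_fun_pair t u iw; have P2 := char_fun_pair t u iw1.
  have P3 := char_fun_pair t u iw2.
  set x1 := cexp _ in P1 P2 P3 *; set x2 := cexp _ in P1 P2 P3 *.
  have cM (r1 r2 : R) : (r1 * r2)%:C = r1%:C * r2%:C :> R[i].
    by apply: complex_eq; rewrite ?reMr ?imMr// mulr0.
  rewrite /G !cM in P1 P2 P3 *.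
  set d1 := char_fun m w t in P1 *; set d1' := char_fun m w (- t) in P1 *.
  set d2 := char_fun mu w1 t in P2 *; set d2' := char_fun mu w1 (- t) in P2 *.
  set d3 := char_fun mu w2 t in P3 *; set d3' := char_fun mu w2 (- t) in P3 *.
  rewrite [LHS](_ : _ = (gauss_kernel s t)%:C * ((d1 * x1 + d1' * x2) -
    b * (d2 * x1 + d2' * x2) - c * (d3 * x1 + d3' * x2))); last by ring.
  by rewrite P1 P2 P3; ring.
have cX : (X n : R[i]^o) @[n --> \oo] --> (2%:C * (pi%:C * D) : R[i]^o).
  apply: cvgC_mull.
  have -> : pi%:C * D = (pi * smooth_density m w s u)%:C - b * (pi * smooth_density mu
      w1 s u)%:C -
      c * (pi * smooth_density mu w2 s u)%:C.
    have cM (r1 r2 : R) : (r1 * r2)%:C = r1%:C * r2%:C :> R[i].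
      by apply: complex_eq; rewrite ?reMr ?imMr// mulr0.
    by rewrite /D !cM; ring.
  apply: cvgC_sub; first apply: cvgC_sub; try apply: cvgC_mull; apply: cvg_realC; exact: cI.
have cX2 : cmod (X n) @[n --> \oo] --> cmod (2%:C * (pi%:C * D)).
  exact: (cvg_comp _ _ cX (@continuous_cmod R _)).
have : cmod (2%:C * (pi%:C * D)) <= E.
  have cE : E + e_ n @[n --> \oo] --> E + 0 by apply: cvgD => //; exact: cvg_cst.
  rewrite -[leRHS]addr0; apply: (ler_cvg_to cX2 cE).
  by near=> n; rewrite -EX.
(* The factor 2 pi is at least 1 and is simply given away. *)
rewrite !cmodM !cmod_real !ger0_norm ?pi_ge0// => h.
have := pi_ge2 R; have := cmod_ge0 D; nra.
Unshelve. all: by end_near. Qed.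

End ContourToDensity.

(** * Concentration of the normal law *)

Section NormalWindow.
Context {R : realType}.
Notation mu := (@lebesgue_measure R).
Implicit Types (s t u x y d p q : R).

Lemma normal_pdf_sym u s y : s != 0 -> normal_pdf u s y = normal_pdf y s u.
Proof.
by move=> s0; rewrite !normal_pdfE2// -[in RHS]opprB sqrrN.
Qed.

(* A normal law of deviation [s] is compared with the one of deviation [2 s]:
   away from the mean their densities have a small quotient. *)
Lemma normal_far (A : set R) y s d : 0 < s -> 0 < d ->
  measurable (A : set (measurableTypeR R)) -> (forall u, A u -> d <= `|u - y|) ->
  \int[mu]_(u in A) normal_pdf u s y <= 6 * (s ^+ 2 / d ^+ 2).
Proof.
move=> s0 d0 mA Ad.
have sn : s != 0 by rewrite gt_eqF.
have s2 : 0 < 2 * s by rewrite mulr_gt0.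
have s2n : 2 * s != 0 by rewrite gt_eqF.
have d2 : 0 < d ^+ 2 by rewrite exprn_gt0.
have ss : 0 < s ^+ 2 by rewrite exprn_gt0.
have pk : normal_peak s = 2 * normal_peak (2 * s).
  rewrite /normal_peak.
  have -> : (2 * s) ^+ 2 * pi *+ 2 = 2 ^+ 2 * (s ^+ 2 * pi *+ 2) :> R by ring.
  by rewrite sqrtrM ?exprn_ge0// sqrtr_sqr ger0_norm// invfM mulrA divff// mul1r.
have i1 : mu.-integrable A (EFin \o (fun u => normal_pdf u s y)).
  apply: (@integrableS _ _ _ mu setT) => //.
  have := @integrable_normal_pdf R y s; apply: eq_integrable => // u _.
  by rewrite /= normal_pdf_sym.
have i2 : mu.-integrable setT (EFin \o normal_pdf y (2 * s)).
  exact: integrable_normal_pdf.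
have i3 : mu.-integrable A (EFin \o normal_pdf y (2 * s)).
  exact: (@integrableS _ _ _ mu setT).
apply: (@le_trans _ _ (\int[mu]_(u in A) (6 * (s ^+ 2 / d ^+ 2) * normal_pdf y (2 * s) u))).
  apply: le_Rintegral => //; first exact: integrable_realZ.
  move=> u Au; rewrite !normal_pdfE2// pk.
  set r := (y - u) ^+ 2.
  have dr : d ^+ 2 <= r.
    rewrite /r -[leRHS]real_normK ?num_real// distrC ler_sqr ?nnegrE ?(ltW d0)//.
    exact: Ad.
  have -> : expR (- (r / (2 * s ^+ 2))) =
      expR (- (3 * r / (8 * s ^+ 2))) * expR (- (r / (2 * (2 * s) ^+ 2))).
    by rewrite -expRD; congr expR; field.
  have -> : (u - y) ^+ 2 = r by rewrite /r -[in RHS]opprB sqrrN.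
  (* The inequality exp (- z) <= 1 / z at z = 3 d^2 / (8 s^2) gives 8 / 3, rounded up to 3; the
     quotient 2 of the peaks then makes the 6. *)
  have h : expR (- (3 * r / (8 * s ^+ 2))) <= 3 * (s ^+ 2 / d ^+ 2).
    rewrite expRN.
    have z0 : 0 < 3 * d ^+ 2 / (8 * s ^+ 2) by rewrite divr_gt0 ?mulr_gt0.
    have h1 : 3 * d ^+ 2 / (8 * s ^+ 2) <= expR (3 * r / (8 * s ^+ 2)).
      apply: (@le_trans _ _ (3 * r / (8 * s ^+ 2))).
        by rewrite ler_pM2r ?invr_gt0 ?mulr_gt0// ler_pM2l.
      by rewrite (le_trans _ (expR_ge1Dx _))// lerDr.
    apply: (@le_trans _ _ (3 * d ^+ 2 / (8 * s ^+ 2))^-1).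
      by rewrite lef_pV2// posrE// expR_gt0.
    have -> : (3 * d ^+ 2 / (8 * s ^+ 2))^-1 = 8 / 3 * (s ^+ 2 / d ^+ 2).
      by field; rewrite ?gt_eqF.
    rewrite ler_wpM2r ?divr_ge0 ?ltW//; lra.
  have pk0 : 0 <= normal_peak (2 * s) by exact: normal_peak_ge0.
  have e0 := expR_ge0 (- (r / (2 * (2 * s) ^+ 2))).
  have := mulr_ge0 pk0 e0; set P := normal_peak _ * _ => P0.
  have -> : 2 * normal_peak (2 * s) * (expR (- (3 * r / (8 * s ^+ 2))) *
    expR (- (r / (2 * (2 * s) ^+ 2)))) = (2 * expR (- (3 * r / (8 * s ^+ 2)))) * P.
    by rewrite /P; ring.
  by apply: ler_wpM2r => //; lra.
rewrite RintegralZl//.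
have c0 : 0 <= 6 * (s ^+ 2 / d ^+ 2) by apply: mulr_ge0 => //; apply: divr_ge0; exact: ltW.
rewrite -[leRHS]mulr1; apply: ler_wpM2l => //.
rewrite /Rintegral -lee_fin fineK; last exact: integrable_fin_num.
rewrite -(@integral_normal_pdf R y (2 * s))//.
apply: ge0_subset_integral => //; first by apply/measurable_EFinP; exact: measurable_normal_pdf.
by move=> u _; rewrite lee_fin normal_pdf_ge0.
Qed.

(** The normal density is symmetric in mean and argument, so this is the mass that the normal law
    centred at [y] gives to [p, q]. *)
Definition normal_window s p q y : R := \int[mu]_(u in `[p, q]) normal_pdf u s y.

Lemma normal_window_bounds s p q y : s != 0 -> 0 <= normal_window s p q y <= 1.
Proof.
move=> s0; apply/andP; split.
  by apply: Rintegral_ge0 => u _; exact: normal_pdf_ge0.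
rewrite /normal_window.
under eq_Rintegral do rewrite normal_pdf_sym//.
rewrite /Rintegral -lee_fin fineK; last first.
  apply: integrable_fin_num => //.
  apply: (@integrableS _ _ _ mu setT) => //; exact: integrable_normal_pdf.
rewrite -(@integral_normal_pdf R y s)//.
apply: ge0_subset_integral => //; first by apply/measurable_EFinP; exact: measurable_normal_pdf.
by move=> u _; rewrite lee_fin normal_pdf_ge0.
Qed.

Lemma normal_window_compl s p q y : s != 0 ->
  1 - normal_window s p q y = \int[mu]_(u in ~` `[p, q]) normal_pdf u s y.
Proof.
move=> s0.
have iT : mu.-integrable setT (EFin \o (fun u => normal_pdf u s y)).
  have := @integrable_normal_pdf R y s; apply: eq_integrable => // u _.
  by rewrite /= normal_pdf_sym.
have <- : \int[mu]_u normal_pdf u s y = 1.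
  under eq_Rintegral do rewrite normal_pdf_sym//.
  by rewrite /Rintegral integral_normal_pdf.
have mI : measurable (`[p, q]%classic : set (measurableTypeR R)) by exact: measurable_itv.
rewrite -(setUv (`[p, q]%classic : set R)) Rintegral_setU//.
- by rewrite /normal_window addrC addKr.
- exact: measurableC.
- by rewrite setUv.
- by apply/disj_setPS; rewrite setICr.
Qed.

(** The left end exceeds [x] by 1 / (n + 1), which is large compared with the deviation 1 / (n +
    1)^2: the window loses the point y = x itself and converges to the indicator of the open
    half-line, as is necessary when the measure has an atom at [x]. *)
Lemma normal_window_cvg x y :
  normal_window (n.+1%:R ^- 2) (x + n.+1%:R^-1) n.+1%:R y @[n --> \oo] -->
  ((x < y)%R%:R : R).
Proof.
suff [K K0 h] : exists2 K, 0 < K & \forall n \near \oo,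
    `|normal_window (n.+1%:R ^- 2) (x + n.+1%:R^-1) n.+1%:R y - (x < y)%R%:R| <= K * n.+1%:R^-1.
  apply/cvgrPdist_le => e e0; near=> n.
  rewrite distrC (@le_trans _ _ (K * n.+1%:R^-1))//; first by near: n.
  have : n%:R >= K / e by near: n; exact: nbhs_infty_ger.
  rewrite ler_pdivrMr// => h1.
  rewrite ler_pdivrMr ?ltr0n// (le_trans h1)// mulrC ler_pM2l// ler_nat.
  by [].
have N0 n : 0 < n.+1%:R :> R by [].
have S0 n : 0 < n.+1%:R ^- 2 :> R by rewrite invr_gt0 exprn_gt0.
have Sn n : n.+1%:R ^- 2 != 0 :> R by rewrite gt_eqF.
have I1 n : n.+1%:R^-1 <= 1 :> R by rewrite invf_le1// ler1n.
have I0 n : 0 < n.+1%:R^-1 :> R by rewrite invr_gt0.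
have [xy|yx] := ltP x y.
- pose d := (y - x) / 2.
  have d0 : 0 < d by rewrite /d divr_gt0 ?subr_gt0.
  exists (6 / d ^+ 2); first by rewrite divr_gt0 ?exprn_gt0.
  near=> n; rewrite distrC ger0_norm; last first.
    by rewrite subr_ge0; have /andP[] := normal_window_bounds (x + n.+1%:R^-1) n.+1%:R y (Sn n).
  rewrite normal_window_compl//.
  apply: (@le_trans _ _ (6 * ((n.+1%:R ^- 2) ^+ 2 / d ^+ 2))).
    apply: normal_far => //; first by apply: measurableC; exact: measurable_itv.
    move=> u /=; rewrite in_itv/= => /negP; rewrite negb_and -!ltNge => /orP[up|uq].
      have : n.+1%:R^-1 <= d.
        rewrite invf_ple ?posrE//.
        have : d^-1 <= n%:R by near: n; exact: nbhs_infty_ger.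
        by move=> h1; rewrite (le_trans h1)// ler_nat.
      move: up; set r := n.+1%:R^-1 => up rd.
      have dE : d = (y - x) / 2 by [].
      by clearbody d r; rewrite distrC ger0_norm; lra.
    have : y + d <= n.+1%:R.
      have : y + d <= n%:R by near: n; exact: nbhs_infty_ger.
      by move=> h1; rewrite (le_trans h1)// ler_nat.
    by move=> h; rewrite ger0_norm; lra.
  rewrite mulrCA [leRHS]mulrC; apply: ler_wpM2r; first by rewrite divr_ge0// exprn_ge0// ltW.
  have := I1 n; have := I0 n; rewrite -exprVn; set r := n.+1%:R^-1; clearbody r => r0 r1.
  have r2 : r ^+ 2 <= r by nra.
  have r3 : 0 <= r ^+ 2 by exact: sqr_ge0.
  by nra.
- exists 6 => //; near=> n; rewrite subr0 ger0_norm; last first.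
    by have /andP[] := normal_window_bounds (x + n.+1%:R^-1) n.+1%:R y (Sn n).
  apply: (@le_trans _ _ (6 * ((n.+1%:R ^- 2) ^+ 2 / (n.+1%:R^-1) ^+ 2))).
    apply: normal_far => // u /=; rewrite in_itv/= => /andP[h1 h2].
    move: (I0 n) h1; set r := n.+1%:R^-1; clearbody r => h0 h1.
    by rewrite ger0_norm; lra.
  rewrite ler_pM2l// -exprVn.
  set r := n.+1%:R^-1; have r0 : 0 < r := I0 n; have r1 : r <= 1 := I1 n.
  have -> : (r ^+ 2) ^+ 2 / r ^+ 2 = r ^+ 2 by rewrite expr2 mulfK// expf_neq0// gt_eqF.
  nra.
Unshelve. all: by end_near. Qed.

End NormalWindow.

(** * Recovering a tail from its smoothed densities *)

Section WindowIntegral.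
Context {R : realType} (m : {sigma_finite_measure set (measurableTypeR R) -> \bar R}).
Notation mu := (@lebesgue_measure R).
Implicit Types (s t u x y p q : R) (w : R -> R).

Lemma measurable_normal_shift s (D : set R) w :
  measurable (D : set (measurableTypeR R)) -> measurable_fun setT w ->
  measurable_fun setT (fun z : measurableTypeR R * measurableTypeR R =>
    (cst (1 : R) \_ D) z.1 * (normal_pdf 0 s (z.2 - z.1) * w z.2)).
Proof.
move=> mD mw; apply: measurable_funM.
  apply: measurableT_comp measurable_fst.
  apply/(measurable_restrictT _ mD); exact: measurable_cst.
apply: measurable_funM; last exact: measurableT_comp mw measurable_snd.
apply: measurableT_comp; first exact: measurable_normal_pdf.
by apply: measurable_funB; [exact: measurable_snd|exact: measurable_fst].
Qed.

Lemma normal_pdf_shift u s y : s != 0 -> normal_pdf 0 s (y - u) = normal_pdf u s y.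
Proof. by move=> s0; rewrite !normal_pdfE2// subr0. Qed.

Lemma integrable_normal_mul w s u : s != 0 -> m.-integrable setT (EFin \o w) ->
  m.-integrable setT (EFin \o (fun y => normal_pdf u s y * w y)).
Proof.
move=> s0 iw.
have mw : measurable_fun setT w by have /integrableP[/measurable_EFinP] := iw.
have := integrable_realZ (normal_peak s) measurableT (integrable_norm iw).
move=> h; apply: (le_integrable _ _ _ h) => //.
  apply/measurable_EFinP; apply: measurable_funM => //; exact: measurable_normal_pdf.
move=> y _; rewrite /= lee_fin !normrM normr_id ler_wpM2r//.
by rewrite !ger0_norm ?normal_pdf_ge0 ?normal_peak_ge0// normal_pdf_ub.
Qed.

Lemma window_fubini w s p q : 0 < s -> m.-integrable setT (EFin \o w) ->
  [/\ mu.-integrable `[p, q] (EFin \o smooth_density m w s),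
   measurable_fun setT ((fun y => normal_window s p q y * w y) : measurableTypeR R -> R) &
   \int[mu]_(u in `[p, q]) smooth_density m w s u =
   \int[m]_y (normal_window s p q y * w y)].
Proof.
move=> s0 iw; have sn : s != 0 by rewrite gt_eqF.
have mw : measurable_fun setT w by have /integrableP[/measurable_EFinP] := iw.
pose D : set R := `[p, q]%classic.
have mD : measurable (D : set (measurableTypeR R)) by exact: measurable_itv.
pose f (z : measurableTypeR R * measurableTypeR R) : R :=
  (cst (1 : R) \_ D) z.1 * (normal_pdf 0 s (z.2 - z.1) * w z.2).
have mf : measurable_fun setT f by exact: measurable_normal_shift.
(* Both inner integrals have to be measurable, and [RFubini_dominated] provides one per order of the
   variables. *)
have mf' : measurable_fun setT (fun z : measurableTypeR R * measurableTypeR R => f (z.2, z.1)).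
  exact: measurableT_comp mf (@measurable_swap _ _ _ _).
pose a u : R := (cst (1 : R) \_ D) u.
pose b y : R := normal_peak s * `|w y|.
have a0 u : 0 <= a u by rewrite /a patchE; case: ifP.
have ia : mu.-integrable setT (EFin \o a).
  rewrite -restrict_EFin; apply/integrable_restrict => //; rewrite setTI.
  apply: continuous_compact_integrable; first exact: segment_compact.
  by apply: continuous_subspaceT => t; exact: cvg_cst.
have ib : m.-integrable setT (EFin \o b) by exact: integrable_realZ _ _ (integrable_norm iw).
have fab u y : `|f (u, y)| <= a u * b y.
  rewrite /f/= normrM (ger0_norm (a0 u)) ler_wpM2l// normrM ler_wpM2r//.
  by rewrite ger0_norm ?normal_pdf_ge0// normal_pdf_ub.
have fba y u : `|(fun z : measurableTypeR R * measurableTypeR R => f (z.2, z.1)) (y,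
    u)| <= b y * a u.
  by rewrite mulrC; exact: fab.
have [F1 M1] := @RFubini_dominated _ _ _ _ R mu m f a b mf ia ib fab.
have [_ M2] := @RFubini_dominated _ _ _ _ R m mu _ b a mf' ib ia fba.
have E1 y : \int[mu]_u f (u, y) = normal_window s p q y * w y.
  have i1 : mu.-integrable `[p, q] (EFin \o (fun u => normal_pdf u s y)).
    apply: (@integrableS _ _ _ mu setT) => //.
    have := @integrable_normal_pdf R y s; apply: eq_integrable => // u _.
    by rewrite /= normal_pdf_sym.
  rewrite /normal_window mulrC -RintegralZl// [RHS]Rintegral_mkcond.
  apply: eq_Rintegral => u _; rewrite /f/= !patchE.
  by case: ifP => _; rewrite ?mul0r// mul1r normal_pdf_shift// mulrC.
have E2 u : \int[m]_y f (u, y) = (smooth_density m w s \_ D) u.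
  have i1 := integrable_normal_mul u sn iw.
  transitivity (\int[m]_y (a u * (normal_pdf u s y * w y))).
    by apply: eq_Rintegral => y _; rewrite /f /a/= normal_pdf_shift.
  rewrite RintegralZl// /a !patchE; case: ifP => _; first by rewrite mul1r.
  by rewrite mul0r.
split.
- have : mu.-integrable setT (EFin \o (fun u => \int[m]_y f (u, y))).
    have h := integrable_realZ (\int[m]_y b y) measurableT ia.
    apply: (le_integrable _ _ _ h) => //.
      exact/measurable_EFinP.
    move=> u _; rewrite /= lee_fin.
    have ifu : m.-integrable setT (EFin \o (fun y => f (u, y))).
      have i1 := integrable_realZ (a u) measurableT (integrable_normal_mul u sn iw).
      by apply: eq_integrable i1 => // y _; rewrite /f /a/= normal_pdf_shift.
    rewrite (le_trans (le_normr_Rintegral measurableT ifu))// ger0_norm; last first.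
      by rewrite mulr_ge0// Rintegral_ge0// => y _; rewrite mulr_ge0// normal_peak_ge0.
    rewrite mulrC -RintegralZl//.
    apply: le_Rintegral => //; first exact: integrable_norm.
    exact: integrable_realZ.
  rewrite (_ : EFin \o _ = (EFin \o smooth_density m w s) \_ D); last first.
    by rewrite restrict_EFin; apply/funext => u /=; rewrite E2.
  by move/integrable_restrict => /(_ mD measurableT); rewrite setTI.
- by move: M1; under eq_fun do rewrite E1.
- rewrite Rintegral_mkcond -[LHS](_ : \int[mu]_u (\int[m]_y f (u, y)) = _).
    by rewrite F1; apply: eq_Rintegral => y _; exact: E1.
  by apply: eq_Rintegral => u _; exact: E2.
Qed.

(** Fubini moves the window onto the normal density; the resulting factor [normal_window] lies in
    [0, 1], so |w| dominates while smoothing and window are removed together. *)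
Lemma window_tail_cvg w x : m.-integrable setT (EFin \o w) ->
  (\int[mu]_(u in `[(x + n.+1%:R^-1)%R, n.+1%:R]) smooth_density m w (n.+1%:R ^- 2) u)
    @[n --> \oo] --> \int[m]_(y in `]x, +oo[) w y.
Proof.
move=> iw.
have mw : measurable_fun setT w by have /integrableP[/measurable_EFinP] := iw.
have S0 n : 0 < n.+1%:R ^- 2 :> R by rewrite invr_gt0 exprn_gt0.
have Sn n : n.+1%:R ^- 2 != 0 :> R by rewrite gt_eqF.
pose D : set R := `]x, +oo[%classic.
have mD : measurable (D : set (measurableTypeR R)) by exact: measurable_itv.
rewrite (_ : (fun n => _) = (fun n => \int[m]_y
    (normal_window (n.+1%:R ^- 2) (x + n.+1%:R^-1) n.+1%:R y * w y))); last first.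
  by apply/funext => n; have [] := window_fubini (x + n.+1%:R^-1) n.+1%:R (S0 n) iw.
have -> : \int[m]_(y in `]x, +oo[) w y = \int[m]_y (((x < y)%R%:R : R) * w y).
  rewrite Rintegral_mkcond; apply: eq_Rintegral => y _; rewrite patchE.
  have -> : (y \in D) = (x < y)%R.
    by apply/idP/idP; rewrite inE /D/= in_itv/= andbT.
  by case: (x < y)%R; rewrite ?mul1r ?mul0r.
have [||||||_] := @Rdominated_convergence _ _ _ m setT
    (fun n y => normal_window (n.+1%:R ^- 2) (x + n.+1%:R^-1) n.+1%:R y * w y)
    (fun y => ((x < y)%R%:R : R) * w y) (fun y => `|w y|) => //.
- by move=> n; have [] := window_fubini (x + n.+1%:R^-1) n.+1%:R (S0 n) iw.
- apply: measurable_funM => //.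
  rewrite (_ : (fun y => _) = (cst (1 : R) \_ D)).
    by apply/(measurable_restrictT _ mD); exact: measurable_cst.
  apply/funext => y; rewrite patchE.
  have -> : (y \in D) = (x < y)%R.
    by apply/idP/idP; rewrite inE /D/= in_itv/= andbT.
  by case: (x < y)%R.
- move=> y _; apply: cvgM; last exact: cvg_cst.
  exact: normal_window_cvg.
- exact: integrable_norm.
- move=> n y _; rewrite normrM ler_piMl//.
  have /andP[h1 h2] := normal_window_bounds (x + n.+1%:R^-1) n.+1%:R y (Sn n).
  by rewrite ger0_norm.
Qed.

End WindowIntegral.

(** * Integrating a density estimate to a tail estimate *)

Section TailComparison.
Context {R : realType} (m : {sigma_finite_measure set (measurableTypeR R) -> \bar R}).
Notation mu := (@lebesgue_measure R).
Implicit Types (s t u x y p q v A : R) (w : R -> R).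

Lemma integral_exp_le A v p q : 0 <= A -> 0 < v -> p < q ->
  mu.-integrable `[p, q] (EFin \o (fun u => A * expR (- v * u))) /\
  \int[mu]_(u in `[p, q]) (A * expR (- v * u)) <= A * expR (- v * p) / v.
Proof.
move=> A0 v0 pq.
have v1 : v != 0 by rewrite gt_eqF.
have ch : continuous (fun u : R => A * expR (- v * u)).
  by move=> t; apply: cvgM; [exact: cvg_cst|exact: continuous_expRM].
split.
  apply: continuous_compact_integrable; first exact: segment_compact.
  exact: continuous_subspaceT.
pose P t := - (A / v) * expR (- v * t).
have dP t : is_derive t (1 : R) P (A * expR (- v * t)).
  have d1 := is_derive_expRM (- v) t.
  have d : is_derive t (1 : R) P (- (A / v) * (- v * expR (- v * t))).
    by apply: is_derive_eq; rewrite /GRing.scale/=; ring.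
  by apply: (is_derive_eq d); field.
have -> : \int[mu]_(t in `[p, q]) (A * expR (- v * t)) = P q - P p.
  by apply: Rintegral_FTC => // x _; exact: ch.
rewrite /P.
have : 0 <= A / v * expR (- v * q) by rewrite mulr_ge0 ?expR_ge0// divr_ge0// ltW.
have -> : A * expR (- v * p) / v = A / v * expR (- v * p) by rewrite mulrAC.
by move=> h; lra.
Qed.

(** The windows start to the right of [x] and their deviations are at most 1, so the hypothesis
    applies throughout; integrating the exponential yields the factor 1 / v, and the 2 is that of
    [cmod_cint_le]. *)
Theorem tail_comparison w w1 w2 (b c : R[i]) (A v x : R) :
  m.-integrable setT (EFin \o w) -> mu.-integrable setT (EFin \o w1) ->
  mu.-integrable setT (EFin \o w2) -> 0 <= A -> 0 < v ->
  (forall s u, 0 < s <= 1 -> x <= u ->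
    cmod ((smooth_density m w s u)%:C - b * (smooth_density mu w1 s u)%:C -
    c * (smooth_density mu w2 s u)%:C) <= A * expR (- v * u)) ->
  cmod ((\int[m]_(y in `]x, +oo[) w y)%:C - b * (\int[mu]_(y in `]x, +oo[) w1 y)%:C -
    c * (\int[mu]_(y in `]x, +oo[) w2 y)%:C) <= 2 * (A * expR (- v * x) / v).
Proof.
move=> iw iw1 iw2 A0 v0 h.
pose p n : R := x + n.+1%:R^-1; pose q n : R := n.+1%:R; pose s n : R := n.+1%:R ^- 2.
have s01 n : 0 < s n <= 1.
  by rewrite /s invr_gt0 exprn_gt0//= invf_le1 ?exprn_gt0// exprn_ege1// ler1n.
have s0 n : 0 < s n by have /andP[] := s01 n.
pose J (m' : {sigma_finite_measure set (measurableTypeR R) -> \bar R}) (w' : R -> R) (n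
    : nat) : R :=
  \int[mu]_(u in `[p n, q n]) smooth_density m' w' (s n) u.
have cJ (m' : {sigma_finite_measure set (measurableTypeR R) -> \bar R}) (w' : R -> R) :
    m'.-integrable setT (EFin \o w') ->
    ((J m' w' n)%:C : R[i]^o) @[n --> \oo] --> ((\int[m']_(y in `]x, +oo[) w' y)%:C : R[i]^o).
  by move=> iw'; apply: cvg_realC; exact: window_tail_cvg.
pose X n := (J m w n)%:C - b * (J mu w1 n)%:C - c * (J mu w2 n)%:C.
set D := _ - c * _.
have cX : (X n : R[i]^o) @[n --> \oo] --> (D : R[i]^o).
  by apply: cvgC_sub; [apply: cvgC_sub|]; try apply: cvgC_mull; exact: cJ.
have cX2 : cmod (X n) @[n --> \oo] --> cmod D.
  exact: (cvg_comp _ _ cX (@continuous_cmod R _)).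
apply: (ler_cvg_to cX2 (cvg_cst _)).
near=> n.
have pq : p n < q n.
  have : x + 1 <= n%:R by near: n; exact: nbhs_infty_ger.
  rewrite /p /q => h1.
  have : n.+1%:R^-1 <= 1 :> R by rewrite invf_le1// ler1n.
  have : n%:R < n.+1%:R :> R by rewrite ltr_nat.
  set r := n.+1%:R^-1; set r' := n.+1%:R; clearbody r r'; lra.
have [iE IE] := integral_exp_le A0 v0 pq.
have i (m' : {sigma_finite_measure set (measurableTypeR R) -> \bar R}) (w' : R -> R) :
    m'.-integrable setT (EFin \o w') ->
    cintegrable mu `[p n, q n] (fun u => (smooth_density m' w' (s n) u)%:C).
  by move=> iw'; apply: cintegrable_real => //; have [] := window_fubini (p n) (q n) (s0 n) iw'.
have i1 := i _ _ iw; have i2 := i _ _ iw1; have i3 := i _ _ iw2.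
have j2 : cintegrable mu `[p n, q n] (fun u => b * (smooth_density mu w1 (s n) u)%:C).
  exact: cintegrableZ.
have j3 : cintegrable mu `[p n, q n] (fun u => c * (smooth_density mu w2 (s n) u)%:C).
  exact: cintegrableZ.
have j12 : cintegrable mu `[p n, q n] (fun u => (smooth_density m w (s n) u)%:C -
    b * (smooth_density mu w1 (s n) u)%:C).
  exact: cintegrableB.
have -> : X n = cint mu `[p n, q n] (fun u => (smooth_density m w (s n) u)%:C -
    b * (smooth_density mu w1 (s n) u)%:C - c * (smooth_density mu w2 (s n) u)%:C).
  by rewrite cintB// cintB// !cintZ// !cint_real.
apply: (@le_trans _ _ (2 * \int[mu]_(u in `[p n, q n]) (A * expR (- v * u)))).
  apply: cmod_cint_le => //; first exact: cintegrableB.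
  move=> u /=; rewrite in_itv/= => /andP[pu _]; apply: h => //.
  by rewrite (le_trans _ pu)// /p lerDl invr_ge0.
rewrite ler_pM2l// (le_trans IE)//.
rewrite ler_pM2r ?invr_gt0// ler_wpM2l// ler_expR !mulNr lerN2 ler_pM2l//.
by rewrite /p lerDl invr_ge0.
Unshelve. all: by end_near. Qed.

End TailComparison.

(** * A region between the contour and the domain of analyticity *)

Section Cone.
Context {R : realType}.
Implicit Types (al delta k e x y t r l : R) (z s w : R[i]).

(** A subregion that is described without the argument and is closed except for its apex, so that
    its annuli are compact; it contains the half-planes used by the contour. *)
Definition cone k al : set R[i] :=
  [set z | z != al%:C /\ reC (z - al%:C) <= k * `|imC (z - al%:C)|].

Lemma lt_acos (t x : R) : 0 <= t <= pi -> -1 <= x <= 1 -> x < cos t -> t < acos x.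
Proof.
move=> tpi x1; rewrite -[X in X < _](acosK x1) ltr_cos// in_itv/=.
by rewrite acos_ge0// acos_lepi.
Qed.

Lemma Gdomain_lt_cos delta al z : 0 <= delta <= pi -> z != al%:C ->
  reC (z - al%:C) < cos delta * cmod (z - al%:C) -> Gdomain delta al z.
Proof.
move=> dpi zal; rewrite /Gdomain/=; set s := z - al%:C => h; split => //.
have s0 : s != 0 by rewrite subr_eq0.
have m0 := cmod_gt0 s0; have r1 := cmod_ratio s0.
have -> : `|carg s| = acos (reC s / cmod s).
  by rewrite /carg; case: ifP => _; rewrite ?normrN ger0_norm// acos_ge0.
by apply: lt_acos => //; rewrite ltr_pdivrMr.
Qed.

(** With s = z - al, the cone gives Re s <= (cos delta / 2) |s| < cos delta |s|, which says that the
    cosine of the argument is below cos delta. *)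
Lemma cone_Gdomain delta al z : 0 <= delta < pi / 2 ->
  cone (cos delta / 2) al z -> Gdomain delta al z.
Proof.
move=> /andP[d0 dpi] [zal h].
have pi0 := pi_gt0 R.
have c0 : 0 < cos delta by rewrite cos_gt0_pihalf//; apply/andP; split; lra.
apply: Gdomain_lt_cos => //; first by apply/andP; split; lra.
apply: (le_lt_trans h).
have s0 : z - al%:C != 0 by rewrite subr_eq0.
have := cmod_im (z - al%:C); have := cmod_gt0 s0.
by set m := cmod _; set y := `|_|; clearbody m y; nra.
Qed.

Lemma half_plane_cone k al v e z : 0 <= k -> v < al -> e ^+ 2 = 1 ->
  half_plane (k * e) v z -> cone k al z.
Proof.
move=> k0 val e2; rewrite /half_plane/= => h.
have e1 : `|e| = 1.
  have /eqP : `|e| ^+ 2 = 1 by rewrite -normrX e2 normr1.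
  by rewrite sqrp_eq1// => /eqP.
have h1 : k * e * imC z <= k * `|imC z|.
  by rewrite -mulrA ler_wpM2l// (le_trans (ler_norm _))// normrM e1 mul1r.
have h2 : reC z - al <= k * `|imC z| - (al - v) by lra.
split; last by rewrite reB imB re_real im_real subr0; lra.
apply/eqP => zal; move: h; rewrite zal re_real im_real mulr0 addr0; lra.
Qed.

Lemma cone_re_le k al v z : v < al ->
  reC z <= v + k * `|imC z| -> cone k al z.
Proof.
move=> val h; split; last by rewrite reB imB re_real im_real subr0; lra.
apply/eqP => zal; move: h; rewrite zal re_real im_real normr0 mulr0 addr0; lra.
Qed.

Lemma cone_slit k al x z : 0 <= x -> cone k al z -> slit_plane ((al + x)%:C - z).
Proof.
move=> x0 [zal h].
have [i0|i0] := eqVneq (imC z) 0; last first.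
  by apply: slit_plane_im; rewrite imB im_real sub0r oppr_eq0.
apply: slit_plane_re; rewrite reB re_real.
move: h; rewrite reB imB re_real im_real i0 subrr normr0 mulr0 => h.
have : reC z != al.
  by apply: contra zal => /eqP h1; apply/eqP/complex_eq; rewrite ?re_real ?im_real.
by rewrite neq_lt => /orP[|]; lra.
Qed.

(** With s = z - al: if Re s <= 0, moving right by x only increases the distance; otherwise Re s <=
    |Im s| / 2 and the imaginary part alone gives the lower bound. *)
Lemma cone_cmod_bounds k al x z : 0 <= k <= 1 / 2 -> 0 <= x -> cone k al z ->
  cmod (z - al%:C) / 2 <= cmod ((al + x)%:C - z) <= cmod (z - al%:C) + x.
Proof.
move=> /andP[k0 k2] x0 [_]; set s := z - al%:C => h.
have -> : (al + x)%:C - z = x%:C - s.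
  by apply: complex_eq; rewrite /s !(reB, imB) ?re_real ?im_real; ring.
clearbody s; apply/andP; split; last first.
  by rewrite (le_trans (cmodB _ _))// cmod_real ger0_norm// addrC.
rewrite ler_pdivrMr// -ler_sqr ?nnegrE ?cmod_ge0 ?mulr_ge0 ?cmod_ge0//.
rewrite exprMn !cmod_sqr reB imB re_real im_real.
have h1 : reC s <= `|imC s| / 2.
  by rewrite (le_trans h)// mulrC ler_wpM2l//; lra.
have h2 : imC s ^+ 2 = `|imC s| ^+ 2 by rewrite real_normK// num_real.
have := normr_ge0 (imC s).
rewrite sub0r sqrrN h2; move: h1; set a := reC s; set b := `|imC s|.
clearbody a b; move=> h1 b0.
have [a0|a0] := leP a 0; first by nra.
have : a ^+ 2 <= b ^+ 2 / 4 by nra.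
have := sqr_ge0 (x - a); nra.
Qed.

(** Writing x^(- l) = x^(- l - 1) x, the first factor is decreasing because -1 < l: away from the
    singularity the comparison functions grow at most linearly. *)
Lemma powR_le_lin l r x : -1 < l -> 0 < r -> r <= x -> x `^ (- l) <= r `^ (- l - 1) * x.
Proof.
move=> l1 r0 rx; have x0 : 0 < x by exact: lt_le_trans rx.
rewrite (powR_pred (- l) x0) ler_pM2r//.
have h : 0 <= l + 1 by lra.
have -> : - l - 1 = - (l + 1) by ring.
by rewrite !powRN lef_pV2 ?posrE ?powR_gt0// ge0_ler_powR// nnegrE ltW.
Qed.

(** Fills the gap between a small disc about the apex and the exterior region where [g] is assumed
    bounded: a continuous function is bounded on the compact annulus of the cone. *)
Lemma bounded_on_cone (k al r e0 : R) (f : R[i] -> R[i]) : 0 < r ->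
  (forall z, cone k al z -> {for z, continuous (f : R[i]^o -> R[i]^o)}) ->
  exists M, forall z, cone k al z -> r <= cmod (z - al%:C) <= e0 -> cmod (f z) <= M.
Proof.
move=> r0 cf.
pose L (p : R * R) : R[i]^o := (al + p.1) +i* p.2.
have cL : continuous L.
  move=> p; apply: continuous_mkC.
    apply: (@cvgD _ R^o _ _ _ (fun=> al) fst); first exact: cvg_cst.
    exact: cvg_fst.
  exact: cvg_snd.
pose n2 (p : R * R) : R := p.1 ^+ 2 + p.2 ^+ 2.
pose d (p : R * R) : R := k * `|p.2| - p.1.
have c1 : continuous (fst : R * R -> R) by move=> p; exact: cvg_fst.
have c2 : continuous (snd : R * R -> R) by move=> p; exact: cvg_snd.
have cn2 : continuous n2.
  by move=> p; apply: cvgD; apply: cvgM; (try exact: c1); exact: c2.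
have cd : continuous d.
  move=> p; apply: cvgB; last exact: c1.
  apply: cvgM; first exact: cvg_cst.
  by apply: cvg_norm; exact: c2.
(* The annulus in the real coordinates of z - al: [K] is closed, and the box [B] makes the
   intersection compact. *)
pose K : set (R * R) := (d @^-1` [set x | 0 <= x]) `&` (n2 @^-1` [set x | r ^+ 2 <= x]).
pose B : set (R * R) := `[- e0, e0]%classic `*` `[- e0, e0]%classic.
have cK : closed K.
  apply: closedI.
    by apply: (@preimage_closed _ _ d _ _ (@closed_ge _ 0)).
  by apply: (@preimage_closed _ _ n2 _ _ (@closed_ge _ (r ^+ 2))).
have kB : compact B by apply: compact_setX; exact: segment_compact.
have kA : compact (K `&` B).
  apply: (subclosed_compact _ kB); last by move=> p [].
  by apply: closedI => //; exact: compact_closed.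
have sE (p : R * R) : L p - al%:C = p.1 +i* p.2.
  by apply: complex_eq; rewrite ?reB ?imB ?re_mk ?im_mk ?re_real ?im_real; ring.
have Kcone p : K p -> cone k al (L p).
  move=> [/= h1 h2]; split; last first.
    by rewrite sE re_mk im_mk; move: h1; rewrite /d subr_ge0.
  rewrite -subr_eq0 sE; apply/eqP => h3.
  have e1 : p.1 = 0 by have := congr1 (fun z => reC z) h3.
  have e2 : p.2 = 0 by have := congr1 (fun z => imC z) h3.
  move: h2; rewrite /n2 e1 e2 expr0n/= addr0 leNgt exprn_gt0 //.
have cg : {within K `&` B, continuous (fun p => cmod (f (L p)))}.
  apply: continuous_in_subspaceT => p; rewrite inE => -[Kp _].
  apply: (@continuous_comp _ _ _ (fun p => f (L p) : R[i]^o) cmod); last exact: continuous_cmod.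
  apply: (@continuous_comp _ _ _ L (f : R[i]^o -> R[i]^o)); first exact: cL.
  exact: cf (Kcone _ Kp).
have KB z : cone k al z -> r <= cmod (z - al%:C) <= e0 ->
    (K `&` B) (reC (z - al%:C), imC (z - al%:C)) /\ L (reC (z - al%:C), imC (z - al%:C)) = z.
  move=> [zal h] /andP[rz ze]; split; last first.
    by apply: complex_eq; rewrite /L ?re_mk ?im_mk /= ?reB ?imB ?re_real ?im_real; ring.
  split; split; rewrite /=.
  - by rewrite /d subr_ge0.
  - by rewrite /n2/= -cmod_sqr ler_sqr// nnegrE ?cmod_ge0// ltW.
  - by rewrite in_itv/= -ler_norml (le_trans (cmod_re _)).
  - by rewrite in_itv/= -ler_norml (le_trans (cmod_im _)).
have [E|/set0P ne] := eqVneq (K `&` B) set0.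
  by exists 0 => z zc zr; have [h _] := KB z zc zr; rewrite E in h.
have [p0 _ hp] := compact_EVT_max ne kA cg.
exists (cmod (f (L p0))) => z zc zr; have [h {1}<-] := KB z zc zr.
by apply: hp; rewrite inE.
Qed.

End Cone.

(** * The residual near the singularity *)

Section Residual.
Context {R : realType}.
Implicit Types (k e x y t r h l eta : R) (z s w : R[i]).

Definition comp_mgf l x z : R[i] := cpow (x%:C - z) (- l) - cpow ((x + 1)%:C - z) (- l).

Definition residual (g : R[i] -> R[i]) (b c : R[i]) l x z : R[i] :=
  g z - b * comp_mgf l x z - c * comp_mgf l (x + 1) z.

Lemma derivable_cpow_sub x l z : slit_plane (x%:C - z) ->
  derivable ((fun z => cpow (x%:C - z) l) : R[i]^o -> R[i]^o) z 1.
Proof.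
move=> h; apply: (@derivable_compC _ (fun z => x%:C - z) (fun w => cpow w l)).
  by apply: derivableBC; [exact: derivable_cstC|exact: derivable_idC].
exact: derivable_cpow.
Qed.

Lemma derivable_comp_mgf l x z : slit_plane (x%:C - z) -> slit_plane ((x + 1)%:C - z) ->
  derivable (comp_mgf l x : R[i]^o -> R[i]^o) z 1.
Proof.
move=> h1 h2.
apply: (@derivableBC _ (fun z => cpow (x%:C - z) (- l)) (fun z => cpow ((x + 1)%:C - z) (- l)));
  exact: derivable_cpow_sub.
Qed.

Lemma powR2_neq1 l : l != 0 -> 1 - (2 : R) `^ (- l) != 0.
Proof.
move=> l0; rewrite subr_eq0 eq_sym /powR (gt_eqF (ltr0n R 2)).
rewrite -[X in _ != X]expR0 (inj_eq (@expR_inj R)) mulf_eq0 oppr_eq0 (negbTE l0)/=.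
by rewrite gt_eqF// ln_gt0// ltr1n.
Qed.

(* Near the singularity the constant terms cancel, whence the choice of the
   coefficient of the second comparison function. *)
Lemma residual_near (delta al l : R) (g : R[i] -> R[i]) (a b : R[i]) :
  l != 0 -> -1 < l ->
  (fun z : R[i]^o => cpow (al%:C - z) l * (g z - a) : R[i]^o)
    @ within (Gdomain delta al) (nbhs (al%:C : R[i]^o)) --> (b : R[i]^o) ->
  forall eta, 0 < eta -> exists2 r, 0 < r & forall z, Gdomain delta al z ->
    cmod (z - al%:C) < r ->
    cmod (residual g b ((a + b) / (1 - 2 `^ (- l))%:C) l al z) <=
      eta * cmod (z - al%:C) `^ (- l).
Proof.
move=> l0 l1 glim eta eta0; set c := (a + b) / _.
(* What remains of the residual once (al - z)^(- l) ((al - z)^l (g z - a) - b) is split off; it is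
   differentiable at [al]. *)
pose psi z := a + b * cpow ((al + 1)%:C - z) (- l) - c * comp_mgf l (al + 1) z.
have psi0 : psi al%:C = 0.
  have p1 : cpow ((al + 1)%:C - al%:C) (- l) = 1 :> R[i].
    have -> : (al + 1)%:C - al%:C = 1%:C :> R[i].
      by apply: complex_eq; rewrite ?reB ?imB ?re_real ?im_real; ring.
    by rewrite cpow_real// powR1.
  have p2 : cpow ((al + 1 + 1)%:C - al%:C) (- l) = (2 `^ (- l))%:C :> R[i].
    have -> : (al + 1 + 1)%:C - al%:C = 2%:C :> R[i].
      by apply: complex_eq; rewrite ?reB ?imB ?re_real ?im_real; ring.
    by rewrite cpow_real.
  rewrite /psi /comp_mgf p1 p2.
  have n0 : (1 - (2 : R) `^ (- l))%:C != 0 :> R[i].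
    by rewrite -cmod_eq0 cmod_real normr_eq0 powR2_neq1.
  have -> : 1 - (2 `^ (- l))%:C = (1 - (2 : R) `^ (- l))%:C :> R[i].
    by apply: complex_eq; rewrite ?reB ?imB ?re_real ?im_real ?re1 ?im1; ring.
  by rewrite /c divfK// mulr1 subrr.
have dpsi : derivable (psi : R[i]^o -> R[i]^o) al%:C 1.
  have s1 : slit_plane ((al + 1)%:C - al%:C).
    by apply: slit_plane_re; rewrite reB !re_real; lra.
  have s2 : slit_plane ((al + 1 + 1)%:C - al%:C).
    by apply: slit_plane_re; rewrite reB !re_real; lra.
  apply: (@derivableBC _ (fun z => a + b * cpow ((al + 1)%:C - z) (- l))
     (fun z => c * comp_mgf l (al + 1) z)).
    apply: (@derivableDC _ (fun=> a) (fun z => b * cpow ((al + 1)%:C - z) (- l))).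
      exact: derivable_cstC.
    apply: (@derivableMC _ (fun=> b) (fun z => cpow ((al + 1)%:C - z) (- l))).
      exact: derivable_cstC.
    exact: derivable_cpow_sub.
  apply: (@derivableMC _ (fun=> c) (comp_mgf l (al + 1))).
    exact: derivable_cstC.
  exact: derivable_comp_mgf.
have [p' hp] := derivable_cmod dpsi.
have [d d0 hd] := hp _ ltr01.
pose C := 1 + cmod p'.
have C0 : 0 < C by rewrite /C ltr_pwDl// cmod_ge0.
have psiC z : cmod (z - al%:C) < d -> cmod (psi z) <= C * cmod (z - al%:C).
  move=> /hd; rewrite psi0 subr0 mul1r => h.
  have -> : psi z = (psi z - p' * (z - al%:C)) + p' * (z - al%:C) by ring.
  by rewrite (le_trans (cmodD _ _))// /C mulrDl mul1r lerD// cmodM.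
have eta2 : 0 < eta / 2 by rewrite divr_gt0.
have l10 : 0 < l + 1 by lra.
(* Chosen so that C r1^(l + 1) = eta / 2, for C m = C m^(l + 1) m^(- l); this is where -1 < l
   enters. *)
pose r1 := (eta / 2 / C) `^ (l + 1)^-1.
have r10 : 0 < r1 by rewrite powR_gt0 ?divr_gt0.
move/cvg_cmodP : glim => /(_ _ eta2).
rewrite near_withinE => /nbhs_cmodP[r2 r20 hr2].
exists (Num.min d (Num.min r1 r2)); first by rewrite !lt_min d0 r10 r20.
move=> z Dz; rewrite !lt_min => /and3P[zd zr1 zr2].
have zal : z != al%:C by case: Dz.
have az : al%:C - z != 0 by rewrite subr_eq0 eq_sym.
have s0 : 0 < cmod (z - al%:C) by rewrite cmod_gt0// subr_eq0.
set m := cmod (z - al%:C) in s0 zd zr1 zr2 *.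
have -> : residual g b c l al z =
    (cpow (al%:C - z) (- l) * (cpow (al%:C - z) l * (g z - a) - b)) + psi z.
  rewrite /residual /psi /comp_mgf cpowN.
  rewrite [X in _ = X + _]mulrBr mulrA mulVf ?cpow_neq0//; ring.
rewrite (le_trans (cmodD _ _))//.
have -> : eta * m `^ (- l) = eta / 2 * m `^ (- l) + eta / 2 * m `^ (- l) by field.
apply: lerD.
  rewrite cmodM cmod_cpow// cmod_distC -/m mulrC ler_wpM2r ?powR_ge0//.
  by apply/ltW; exact: hr2.
rewrite (le_trans (psiC _ zd))// -/m.
have -> : C * m = C * m `^ (l + 1) * m `^ (- l).
  by rewrite -mulrA -powRD ?(gt_eqF s0) ?implybT// addrAC subrr add0r powRr1// ltW.
rewrite ler_wpM2r ?powR_ge0// -ler_pdivlMl// mulrC.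
rewrite (@le_trans _ _ (r1 `^ (l + 1)))//.
  by rewrite ge0_ler_powR ?nnegrE// ltW.
rewrite /r1 -powRrM mulVf ?gt_eqF// powRr1//.
by rewrite divr_ge0// ltW.
Qed.

End Residual.

(** * The residual away from the singularity and along the rays *)

Section ResidualBounds.
Context {R : realType}.
Implicit Types (k e x y t r h l eta al : R) (z s w : R[i]).

Lemma cmod_cpow_cone k al l r x z : 0 <= k <= 1 / 2 -> -1 < l -> 0 < r ->
  0 <= x <= 2 -> cone k al z -> r <= cmod (z - al%:C) ->
  cmod (cpow ((al + x)%:C - z) (- l)) <=
    (r / 2) `^ (- l - 1) * (cmod (z - al%:C) + 2).
Proof.
move=> k01 l1 r0 /andP[x0 x2] zc rz.
have /andP[h1 h2] := cone_cmod_bounds k01 x0 zc.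
have r2 : 0 < r / 2 by rewrite divr_gt0.
have rc : r / 2 <= cmod ((al + x)%:C - z).
  by rewrite (le_trans _ h1)// ler_pM2r// invr_gt0.
rewrite cmod_cpow; last first.
  by rewrite -cmod_eq0 gt_eqF// (lt_le_trans r2).
rewrite (le_trans (powR_le_lin l1 r2 rc))// ler_wpM2l ?powR_ge0//.
by rewrite (le_trans h2)// lerD2l.
Qed.

(** [g] is bounded by hypothesis beyond [e0] and by compactness from [r] to [e0], and the comparison
    functions grow at most linearly; as |z - al| >= r, constants are absorbed into a multiple of |z
    - al|. *)
Lemma residual_far k al l (g : R[i] -> R[i]) (b c : R[i]) (e0 M : R) :
  0 <= k <= 1 / 2 -> -1 < l ->
  (forall z, cone k al z -> {for z, continuous (g : R[i]^o -> R[i]^o)}) ->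
  (forall z, cone k al z -> e0 < cmod (z - al%:C) -> cmod (g z) <= M) ->
  forall r, 0 < r -> exists2 C, 0 <= C & forall z, cone k al z ->
    r <= cmod (z - al%:C) ->
    cmod (residual g b c l al z) <= C * cmod (z - al%:C).
Proof.
move=> k01 l1 cg gM r r0.
have [M1 gM1] := @bounded_on_cone _ k al r e0 g r0 cg.
pose M2 := `|M| + `|M1|; pose P := (r / 2) `^ (- l - 1).
pose B := 2 * (cmod b + cmod c) * P.
have P0 : 0 <= P by exact: powR_ge0.
have B0 : 0 <= B by rewrite !mulr_ge0 ?addr_ge0 ?cmod_ge0.
have M20 : 0 <= M2 by rewrite addr_ge0.
exists (M2 / r + B * (1 + 2 / r)).
  have r1 := ltW r0.
  apply: addr_ge0; first exact: divr_ge0.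
  by apply: mulr_ge0 => //; apply: addr_ge0 => //; exact: divr_ge0.
move=> z zc rz; set m := cmod (z - al%:C) in rz *.
have gz : cmod (g z) <= M2.
  have [ze|ze] := leP m e0.
    have := gM1 _ zc; rewrite -/m rz ze => /(_ isT) h.
    rewrite (le_trans h)// (le_trans (ler_norm _))// /M2 lerDr//.
  rewrite (le_trans (gM _ zc ze))// (le_trans (ler_norm _))// /M2 lerDl//.
have K0 : cmod (cpow (al%:C - z) (- l)) <= P * (m + 2).
  by rewrite -[al in al%:C]addr0; apply: cmod_cpow_cone zc rz => //; rewrite lexx ler0n.
have K1 : cmod (cpow ((al + 1)%:C - z) (- l)) <= P * (m + 2).
  by apply: cmod_cpow_cone zc rz => //; rewrite ler01 ler1n.
have K2 : cmod (cpow ((al + 1 + 1)%:C - z) (- l)) <= P * (m + 2).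
  rewrite -[al + 1 + 1]addrA; apply: cmod_cpow_cone zc rz => //.
  by apply/andP; split; lra.
have L0 : cmod (comp_mgf l al z) <= 2 * (P * (m + 2)).
  by rewrite /comp_mgf (le_trans (cmodB _ _))//; lra.
have L1 : cmod (comp_mgf l (al + 1) z) <= 2 * (P * (m + 2)).
  by rewrite /comp_mgf (le_trans (cmodB _ _))//; lra.
have N0 : cmod (b * comp_mgf l al z) <= cmod b * (2 * (P * (m + 2))).
  by rewrite cmodM ler_wpM2l ?cmod_ge0.
have N1 : cmod (c * comp_mgf l (al + 1) z) <= cmod c * (2 * (P * (m + 2))).
  by rewrite cmodM ler_wpM2l ?cmod_ge0.
have m1 : 1 <= m / r by rewrite ler_pdivlMr// mul1r.
have A1 : M2 <= M2 / r * m by rewrite -mulrA ler_peMr// mulrC.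
have A2 : B * (m + 2) <= B * (1 + 2 / r) * m.
  rewrite -mulrA ler_wpM2l// mulrDl mul1r lerD2l -mulrA ler_peMr//.
  by rewrite mulrC.
rewrite mulrDl; apply: (le_trans _ (lerD A1 A2)).
rewrite /residual (le_trans (cmodB _ _))//.
have : cmod (g z - b * comp_mgf l al z) <= M2 + cmod b * (2 * (P * (m + 2))).
  by rewrite (le_trans (cmodB _ _))// lerD.
have -> : B * (m + 2) = cmod b * (2 * (P * (m + 2))) + cmod c * (2 * (P * (m + 2))).
  by rewrite /B; ring.
lra.
Qed.

(** For l >= 0 the lower bound on [y] gives (2 x)^l. For l < 0 the upper bound gives x^l (1 + 2 x
    t)^(- l), and - l < 1 permits replacing this exponent by 1. The constant 2^l + 1 serves both
    cases. *)
Lemma powR_ray_le l x t y : -1 < l -> 0 < x -> 0 <= t ->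
  x^-1 / 2 <= y <= x^-1 + 2 * t ->
  y `^ (- l) <= (2 `^ l + 1) * x `^ l * (1 + 2 * x * t).
Proof.
move=> l1 x0 t0 /andP[y1 y2].
have h0 : 0 < x^-1 / 2 by rewrite divr_gt0 ?invr_gt0.
have y0 : 0 < y by exact: lt_le_trans y1.
have xl : 0 < x `^ l by exact: powR_gt0.
have p2 : 0 < (2 : R) `^ l by exact: powR_gt0.
have z0 : 0 <= 2 * x * t by rewrite !mulr_ge0// ltW.
have iv u : 0 <= u -> u^-1 `^ l = u `^ (- l).
  by move=> u0; rewrite -powR_inv1// -powRrM mulN1r.
have [l0|l0] := leP 0 l.
  have h : y `^ (- l) <= (2 * x) `^ l.
    have -> : 2 * x = (x^-1 / 2)^-1 by rewrite invfM !invrK mulrC.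
    rewrite (iv _ (ltW h0)) !powRN lef_pV2 ?posrE ?powR_gt0//.
    by rewrite ge0_ler_powR// nnegrE ltW.
  rewrite (le_trans h)// powRM ?(ltW x0)//.
  have := mulr_gt0 p2 xl; set A := 2 `^ l * x `^ l => A0.
  have -> : (2 `^ l + 1) * x `^ l = A + x `^ l by rewrite /A; ring.
  have : 0 <= (A + x `^ l) * (2 * x * t).
    by rewrite mulr_ge0// addr_ge0// ltW.
  by lra.
have l2 : 0 <= - l by rewrite oppr_ge0 ltW.
have h : y `^ (- l) <= (x^-1 * (1 + 2 * x * t)) `^ (- l).
  rewrite ge0_ler_powR ?nnegrE ?(ltW y0)//.
    by rewrite mulr_ge0 ?addr_ge0// invr_ge0 ltW.
  suff -> : x^-1 * (1 + 2 * x * t) = x^-1 + 2 * t by [].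
  by field; rewrite gt_eqF.
rewrite (le_trans h)// powRM ?addr_ge0 ?invr_ge0 ?(ltW x0)//.
have -> : x^-1 `^ (- l) = x `^ l.
  by rewrite -iv ?invr_ge0 ?(ltW x0)// invrK.
have h3 : (1 + 2 * x * t) `^ (- l) <= 1 + 2 * x * t.
  by apply: ler1_powR; lra.
have := ler_wpM2l (ltW xl) h3.
have : 0 <= 2 `^ l * (x `^ l * (1 + 2 * x * t)).
  apply: mulr_ge0; first exact: ltW.
  by apply: mulr_ge0; [exact: ltW|exact: addr_ge0].
have -> : (2 `^ l + 1) * x `^ l * (1 + 2 * x * t) =
  2 `^ l * (x `^ l * (1 + 2 * x * t)) + x `^ l * (1 + 2 * x * t) by ring.
by lra.
Qed.

Lemma ray_cmod_bounds k h e t : 0 <= k <= 1 / 2 -> e ^+ 2 = 1 -> 0 < h -> 0 <= t ->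
  [/\ h / 2 <= cmod ((t * k - h) +i* (t * e)), t <= cmod ((t * k - h) +i* (t * e)) &
      cmod ((t * k - h) +i* (t * e)) <= h + 2 * t].
Proof.
move=> /andP[k0 k1] e2 h0 t0; set s := _ +i* _.
have e1 : `|e| = 1.
  have /eqP : `|e| ^+ 2 = 1 by rewrite -normrX e2 normr1.
  by rewrite sqrp_eq1// => /eqP.
have im : `|imC s| = t by rewrite /s im_mk normrM e1 mulr1 ger0_norm.
have h1 := cmod_im s; have h2 := cmod_re s; have h3 := cmod_le_reim s.
rewrite im in h1 h3; rewrite /s re_mk -/s in h2 h3.
have tk : 0 <= t * k <= t / 2 by rewrite mulr_ge0//= ler_wpM2l//; lra.
have h4 := ler_norm (- (t * k - h)); rewrite normrN in h4.
have h5 : `|t * k - h| <= t * k + h.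
  by rewrite (le_trans (ler_normB _ _))// !ger0_norm//; [lra|lra].
by case/andP: tk => tk1 tk2; split=> //; lra.
Qed.

(** The far part must contribute no constant term, only a multiple of [t]: 2 / r <= x puts the start
    of the ray within r / 2 of [al], so at distance m >= r from it m <= 1 / x + 2 t <= m / 2 + 2 t,
    hence m <= 4 t. *)
Theorem ray_bound (H : R[i] -> R[i]) k al l r eta C x e t :
  0 <= k <= 1 / 2 -> -1 < l -> 0 < r -> 0 <= eta -> 0 <= C -> 0 < x -> 2 / r <= x ->
  (forall z, cone k al z -> cmod (z - al%:C) < r ->
    cmod (H z) <= eta * cmod (z - al%:C) `^ (- l)) ->
  (forall z, cone k al z -> r <= cmod (z - al%:C) ->
    cmod (H z) <= C * cmod (z - al%:C)) ->
  e ^+ 2 = 1 -> 0 <= t ->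
  cmod (H ((al - x^-1)%:C + t%:C * (k +i* e))) <=
    eta * (2 `^ l + 1) * x `^ l +
    (2 * (eta * (2 `^ l + 1) * x `^ l * x) + 4 * C) * t.
Proof.
move=> k01 l1 r0 eta0 C0 x0 rx near far e2 t0.
have h0 : 0 < x^-1 by rewrite invr_gt0.
set z := _ + _.
have reZ : reC z = al - x^-1 + t * k by rewrite /z reD reMr re_real re_mk.
have imZ : imC z = t * e by rewrite /z imD imMr im_real im_mk add0r.
have zc : cone k al z.
  apply: (@half_plane_cone _ k al (al - x^-1) e) => //; first by case/andP: k01.
    by lra.
  change (reC z <= al - x^-1 + k * e * imC z); rewrite reZ imZ.
  by have -> : k * e * (t * e) = t * k by rewrite -[RHS]mulr1 -e2; ring.
have E : z - al%:C = (t * k - x^-1) +i* (t * e).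
  apply: complex_eq; first by rewrite reB reZ re_real re_mk; ring.
  by rewrite imB imZ im_real im_mk subr0.
have [b1 b2 b3] := ray_cmod_bounds k01 e2 h0 t0.
rewrite -E in b1 b2 b3.
have A0 : 0 <= eta * (2 `^ l + 1) * x `^ l.
  by rewrite !mulr_ge0 ?addr_ge0 ?powR_ge0.
set A := eta * _ * _ in A0 *.
have x1 := ltW x0.
have [zr|rz] := ltP (cmod (z - al%:C)) r.
  rewrite (le_trans (near _ zc zr))//.
  have bb : x^-1 / 2 <= cmod (z - al%:C) <= x^-1 + 2 * t by rewrite b1.
  have := ler_wpM2l eta0 (powR_ray_le l1 x0 t0 bb).
  have -> : eta * ((2 `^ l + 1) * x `^ l * (1 + 2 * x * t)) = A + 2 * (A * x) * t.
    by rewrite /A; ring.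
  have : 0 <= 4 * C * t by rewrite !mulr_ge0.
  by move: (eta * _) => B; lra.
rewrite (le_trans (far _ zc rz))//.
have hx : x^-1 <= r / 2 by rewrite -[leRHS]invrK lef_pV2 ?posrE ?invr_gt0 ?divr_gt0// invf_div.
have : cmod (z - al%:C) <= 4 * t by lra.
move=> /(ler_wpM2l C0) h.
have : 0 <= 2 * (A * x) * t by clearbody A; rewrite !mulr_ge0.
by lra.
Qed.

End ResidualBounds.

(** * The tail estimate for a residual with small singularity *)

Section TailResidual.
Context {R : realType} (m : {sigma_finite_measure set (measurableTypeR R) -> \bar R}).
Notation mu := (@lebesgue_measure R).
Implicit Types (k e x y t r h l eta al : R) (z s w : R[i]).

Lemma horizontal_bound (H : R[i] -> R[i]) k al C v : 0 <= k <= 1 / 2 -> 0 <= v < al -> 0 <= C ->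
  (forall z, cone k al z -> 1 <= cmod (z - al%:C) ->
    cmod (H z) <= C * cmod (z - al%:C)) ->
  forall z, 0 <= reC z <= v + k * `|imC z| -> 1 <= `|imC z| ->
    cmod (H z) <= C * (al + 2) * `|imC z|.
Proof.
move=> /andP[k0 k1] /andP[v0 val] C0 far z /andP[z0 zv] iz.
have zc : cone k al z by exact: cone_re_le zv.
have iE : imC (z - al%:C) = imC z by rewrite imB im_real subr0.
have rE : reC (z - al%:C) = reC z - al by rewrite reB re_real.
have h1 := cmod_im (z - al%:C); have h2 := cmod_le_reim (z - al%:C).
rewrite iE in h1 h2; rewrite rE in h2.
rewrite (le_trans (far _ zc (le_trans iz h1)))// -mulrA ler_wpM2l// (le_trans h2)//.
have h3 : `|reC z - al| <= reC z + al.
  by rewrite (le_trans (ler_normB _ _))// !ger0_norm//; lra.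
have h4 : k * `|imC z| <= `|imC z| / 2 by rewrite mulrC ler_wpM2l//; lra.
have : al <= al * `|imC z| by rewrite ler_peMr//; lra.
have : v + k * `|imC z| <= al + `|imC z| / 2 by lra.
have := cmod_re (z - al%:C); rewrite rE.
have h5 : `|reC z - al| <= al + `|imC z| / 2.
  by rewrite ler_norml; apply/andP; split; lra. 
by lra.
Qed.

Theorem tail_residual (H : R[i] -> R[i]) (w w1 w2 : R -> R) (b c : R[i]) k al l :
  m.-integrable setT (EFin \o w) -> mu.-integrable setT (EFin \o w1) ->
  mu.-integrable setT (EFin \o w2) ->
  (forall t, H (0 +i* t) =
    char_fun m w t - b * char_fun mu w1 t - c * char_fun mu w2 t) ->
  0 < k <= 1 / 2 -> 0 < al -> -1 < l ->
  holomorphic_on (cone k al) H ->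
  (forall eta, 0 < eta -> exists2 r, 0 < r & forall z, cone k al z ->
    cmod (z - al%:C) < r -> cmod (H z) <= eta * cmod (z - al%:C) `^ (- l)) ->
  (forall r, 0 < r -> exists2 C, 0 <= C & forall z, cone k al z ->
    r <= cmod (z - al%:C) -> cmod (H z) <= C * cmod (z - al%:C)) ->
  forall eps, 0 < eps -> \forall x \near +oo,
    cmod ((\int[m]_(y in `]x, +oo[) w y)%:C - b * (\int[mu]_(y in `]x, +oo[) w1 y)%:C -
      c * (\int[mu]_(y in `]x, +oo[) w2 y)%:C) <= eps * decay l al x.
Proof.
move=> iw iw1 iw2 HE k01 al0 l1 hH near far eps eps0.
have /andP[k0 k1] := k01.
have k01' : 0 <= k <= 1 / 2 by rewrite ltW.
(* 16 collects the constants 8 and 2 of the density and tail bounds; exp (al^2) bounds exp (v^2),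
   exp 1 comes from exp (- v x) = exp 1 exp (- al x), and 2 / al bounds 1 / v. *)
pose E0 := 16 * expR (al ^+ 2) * expR 1 * (2 / al).
pose C1 : R := 2 `^ l + 1.
(* From p / (k x) + 2 p x / (k x)^2 = (p / x) (1 / k + 2 / k^2), the near part of the ray
   integral. *)
pose K := k^-1 + 2 / k ^+ 2.
have E00 : 0 < E0 by rewrite /E0 !mulr_gt0 ?expR_gt0 ?invr_gt0.
have C10 : 0 < C1 by rewrite ltr_wpDl ?powR_ge0.
have K0 : 0 < K by rewrite addr_gt0 ?divr_gt0 ?invr_gt0 ?exprn_gt0.
(* Makes the near part E0 eta C1 K exactly eps / 2. *)
pose eta := eps / (2 * E0 * C1 * K).
have eta0 : 0 < eta.
  apply: divr_gt0 => //; apply: mulr_gt0; last exact: K0.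
  by apply: mulr_gt0; [apply: mulr_gt0|exact: C10].
have [r r0 nearr] := near _ eta0.
have [C C0 farr] := far _ r0.
(* This constant serves the horizontal sides, whose contribution vanishes in the limit. *)
have [C' C'0 far1] := far _ ltr01.
pose C2 := 4 * C / k ^+ 2.
have C20 : 0 <= C2 by rewrite /C2 divr_ge0 ?mulr_ge0 ?exprn_ge0 ?(ltW k0).
have l10 : 0 < l + 1 by lra.
(* Beyond [X0] the far part E0 C2 / x^(l + 1) is at most eps / 2. *)
pose X0 := ((2 * E0 * C2 / eps) `^ (l + 1)^-1).
near=> x.
have x1 : 1 <= x by near: x; apply: nbhs_pinfty_ge; rewrite num_real.
have xr : 2 / r <= x by near: x; apply: nbhs_pinfty_ge; rewrite num_real.
have xal : 2 / al <= x by near: x; apply: nbhs_pinfty_ge; rewrite num_real.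
have xX : X0 <= x by near: x; apply: nbhs_pinfty_ge; rewrite num_real.
have x0 : 0 < x by exact: lt_le_trans x1.
have xi0 : 0 < x^-1 by rewrite invr_gt0.
pose v := al - x^-1.
have vh : x^-1 <= al / 2 by rewrite -[leRHS]invrK lef_pV2 ?posrE ?invr_gt0 ?divr_gt0// invf_div.
have v0 : 0 < v by rewrite /v; clear -vh al0; lra.
have val : v < al by rewrite /v; clear -xi0; lra.
pose p := eta * C1 * x `^ l; pose q := 2 * (p * x) + 4 * C.
have xl : 0 < x `^ l by exact: powR_gt0.
have p0 : 0 <= p.
  by apply: mulr_ge0; [apply: mulr_ge0|]; exact: ltW.
have q0 : 0 <= q.
  by apply: addr_ge0; apply: mulr_ge0 => //; exact: mulr_ge0 (ltW x0).
have kx : 0 < k * x by exact: mulr_gt0.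
pose A := 8 * (expR (v ^+ 2) * (p / (k * x) + q / (k * x) ^+ 2)).
have D0 : 0 <= p / (k * x) + q / (k * x) ^+ 2.
  by apply: addr_ge0; apply: divr_ge0 => //; rewrite ?exprn_ge0 ?(ltW kx).
have A0 : 0 <= A.
  by apply: mulr_ge0 => //; apply: mulr_ge0 => //; exact: expR_ge0.
have T : cmod ((\int[m]_(y in `]x, +oo[) w y)%:C - b * (\int[mu]_(y in `]x, +oo[) w1 y)%:C -
      c * (\int[mu]_(y in `]x, +oo[) w2 y)%:C) <= 2 * (A * expR (- v * x) / v).
  apply: tail_comparison => // s u s01 xu.
  have u0 : 0 < u by exact: lt_le_trans xu.
  have B := @smooth_density_bound R m H w w1 w2 b c k v s u p q (C' * (al + 2)) iw iw1 iw2 HE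
    k01 (ltW v0) s01 u0 p0 q0.
  have c1 : 0 <= C' * (al + 2) by exact: (mulr_ge0 C'0 (addr_ge0 (ltW al0) (ler0n _ 2))).
  have c2 e : e ^+ 2 = 1 -> holomorphic_on (half_plane (k * e) v) H.
    by move=> e2 z hz; apply: hH; exact: (half_plane_cone (ltW k0) val e2 hz).
  have c3 e t : e ^+ 2 = 1 -> 0 <= t -> cmod (H (v%:C + t%:C * (k +i* e))) <= p + q * t.
    by move=> e2 t0; exact: (ray_bound k01' l1 r0 (ltW eta0) C0 x0 xr nearr farr).
  have vv : 0 <= v < al by rewrite (ltW v0).
  apply: (le_trans (B c1 c2 c3 (horizontal_bound k01' vv C'0 far1))).
  have -> : A * expR (- v * u) =
      8 * (expR (v ^+ 2) * expR (- v * u) * (p / (k * x) + q / (k * x) ^+ 2)).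
    by rewrite /A; ring.
  rewrite ler_pM2l// ler_pM2l ?mulr_gt0 ?expR_gt0//.
  have ku : 0 < k * u by exact: mulr_gt0.
  have kk : k * x <= k * u by rewrite ler_pM2l.
  apply: lerD; apply: ler_wpM2l => //; rewrite lef_pV2 ?posrE ?exprn_gt0//.
  by rewrite ler_sqr// nnegrE ltW.
have xE : x `^ (l - 1) * x = x `^ l by rewrite -powR_pred.
set y := x `^ (l - 1) in xE.
have y0 : 0 < y by exact: powR_gt0.
(* The far part of the ray integral is of order x^(-2), smaller than the scale x^(l - 1) by the
   factor x^(- (l + 1)), which tends to 0 because -1 < l. *)
have x2 : (x `^ (l + 1))^-1 * y = (x ^+ 2)^-1.
  have -> : x `^ (l + 1) = y * x ^+ 2.
    by rewrite powRD ?(gt_eqF x0) ?implybT// powRr1 ?(ltW x0)// -xE; ring.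
  by rewrite invfM mulrAC mulVf ?gt_eqF// mul1r.
have DE : p / (k * x) + q / (k * x) ^+ 2 = y * (eta * C1 * K + C2 * (x `^ (l + 1))^-1).
  have -> : y * (eta * C1 * K + C2 * (x `^ (l + 1))^-1) =
    y * (eta * C1 * K) + C2 * ((x `^ (l + 1))^-1 * y) by ring.
  rewrite x2 /q /p -xE /K /C2; field.
  by rewrite !gt_eqF.
have small : E0 * (C2 * (x `^ (l + 1))^-1) <= eps / 2.
  have xl1 : 0 < x `^ (l + 1) by exact: powR_gt0.
  have h : 2 * E0 * C2 / eps <= x `^ (l + 1).
    have h0 : 0 <= 2 * E0 * C2 / eps.
      apply: divr_ge0; last exact: ltW.
      by apply: mulr_ge0 => //; apply: mulr_ge0 => //; exact: ltW.
    rewrite (@le_trans _ _ (X0 `^ (l + 1)))//.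
      by rewrite /X0 -powRrM mulVf ?gt_eqF// powRr1.
    by rewrite ge0_ler_powR ?nnegrE ?powR_ge0 ?(ltW l10) ?(ltW x0).
  rewrite mulrA ler_pdivrMr//.
  move: h; rewrite ler_pdivrMr// => h.
  have -> : eps / 2 * x `^ (l + 1) = x `^ (l + 1) * eps / 2 by ring.
  by move: h; generalize (x `^ (l + 1)) => X; clear; lra.
have big : E0 * (eta * C1 * K) = eps / 2.
  by rewrite /eta; field; rewrite !gt_eqF.
have eE : expR (- v * x) = expR 1 * expR (- al * x).
  by rewrite -expRD; congr expR; rewrite /v; field; rewrite gt_eqF.
have vinv : v^-1 <= 2 / al.
  have hv : al / 2 <= v by rewrite /v; clear -vh; lra.
  have h2 : 0 < al / 2 by rewrite divr_gt0.
  by rewrite -invf_div lef_pV2 ?posrE.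
have ev : expR (v ^+ 2) <= expR (al ^+ 2).
  by rewrite ler_expR ler_sqr ?nnegrE; [exact: ltW|exact: ltW|exact: ltW].
rewrite (le_trans T)//.
set W := y * (eta * C1 * K + C2 * (x `^ (l + 1))^-1) in DE.
have W0 : 0 <= W by rewrite -DE.
have ea0 := expR_gt0 (- al * x).
have e10 := expR_gt0 (1 : R).
have -> : 2 * (A * expR (- v * x) / v) =
    (16 * expR 1 * expR (- al * x) * W) * (expR (v ^+ 2) * v^-1).
  by rewrite eE /A DE; ring.
have : expR (v ^+ 2) * v^-1 <= expR (al ^+ 2) * (2 / al).
  by apply: ler_pM => //; rewrite ?expR_ge0// invr_ge0 ltW.
have Z0 : 0 <= 16 * expR 1 * expR (- al * x) * W.
  by clearbody W; rewrite !mulr_ge0 ?expR_ge0.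
move=> /(ler_wpM2l Z0) h; rewrite (le_trans h)//.
have -> : 16 * expR 1 * expR (- al * x) * W * (expR (al ^+ 2) * (2 / al)) =
    (E0 * (eta * C1 * K) + E0 * (C2 * (x `^ (l + 1))^-1)) * decay l al x.
  by rewrite /decay -/y /E0 /W; ring.
rewrite ler_wpM2r ?(ltW (decay_gt0 _ _ x0))//; rewrite big.
by clear -small; lra.
Unshelve. all: by end_near. Qed.

End TailResidual.

(** * Weights supported on a subset *)

Section Weights.
Context {R : realType} (m : {sigma_finite_measure set (measurableTypeR R) -> \bar R}).
Notation mu := (@lebesgue_measure R).
Implicit Types (t x y l : R) (w : R -> R) (D : set R).

Lemma integrable_restrictT w D : measurable (D : set (measurableTypeR R)) ->
  m.-integrable D (EFin \o w) -> m.-integrable setT (EFin \o (w \_ D)).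
Proof.
move=> mD iw; rewrite -restrict_EFin; apply/integrable_restrict => //.
by rewrite setTI.
Qed.

Lemma char_fun_restrict w D t : char_fun m (w \_ D) t =
  cint m D (fun y => (w y)%:C * cexp ((0 +i* t) * y%:C)).
Proof.
rewrite /char_fun /cint; congr (_ +i* _); rewrite [RHS]Rintegral_mkcond;
  by apply: eq_Rintegral => y _; rewrite !patchE; case: ifP => _ //;
     rewrite ?reMr ?imMr mul0r.
Qed.

Lemma tail_restrict w D x : measurable (D : set (measurableTypeR R)) ->
  `]x, +oo[ `<=` D ->
  \int[m]_(y in `]x, +oo[) (w \_ D) y = \int[m]_(y in `]x, +oo[) w y.
Proof.
move=> mD xD; apply: eq_Rintegral => y; rewrite inE => /xD yD.
by rewrite patchE mem_set.
Qed.

End Weights.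

(** * The comparison densities as weights on the whole line *)

Section ComparisonWeight.
Context {R : realType}.
Notation mu := (@lebesgue_measure R).
Implicit Types (t x y l : R).

Definition comp_weight l x : R -> R := comp_density l x \_ `]0, +oo[.

Lemma integrable_comp_weight l x : -1 < l -> 0 < x ->
  mu.-integrable setT (EFin \o comp_weight l x).
Proof.
by move=> l1 x0; apply: integrable_restrictT => //; exact: integrable_comp_density.
Qed.

(** The factor l of [comp_transform] is divided out, and Gamma (l + 1) / l = Gamma l. *)
Lemma char_fun_comp_weight l x t : -1 < l -> l != 0 -> 0 < x ->
  char_fun mu (comp_weight l x) t = (Gamma l)%:C * comp_mgf l x (0 +i* t).
Proof.
move=> l1 l0 x0; rewrite char_fun_restrict GammaE//.
have lC : l%:C != 0 :> R[i] by rewrite -cmod_eq0 cmod_real normr_eq0.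
apply: (mulfI lC); rewrite comp_transform// mulrA; congr (_ * _).
by apply: complex_eq; rewrite ?reMr ?imMr ?re_real ?im_real ?mulr0// mulrC divfK.
Qed.

Lemma comp_weight_tail_cvg l x : -1 < l -> 0 < x ->
  (\int[mu]_(y in `]t, +oo[) comp_weight l x y) / decay l x t @[t --> +oo] --> x^-1.
Proof.
move=> l1 x0; have h := comp_tail_cvg l1 x0.
have E : \forall t \near +oo, (\int[mu]_(y in `]t, +oo[) comp_density l x y) / decay l x t =
    (\int[mu]_(y in `]t, +oo[) comp_weight l x y) / decay l x t.
  near=> t; congr (_ / _); rewrite tail_restrict// => y /=.
  have t0 : 0 <= t by near: t; apply: nbhs_pinfty_ge; rewrite num_real.
  by rewrite !in_itv/= !andbT; exact: le_lt_trans.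
exact: cvg_trans (near_eq_cvg E) h.
Unshelve. all: by end_near. Qed.

Lemma decayS l x t : decay l (x + 1) t = decay l x t * expR (- t).
Proof. by rewrite /decay -mulrA -expRD; congr (_ * expR _); ring. Qed.

(** The rate x + 1 brings an additional factor exp (- t): the second comparison weight, introduced
    to correct the residual at the singularity, leaves no trace in the limit. *)
Lemma comp_weight_tail_cvg0 l x : -1 < l -> 0 < x ->
  (\int[mu]_(y in `]t, +oo[) comp_weight l (x + 1) y) / decay l x t @[t --> +oo] --> (0 : R).
Proof.
move=> l1 x0; have x10 : 0 < x + 1 by lra.
have h := comp_weight_tail_cvg l1 x10.
have e : expR (- t) @[t --> +oo] --> (0 : R) by exact: cvgr_expR.
have E : \forall t \near +oo,
    (\int[mu]_(y in `]t, +oo[) comp_weight l (x + 1) y) / decay l (x + 1) t * expR (- t) =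
    (\int[mu]_(y in `]t, +oo[) comp_weight l (x + 1) y) / decay l x t.
  near=> t.
  have t0 : 0 < t by near: t; apply: nbhs_pinfty_gt; rewrite num_real.
  have d0 := decay_gt0 l x t0; have e0 := expR_gt0 (- t).
  by rewrite decayS; field; rewrite !gt_eqF.
rewrite -(mulr0 (x + 1)^-1).
exact: cvg_trans (near_eq_cvg E) (cvgM h e).
Unshelve. all: by end_near. Qed.

End ComparisonWeight.

(** * Error terms in the quotient of tails *)

Section RatioError.
Context {R : realType}.
Implicit Types (x e : R) (z : R[i]).

Lemma realCM (x1 x2 : R) : (x1 * x2)%:C = x1%:C * x2%:C :> R[i].
Proof. by apply: complex_eq; rewrite ?reMr ?imMr// mulr0. Qed.

Lemma realCB (x1 x2 : R) : (x1 - x2)%:C = x1%:C - x2%:C :> R[i].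
Proof. by apply: complex_eq; rewrite ?reB ?imB ?re_real ?im_real ?subr0. Qed.

Lemma realCV x : x != 0 -> x^-1%:C = (x%:C)^-1 :> R[i].
Proof.
move=> x0; have xC : x%:C != 0 :> R[i] by rewrite -cmod_eq0 cmod_real normr_eq0.
by apply: (mulfI xC); rewrite -realCM !mulfV.
Qed.

Lemma cmodM_real_le z x e : `|x| < e / (1 + cmod z) -> cmod (z * x%:C) <= e.
Proof.
have z0 : 0 < 1 + cmod z by rewrite ltr_pwDl// cmod_ge0.
rewrite ltr_pdivlMr// cmodM cmod_real mulrDr mulr1 mulrC => /ltW.
by apply: le_trans; rewrite lerDr.
Qed.

(** Three errors of size e: the residual, the distance of the first comparison tail from its limit,
    and the second comparison tail. *)
Lemma cmod_ratio_le (N T1 T2 d u : R) (b c : R[i]) e : 0 < d ->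
  cmod (N%:C - b * T1%:C - c * T2%:C) <= e * d ->
  `|u - T1 / d| < e / (1 + cmod b) -> `|0 - T2 / d| < e / (1 + cmod c) ->
  cmod ((N / d)%:C - b * u%:C) <= 3 * e.
Proof.
move=> d0 h0 h1 h2.
have -> : (N / d)%:C - b * u%:C = (N%:C - b * T1%:C - c * T2%:C) * d^-1%:C -
    b * (u - T1 / d)%:C - c * (0 - T2 / d)%:C.
  by rewrite !realCB !realCM; ring.
have k0 : cmod ((N%:C - b * T1%:C - c * T2%:C) * d^-1%:C) <= e.
  rewrite cmodM cmod_real ger0_norm ?invr_ge0 ?(ltW d0)//.
  by rewrite ler_pdivrMr.
have k1 := cmodM_real_le h1; have k2 := cmodM_real_le h2.
have -> : 3 * e = e + e + e by ring.
apply: (le_trans (cmodB _ _)); apply: lerD k2.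
by apply: (le_trans (cmodB _ _)); exact: lerD.
Qed.

End RatioError.

(** * Application of the residual estimate to the measure *)

Theorem lemma6p3 (R : realType)
    (nu : {finite_measure set (measurableTypeR R) -> \bar R})
    (nu_supp : nu `]-oo, 0[%classic = 0%E)
    (alpha delta : R) (alpha_gt0 : 0 < alpha)
    (delta_ge0 : 0 <= delta) (delta_lt : delta < pi / 2)
    (g : R[i] -> R[i])
    (g_mgf : forall z : R[i], complex.Re z <= 0 -> g z = mgf nu z)
    (g_analytic : holomorphic_on (Gdomain delta alpha) g)
    (g_bounded : exists eps0 : R, 0 < eps0 /\
       exists M : R, forall z : R[i], Gdomain delta alpha z ->
         eps0 < cmod (z - alpha%:C) -> cmod (g z) <= M)
    (a b : R[i]) (lambda : R) (lambda_neq0 : lambda != 0)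
    (lambda_gt : -1 < lambda)
    (g_lim :
       (fun z : R[i]^o => cpow (alpha%:C - z) lambda * (g z - a) : R[i]^o)
         @ within (Gdomain delta alpha) (nbhs (alpha%:C : R[i]^o))
       --> (b : R[i]^o)) :
  (fun x : R =>
     (fine (nu `]x, +oo[%classic) / (x `^ (lambda - 1) * expR (- alpha * x)))%:C
       : R[i]^o)
    @ +oo --> (b * (alpha^-1 / Gamma lambda)%:C : R[i]^o).
Proof.
have k01 : 0 < cos delta / 2 <= 1 / 2.
  have pi0 := pi_gt0 R.
  have c0 : 0 < cos delta by rewrite cos_gt0_pihalf//; apply/andP; split; lra.
  by have := cos_le1 delta; lra.
set k := cos delta / 2 in k01.
have k01' : 0 <= k <= 1 / 2 by case/andP: k01 => h1 h2; rewrite ltW.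
have dpi : 0 <= delta < pi / 2 by rewrite delta_ge0.
have coneG z : cone k alpha z -> Gdomain delta alpha z by exact: cone_Gdomain.
have hg : holomorphic_on (cone k alpha) g by move=> z /coneG; exact: g_analytic.
set c := (a + b) / (1 - 2 `^ (- lambda))%:C : R[i].
pose H := residual g b c lambda alpha.
have a10 : 0 < alpha + 1 by lra.
have hH : holomorphic_on (cone k alpha) H.
  move=> z zc.
  have s0 : slit_plane (alpha%:C - z) by rewrite -[alpha]addr0; exact: (cone_slit _ zc).
  have s1 : slit_plane ((alpha + 1)%:C - z) by exact: (cone_slit _ zc).
  have s2 : slit_plane ((alpha + 1 + 1)%:C - z).
    by rewrite -addrA; apply: (cone_slit _ zc).
  apply: (@derivableBC _ (fun z => g z - b * comp_mgf lambda alpha z)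
    (fun z => c * comp_mgf lambda (alpha + 1) z)).
    apply: (@derivableBC _ g (fun z => b * comp_mgf lambda alpha z)); first exact: hg.
    apply: (@derivableMC _ (fun=> b) (comp_mgf lambda alpha)).
      exact: derivable_cstC.
    exact: derivable_comp_mgf.
  apply: (@derivableMC _ (fun=> c) (comp_mgf lambda (alpha + 1))).
    exact: derivable_cstC.
  exact: derivable_comp_mgf.
have near (eta : R) : 0 < eta -> exists2 r, 0 < r & forall z, cone k alpha z ->
    cmod (z - alpha%:C) < r -> cmod (H z) <= eta * cmod (z - alpha%:C) `^ (- lambda).
  move=> /(residual_near lambda_neq0 lambda_gt g_lim) [r r0 h].
  by exists r => // z zc; apply: h; exact: coneG.
have [eps0 [_ [M gM]]] := g_bounded.
have cg z : cone k alpha z -> {for z, continuous (g : R[i]^o -> R[i]^o)}.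
  by move=> zc; apply: derivable_continuousC; exact: hg.
have gM' z : cone k alpha z -> eps0 < cmod (z - alpha%:C) -> cmod (g z) <= M.
  by move=> /coneG; exact: gM.
have far (r : R) : 0 < r -> exists2 C, 0 <= C & forall z, cone k alpha z ->
    r <= cmod (z - alpha%:C) -> cmod (H z) <= C * cmod (z - alpha%:C).
  exact: (residual_far b c k01' lambda_gt cg gM').
pose D0 : set R := `[0, +oo[%classic.
(* The weight 1 on [0, +oo[, the range of integration in [mgf], makes [char_fun nu w] the transform
   of [nu]. *)
pose w : R -> R := cst (1 : R) \_ D0.
have mD0 : measurable (D0 : set (measurableTypeR R)) by exact: measurable_itv.
have iw : nu.-integrable setT (EFin \o w).
  apply: integrable_restrictT => //.
  exact: finite_measure_integrable_cst.
have iw1 := integrable_comp_weight lambda_gt alpha_gt0.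
have iw2 := integrable_comp_weight lambda_gt a10.
have G0 : (Gamma lambda)%:C != 0 :> R[i].
  by rewrite -cmod_eq0 cmod_real normr_eq0 Gamma_neq0.
(* On the imaginary axis the real part is 0, so [g] is given by the integral itself; the transforms
   of the comparison weights carry the factor Gamma (lambda), which is why [b] and [c] are divided
   by it. *)
have HE t : H (0 +i* t) = char_fun nu w t -
    b / (Gamma lambda)%:C * char_fun lebesgue_measure (comp_weight lambda alpha) t -
    c / (Gamma lambda)%:C * char_fun lebesgue_measure (comp_weight lambda (alpha + 1)) t.
  rewrite !char_fun_comp_weight// !mulrA !divfK//.
  rewrite /H /residual g_mgf// char_fun_restrict; congr (_ - _ - _).
  by apply: eq_cint => y _; rewrite mul1r.
have TR := tail_residual iw iw1 iw2 HE k01 alpha_gt0 lambda_gt hH near far.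
have nuE x : 0 <= x -> \int[nu]_(y in `]x, +oo[) w y = fine (nu `]x, +oo[%classic).
  move=> x0; rewrite tail_restrict//; last first.
    by move=> y; rewrite /D0/= !in_itv/= !andbT => xy; exact: ltW (le_lt_trans x0 xy).
  by rewrite Rintegral_cst// mul1r.
set b' := b / _ in TR; set c' := c / _ in TR.
have L1 := comp_weight_tail_cvg lambda_gt alpha_gt0.
have L2 := comp_weight_tail_cvg0 lambda_gt alpha_gt0.
apply/cvg_cmodP => e e0.
(* Three errors of e / 4 stay strictly below e. *)
have e4 : 0 < e / 4 by rewrite divr_gt0.
have B1 : 0 < 1 + cmod b' by rewrite ltr_pwDl// cmod_ge0.
have B2 : 0 < 1 + cmod c' by rewrite ltr_pwDl// cmod_ge0.
pose W1 := comp_weight lambda alpha; pose W2 := comp_weight lambda (alpha + 1).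
pose tails x : R[i] := (\int[nu]_(y in `]x, +oo[) w y)%:C -
  b' * (\int[lebesgue_measure]_(y in `]x, +oo[) W1 y)%:C -
  c' * (\int[lebesgue_measure]_(y in `]x, +oo[) W2 y)%:C.
have {}TR : \forall x \near +oo, cmod (tails x) <= e / 4 * decay lambda alpha x.
  exact: TR.
move/cvgrPdist_lt : L1 => /(_ _ (divr_gt0 e4 B1)) L1.
move/cvgrPdist_lt : L2 => /(_ _ (divr_gt0 e4 B2)) L2.
near=> x.
have x0 : 0 < x by near: x; apply: nbhs_pinfty_gt; rewrite num_real.
have d0 := decay_gt0 lambda alpha x0; rewrite -/(decay lambda alpha x).
have h0 : cmod (tails x) <= e / 4 * decay lambda alpha x by near: x.
have h1 : `|alpha^-1 - (\int[lebesgue_measure]_(y in `]x, +oo[) W1 y) / decay lambda alpha x| <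
    e / 4 / (1 + cmod b') by near: x; exact: L1.
have h2 : `|0 - (\int[lebesgue_measure]_(y in `]x, +oo[) W2 y) / decay lambda alpha x| <
    e / 4 / (1 + cmod c') by near: x; exact: L2.
rewrite /tails nuE ?(ltW x0)// in h0.
have -> : b * (alpha^-1 / Gamma lambda)%:C = b' * alpha^-1%:C.
  by rewrite realCM (realCV (Gamma_neq0 lambda_gt lambda_neq0)) mulrA mulrAC.
rewrite (le_lt_trans (cmod_ratio_le d0 h0 h1 h2))//.
by clear -e0; lra.
Unshelve. all: by end_near. Qed.
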